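(* Let $m$ be the two-parameter shuffle product $\sqcup\!\sqcup$ on $H$, let $\mathfrak{e}$ be the Eulerian idempotent of $(H,m,\Delta)$, and let $\mathrm{Log}:(H,m,\Delta)\to(H,\sqcup\!\sqcup_{\square},\Delta)$ be the unique bialgebra map induced by $\pi\circ\mathfrak{e}$, i.e. the unique unital coalgebra map with $\pi\circ\mathrm{Log}=\pi\circ\mathfrak{e}$ on the augmentation ideal. Then $\mathrm{Log}$ is an isomorphism, and its inverse $\mathrm{Exp}:(H,\sqcup\!\sqcup_{\square},\Delta)\to(H,m,\Delta)$ is recursively given by $\pi_k\circ\mathrm{Exp}\circ\pi_k=\pi_k$ for all $k\in\mathbb{N}$ and $$\pi_n\bigl(\mathrm{Exp}(\pi_k(\mathbf{a}))\bigr)=-\sum_{j=n}^{k-1}\pi_n\circ\mathrm{Exp}\circ\pi_j\circ\mathrm{Log}\circ\pi_k(\mathbf{a})$$ for all $\mathbf{a}\in H$ and all positive integers $n<k$. The same holds when $\sqcup\!\sqcup$ is replaced by the two-parameter quasi-shuffle product $\sqcup\!\sqcup^{\mathsf{qs}}$ (i.e. with $m=\sqcup\!\sqcup^{\mathsf{qs}}$).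
   Context: $\mathbb{K}$ is a commutative $\mathbb{Q}$-algebra, $d\ge 1$, and $(\mathfrak{M}_d,\star,\varepsilon)$ is the free commutative monoid generated by $d$ letters, with neutral element $\varepsilon$. A matrix composition is either the empty composition $\mathsf{e}$ (with $0$ rows and $0$ columns) or a matrix of size $m\times n$, $m,n\ge 1$, with entries in $\mathfrak{M}_d$ having no row and no column consisting only of $\varepsilon$. $\mathrm{Comp}$ is the set of matrix compositions and $H=\bigoplus_{\mathbf{a}\in\mathrm{Comp}}\mathbb{K}\mathbf{a}$. For $\mathbf{a},\mathbf{b}\in\mathrm{Comp}$, $\mathrm{diag}(\mathbf{a},\mathbf{b})$ is the block diagonal matrix with blocks $\mathbf{a},\mathbf{b}$ and all off-diagonal-block entries equal to $\varepsilon$; $\mathsf{e}$ is neutral for $\mathrm{diag}$; $\mathrm{diag}$ is extended multilinearly to $H$. A nonempty $\mathbf{c}\in\mathrm{Comp}$ is connected if $\mathbf{c}=\mathrm{diag}(\mathbf{a},\mathbf{b})$ implies $\mathbf{a}=\mathsf{e}$ or $\mathbf{b}=\mathsf{e}$. Every nonempty composition is uniquely $\mathrm{diag}(\mathbf{u}_1,\dots,\mathbf{u}_\ell)$ with all $\mathbf{u}_i$ connected; $\ell$ is its number of connected blocks. The coproduct $\Delta:H\to H\otimes H$ is linear with $\Delta(\mathsf{e})=\mathsf{e}\otimes\mathsf{e}$ and $\Delta(\mathrm{diag}(\mathbf{u}_1,\dots,\mathbf{u}_\ell))=\sum_{\alpha=0}^{\ell}\mathrm{diag}(\mathbf{u}_1,\dots,\mathbf{u}_\alpha)\otimes\mathrm{diag}(\mathbf{u}_{\alpha+1},\dots,\mathbf{u}_\ell)$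 for connected $\mathbf{u}_i$ (an empty $\mathrm{diag}$ is $\mathsf{e}$). The unit map is $\mu:\mathbb{K}\to H$, $1\mapsto\mathsf{e}$; the counit $\epsilon$ sends $\mathsf{e}\mapsto 1$ and every nonempty composition to $0$; the augmentation ideal is $\ker\epsilon$. Products on $H$ (all bilinear with neutral element $\mathsf{e}$): (1) Block shuffle $\sqcup\!\sqcup_{\square}$: $\mathrm{diag}(\mathbf{a},\mathbf{u})\sqcup\!\sqcup_{\square}\mathrm{diag}(\mathbf{b},\mathbf{v})=\mathrm{diag}(\mathbf{a},\mathbf{u}\sqcup\!\sqcup_{\square}\mathrm{diag}(\mathbf{b},\mathbf{v}))+\mathrm{diag}(\mathbf{b},\mathrm{diag}(\mathbf{a},\mathbf{u})\sqcup\!\sqcup_{\square}\mathbf{v})$ for connected $\mathbf{a},\mathbf{b}$ and $\mathbf{u},\mathbf{v}\in\mathrm{Comp}$. (2) Two-parameter shuffle $\sqcup\!\sqcup$: for nonempty $\mathbf{a}$ (size $m\times n$), $\mathbf{b}$ (size $s\times t$), $\mathbf{a}\sqcup\!\sqcup\mathbf{b}=\sum_{p\in\mathrm{sh}(m,s)}\sum_{q\in\mathrm{sh}(n,t)}(\mathrm{diag}(\mathbf{a},\mathbf{b})_{p^{-1}(u),q^{-1}(v)})_{u,v}$, where $\mathrm{sh}(m,s)$ is the set of permutations $q$ of $\{1,\dots,m+s\}$ with $q(1)<\dots<q(m)$ and $q(m+1)<\dots<q(m+s)$. (3) Two-parameter quasi-shuffle $\sqcup\!\sqcup^{\mathsf{qs}}$: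 for nonempty $\mathbf{a}$ (size $m\times n$), $\mathbf{b}$ (size $s\times t$), $\mathbf{a}\sqcup\!\sqcup^{\mathsf{qs}}\mathbf{b}=\sum_{j,k\ge1}\sum_{p\in\mathrm{qsh}(m,s;j)}\sum_{q\in\mathrm{qsh}(n,t;k)}\mathbf{c}^{p,q}$, where $\mathbf{c}^{p,q}$ is the $j\times k$ matrix with entries $\mathbf{c}^{p,q}_{x,y}=\bigstar_{u\in p^{-1}(x),\,v\in q^{-1}(y)}\mathrm{diag}(\mathbf{a},\mathbf{b})_{u,v}$, and $\mathrm{qsh}(m,s;j)$ is the set of surjections $q:\{1,\dots,m+s\}\to\{1,\dots,j\}$ with $q(1)<\dots<q(m)$ and $q(m+1)<\dots<q(m+s)$. With each of these products, $H$ together with $\Delta$ is a graded connected commutative Hopf algebra (graded by the total number of letters in the entries). For a product $m\in\{\sqcup\!\sqcup_{\square},\sqcup\!\sqcup,\sqcup\!\sqcup^{\mathsf{qs}}\}$ on $H$ and $f,g\in\mathrm{End}(H)$, the convolution is $f*g=m\circ(f\otimes g)\circ\Delta$. The Eulerian idempotent is $\mathfrak{e}=\log^*(\mathrm{id})=\sum_{k\ge1}\frac{(-1)^{k-1}}{k}(\mathrm{id}-\mu\circ\epsilon)^{*k}$ (a finite sum on each element). For $k\in\mathbb{N}$, $\pi_k:H\to H$ is the linear projection that fixes compositions with exactly $k$ connected blocks and sends all other compositions to $0$; $\pi:=\pi_1$ is the projection onto the span of connected compositions. By cofreeness of $(H,\Delta)$, a linear map $\psi:\ker\epsilon\to\pi(H)$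 determines a unique unital coalgebra map $\Psi:H\to H$ with $\pi\circ\Psi=\psi$ on $\ker\epsilon$, namely $\Psi(\mathsf{e})=\mathsf{e}$ and $\Psi=\sum_{n\ge1}\mathrm{diag}\circ\psi^{\otimes n}\circ\widetilde\Delta^{(n-1)}$ on $\ker\epsilon$, where $\widetilde\Delta^{(n-1)}$ is the iterated reduced coproduct ($\widetilde\Delta(\mathbf{b})=\Delta(\mathbf{b})-\mathbf{b}\otimes\mathsf{e}-\mathsf{e}\otimes\mathbf{b}$, $\widetilde\Delta^{(0)}=\mathrm{id}$). *)

(* Defs.v *)
From HB Require Import structures.
From mathcomp Require Import all_boot all_algebra perm.
From mathcomp Require Import finmap boolp.
From mathcomp Require Import monalg.

Set Implicit Arguments.
Unset Strict Implicit.
Unset Printing Implicit Defensive.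

Import GRing.Theory.

Local Open Scope ring_scope.

Section MatrixCompositions.
Variable d : nat.
Local Notation Md := {cmonom 'I_d}.

(* When m = 0 or n = 0 this forces m = n = 0, since a row of a matrix without
   columns (or a column of a matrix without rows) is trivial. *)
Definition is_comp m n (A : 'M[Md]_(m, n)) : bool :=
  [forall i, exists j, A i j != mone] && [forall j, exists i, A i j != mone].

Lemma is_compP m n (A : 'M[Md]_(m, n)) :
  reflect ((forall i, exists j, A i j != mone) /\
           (forall j, exists i, A i j != mone)) (is_comp A).
Proof.
apply: (iffP andP) => -[/= H1 H2]; split.
- by move=> i; apply/existsP; move/forallP: H1.
- by move=> i; apply/existsP; move/forallP: H2.
- by apply/forallP => i; apply/existsP.
- by apply/forallP => i; apply/existsP.
Qed.

Record comp := Comp {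
  nrows : nat;
  ncols : nat;
  entries :> 'M[Md]_(nrows, ncols);
  compP : is_comp entries
}.

HB.instance Definition _ := gen_eqMixin comp.
HB.instance Definition _ := gen_choiceMixin comp.

Lemma is_comp0 : is_comp (const_mx mone : 'M[Md]_(0, 0)).
Proof. by apply/is_compP; split=> -[]. Qed.

Definition ecomp : comp := Comp is_comp0.

Lemma is_comp_diag (a b : comp) :
  is_comp (block_mx a (const_mx mone) (const_mx mone) b).
Proof.
have /is_compP[ra ca] := compP a; have /is_compP[rb cb] := compP b.
apply/is_compP; split=> i; case: (split_ordP i) => k ->.
- by have [j Hj] := ra k; exists (lshift _ j); rewrite block_mxEul.
- by have [j Hj] := rb k; exists (rshift _ j); rewrite block_mxEdr.
- by have [j Hj] := ca k; exists (lshift _ j); rewrite block_mxEul.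
- by have [j Hj] := cb k; exists (rshift _ j); rewrite block_mxEdr.
Qed.

Definition diag (a b : comp) : comp := Comp (is_comp_diag a b).

Definition diags (s : seq comp) : comp := foldr diag ecomp s.

Definition connected (c : comp) : Prop :=
  c <> ecomp /\ forall a b, c = diag a b -> a = ecomp \/ b = ecomp.

(* Entries extended by the neutral element outside the matrix. *)
Definition ext_entry (a : comp) (x y : nat) : Md :=
  if insub x is Some i then if insub y is Some j then a i j else mone else mone.

Lemma ext_entryE (a : comp) (i : 'I_(nrows a)) (j : 'I_(ncols a)) :
  ext_entry a i j = a i j.
Proof. by rewrite /ext_entry !valK. Qed.

Lemma ext_entry_out (a : comp) x y :
  ~~ ((x < nrows a) && (y < ncols a))%N -> ext_entry a x y = mone.
Proof.
rewrite /ext_entry; case: insubP => [i Hx _|//].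
by case: insubP => [j Hy _|//]; rewrite Hx Hy.
Qed.

Lemma comp_ext (a b : comp) : nrows a = nrows b -> ncols a = ncols b ->
  (forall x y, ext_entry a x y = ext_entry b x y) -> a = b.
Proof.
case: a b => [m n A HA] [m' n' B HB] /= em en; subst m' n' => H.
suff eAB : A = B by subst B; congr Comp; apply: bool_irrelevance.
by apply/matrixP => i j; move: (H i j); rewrite !ext_entryE.
Qed.

Lemma ext_entry_diag (a b : comp) x y : ext_entry (diag a b) x y =
  if (x < nrows a)%N && (y < ncols a)%N then ext_entry a x y
  else if (nrows a <= x)%N && (ncols a <= y)%N then
    ext_entry b (x - nrows a) (y - ncols a)
  else mone.
Proof.
case: (boolP ((x < nrows (diag a b)) && (y < ncols (diag a b)))%N); last first.
  move=> H; rewrite ext_entry_out //; case: ifP => [/andP[h1 h2]|_].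
    by case/negP: H; rewrite /= !ltn_addr.
  case: ifP => [/andP[h1 h2]|//]; rewrite ext_entry_out //.
  apply: contra H => /andP[/= k1 k2].
  by rewrite -(subnKC h1) -(subnKC h2) !ltn_add2l k1.
move=> /andP[hx hy].
have [i ->] : exists i : 'I_(nrows (diag a b)), x = i by exists (Ordinal hx).
have [j ->] : exists j : 'I_(ncols (diag a b)), y = j by exists (Ordinal hy).
rewrite ext_entryE.
case: (split_ordP i) => k ->; case: (split_ordP j) => l -> /=.
- by rewrite block_mxEul ext_entryE.
- by rewrite block_mxEur mxE leqNgt ltn_ord.
- by rewrite block_mxEdl mxE [X in _ && X]leqNgt ltn_ord andbF.
- by rewrite block_mxEdr !leq_addr /= !addKn ext_entryE.
Qed.

Lemma row_ex (a : comp) x : (x < nrows a)%N ->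
  exists2 y, (y < ncols a)%N & ext_entry a x y != mone.
Proof.
move=> hx; have /is_compP[ra _] := compP a.
by have [j Hj] := ra (Ordinal hx); exists j; rewrite // -ext_entryE in Hj *.
Qed.

Lemma col_ex (a : comp) y : (y < ncols a)%N ->
  exists2 x, (x < nrows a)%N & ext_entry a x y != mone.
Proof.
move=> hx; have /is_compP[_ ca] := compP a.
by have [j Hj] := ca (Ordinal hx); exists j; rewrite // -ext_entryE in Hj *.
Qed.

Lemma nrows_eq0 (a : comp) : nrows a = 0%N -> a = ecomp.
Proof.
move=> ra; have ca : ncols a = 0%N.
  by case E: (ncols a) => [//|n]; have [|x] := @col_ex a 0; rewrite ?E ?ra.
by apply: comp_ext => // x y; rewrite !ext_entry_out ?ra.
Qed.

Lemma diage0 (a : comp) : diag ecomp a = a.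
Proof. by apply: comp_ext => // x y; rewrite ext_entry_diag /= !subn0. Qed.

Lemma diag0e (a : comp) : diag a ecomp = a.
Proof.
apply: comp_ext; rewrite /= ?addn0 // => x y; rewrite ext_entry_diag.
case: ifP => // /negbT H; rewrite (ext_entry_out H).
by case: ifP => // _; rewrite ext_entry_out.
Qed.

Lemma diagA : associative diag.
Proof.
move=> a b c; apply: comp_ext; rewrite /= ?addnA // => x y.
rewrite !ext_entry_diag /= !subnDA.
case: (ltnP x (nrows a)) => hx; case: (ltnP y (ncols a)) => hy //=.
- by rewrite !ltn_addr.
- by rewrite [(nrows a + _ <= x)%N]leqNgt (ltn_addr _ hx) //= if_same.
- by rewrite [(ncols a + _ <= y)%N]leqNgt (ltn_addr _ hy) /= andbF if_same.
- by rewrite !ltn_subLR // !leq_subRL.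
Qed.

Lemma diag_split (c : comp) (m n : nat) : (m <= nrows c)%N -> (n <= ncols c)%N ->
  (forall x y, (x < m)%N -> (n <= y)%N -> ext_entry c x y = mone) ->
  (forall x y, (m <= x)%N -> (y < n)%N -> ext_entry c x y = mone) ->
  exists a b, [/\ c = diag a b, nrows a = m & ncols a = n].
Proof.
move=> hm hn Hur Hdl.
pose A : 'M[Md]_(m, n) := \matrix_(i, j) ext_entry c i j.
pose B : 'M[Md]_(nrows c - m, ncols c - n) :=
  \matrix_(i, j) ext_entry c (m + i) (n + j).
have cA : is_comp A.
  apply/is_compP; split=> i.
    have [y hy Hy] := row_ex (leq_trans (ltn_ord i) hm).
    have hyn : (y < n)%N.
      by rewrite ltnNge; apply: contra Hy => /(Hur _ _ (ltn_ord i)) ->.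
    by exists (Ordinal hyn); rewrite mxE.
  have [y hy Hy] := col_ex (leq_trans (ltn_ord i) hn).
  have hyn : (y < m)%N.
    by rewrite ltnNge; apply: contra Hy => /Hdl -> //.
  by exists (Ordinal hyn); rewrite mxE.
have cB : is_comp B.
  apply/is_compP; split=> i.
    have hi : (m + i < nrows c)%N by rewrite -ltn_subRL.
    have [y hy Hy] := row_ex hi.
    have hyn : (n <= y)%N.
      rewrite leqNgt; apply: contra Hy => hy'.
      by rewrite Hdl // leq_addr.
    have hy2 : (y - n < ncols c - n)%N by rewrite ltn_sub2r // (leq_ltn_trans hyn).
    by exists (Ordinal hy2); rewrite mxE /= subnKC.
  have hi : (n + i < ncols c)%N by rewrite -ltn_subRL.
  have [y hy Hy] := col_ex hi.
  have hyn : (m <= y)%N.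
    rewrite leqNgt; apply: contra Hy => hy'.
    by rewrite Hur // leq_addr.
  have hy2 : (y - m < nrows c - m)%N by rewrite ltn_sub2r // (leq_ltn_trans hyn).
  by exists (Ordinal hy2); rewrite mxE /= subnKC.
exists (Comp cA), (Comp cB); split=> //; apply: comp_ext; rewrite /= ?subnKC //.
move=> x y; rewrite ext_entry_diag /=.
case: (ltnP x m) => hx; case: (ltnP y n) => hy /=.
- by rewrite -[x]/(val (Ordinal hx)) -[y]/(val (Ordinal hy))
    (ext_entryE (a := Comp cA)) mxE.
- by rewrite Hur.
- by rewrite Hdl.
- have [/andP[h1 h2]|h] :=
    boolP ((x - m < nrows c - m) && (y - n < ncols c - n))%N.
    rewrite -[(x - m)%N]/(val (Ordinal h1)) -[(y - n)%N]/(val (Ordinal h2)).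
    by rewrite (ext_entryE (a := Comp cB)) mxE /= !subnKC.
  rewrite [RHS]ext_entry_out // ext_entry_out //.
  apply: contra h => /andP[h1 h2].
  by rewrite !ltn_sub2r // ?(leq_ltn_trans hx) ?(leq_ltn_trans hy).
Qed.

Lemma blocks_exist (c : comp) :
  exists s, (forall u, u \in s -> connected u) /\ diags s = c.
Proof.
have [n] := ubnP (nrows c); elim: n c => // n IH c; rewrite ltnS => hc.
have [->|ce] := pselect (c = ecomp); first by exists [::].
have [cc|ncc] := pselect (connected c).
  by exists [:: c]; split; [move=> u; rewrite inE => /eqP -> | rewrite /= diag0e].
have [a [b [cab ae be]]] : exists a b, [/\ c = diag a b, a <> ecomp & b <> ecomp].
  apply: contrapT => H; apply: ncc; split=> // a b cab.
  apply: contrapT => /not_orP[ae be]; apply: H.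
  by exists a, b.
have pos x : x <> ecomp -> (0 < nrows x)%N.
  by move=> xe; rewrite lt0n; apply/eqP => /nrows_eq0.
move: hc; rewrite cab /= => hc.
have [|s [s1 s2]] := IH a.
  by apply: leq_trans hc; rewrite -ltn_subLR // subnn pos.
have [|t [t1 t2]] := IH b.
  by apply: leq_trans hc; rewrite -[X in (X < _)%N]add0n ltn_add2r pos.
exists (s ++ t); split.
  by move=> u; rewrite mem_cat => /orP[/s1|/t1].
rewrite -s2 -t2; elim: (s) => [|x s' IHs] /=; first by rewrite diage0.
by rewrite IHs diagA.
Qed.

Lemma connected_diag_inj u v x y : connected u -> connected v ->
  diag u x = diag v y -> u = v /\ x = y.
Proof.
wlog le_uv : u v x y / (nrows u <= nrows v)%N.
  move=> H cu cv E; have [le|/ltnW le] := leqP (nrows u) (nrows v); first exact: H.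
  by have [-> ->] := H v u y x le cv cu (esym E).
move=> [ue cu] [ve cv] E.
have Ee p q : ext_entry (diag u x) p q = ext_entry (diag v y) p q by rewrite E.
have le_c : (ncols u <= ncols v)%N.
  rewrite leqNgt; apply/negP => lt_c.
  have [p hp Hp] := col_ex lt_c.
  have := Ee p (ncols v); rewrite !ext_entry_diag hp lt_c /= ltnn andbF.
  rewrite [(nrows v <= p)%N]leqNgt (leq_trans hp le_uv) /= => H.
  by rewrite H eqxx in Hp.
have [a [w [vE ra ca]]] : exists a b, [/\ v = diag a b, nrows a = nrows u
    & ncols a = ncols u].
  apply: diag_split => // p q hp hq.
    have [hq'|hq'] := ltnP q (ncols v); last first.
      by rewrite ext_entry_out // negb_and -!leqNgt hq' orbT.
    have := Ee p q; rewrite !ext_entry_diag hp hq' (leq_trans hp le_uv) /=.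
    by rewrite [(q < _)%N]ltnNge hq /= [(_ <= p)%N]leqNgt hp.
  have [hp'|hp'] := ltnP p (nrows v); last first.
    by rewrite ext_entry_out // negb_and -!leqNgt hp'.
  have := Ee p q; rewrite !ext_entry_diag hq hp' (leq_trans hq le_c) /=.
  by rewrite [(p < _)%N]ltnNge hp /= [(_ <= q)%N]leqNgt hq.
have we : w = ecomp.
  case: (cv _ _ vE) => // ae; case: ue; apply: nrows_eq0.
  by rewrite -ra ae.
have ev : v = a by rewrite vE we diag0e.
have uv : u = v.
  apply: comp_ext; rewrite ev // => p q.
  have [h|h] := boolP ((p < nrows u) && (q < ncols u))%N.
    have /andP[h1 h2] := h; have := Ee p q; rewrite !ext_entry_diag ev ra ca h1 h2.
    by [].
  by rewrite !ext_entry_out // ?ra ?ca.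
split=> //; rewrite uv in E Ee.
have [er ec] : nrows x = nrows y /\ ncols x = ncols y.
  have := congr1 (@nrows) E; have := congr1 (@ncols) E; rewrite /=.
  by move=> /addnI -> /addnI ->.
apply: comp_ext => // p q; have := Ee (nrows v + p)%N (ncols v + q)%N.
by rewrite !ext_entry_diag !ltnNge !leq_addr /= !addKn.
Qed.

Definition blocks (c : comp) : seq comp := sval (cid (blocks_exist c)).

Definition nblocks (c : comp) : nat := size (blocks c).

Lemma blocks_connected c u : u \in blocks c -> connected u.
Proof. by rewrite /blocks; case: cid => s [/= H _] /H. Qed.

Lemma blocksK c : diags (blocks c) = c.
Proof. by rewrite /blocks; case: cid => s []. Qed.

Lemma diagsK s : (forall u, u \in s -> connected u) -> blocks (diags s) = s.
Proof.
move=> Hs; have := @blocks_connected (diags s); have := blocksK (diags s).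
elim: s (blocks _) Hs => [|u s IH] [|v t] //= Hs Et Ht.
- have [ve _] : connected v by apply: Ht; rewrite inE eqxx.
  case: ve; apply: nrows_eq0; move/(congr1 (@nrows)): Et => /= /eqP.
  by rewrite addn_eq0 => /andP[/eqP].
- have [ve _] : connected u by apply: Hs; rewrite inE eqxx.
  case: ve; apply: nrows_eq0; move/(congr1 (@nrows)): Et => /= /esym/eqP.
  by rewrite addn_eq0 => /andP[/eqP].
- have [-> Ets] : v = u /\ diags t = diags s.
    by apply: connected_diag_inj => //; [apply: Ht|apply: Hs]; rewrite inE eqxx.
  by rewrite (IH t) // => w wt; [apply: Hs|apply: Ht]; rewrite inE wt orbT.
Qed.

Lemma blocks_diag a c : connected a -> blocks (diag a c) = a :: blocks c.
Proof.
move=> ca; rewrite -{1}(blocksK c); apply: (diagsK (s := a :: blocks c)) => u.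
by rewrite inE => /orP[/eqP ->|/blocks_connected].
Qed.

Lemma blocks_e : blocks ecomp = [::].
Proof. exact: (diagsK (s := [::])). Qed.

Definition block_increasing m s N (q : 'I_(m + s) -> 'I_N) : bool :=
  [forall i : 'I_m, forall j : 'I_m,
     (i < j)%N ==> (q (lshift s i) < q (lshift s j))%N] &&
  [forall i : 'I_s, forall j : 'I_s,
     (i < j)%N ==> (q (rshift m i) < q (rshift m j))%N].

Lemma is_comp_sh (a b : comp) (p : 'S_(nrows a + nrows b))
    (q : 'S_(ncols a + ncols b)) :
  is_comp (\matrix_(u, v) diag a b ((p^-1)%g u) ((q^-1)%g v)).
Proof.
have /is_compP[rc cc] := compP (diag a b).
apply/is_compP; split=> i.
  have [j Hj] := rc ((p^-1)%g i).
  by exists (q j); rewrite mxE permK.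
have [j Hj] := cc ((q^-1)%g i).
by exists (p j); rewrite mxE permK.
Qed.

Definition sh_comp (a b : comp) (p : 'S_(nrows a + nrows b))
    (q : 'S_(ncols a + ncols b)) : comp := Comp (is_comp_sh p q).

Definition is_qsh m s j (q : {ffun 'I_(m + s) -> 'I_j}) : bool :=
  block_increasing q && [forall x, exists u, q u == x].

Definition qsh m s j := {q : {ffun 'I_(m + s) -> 'I_j} | is_qsh q}.

Definition qs_mx (a b : comp) j k (p : qsh (nrows a) (nrows b) j)
    (q : qsh (ncols a) (ncols b) k) : 'M[Md]_(j, k) :=
  \matrix_(x, y) \big[mmul/mone]_(u | val p u == x)
                   \big[mmul/mone]_(v | val q v == y) diag a b u v.

Lemma big_mmul_neq1 (I : finType) (P : pred I) (F : I -> Md) i :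
  P i -> F i != mone -> \big[mmul/mone]_(j | P j) F j != mone.
Proof.
move=> Pi; apply: contra; rewrite (bigD1 i) //= => /unitmP[].
by [].
Qed.

Lemma is_comp_qs (a b : comp) j k (p : qsh (nrows a) (nrows b) j)
    (q : qsh (ncols a) (ncols b) k) : is_comp (qs_mx p q).
Proof.
have /is_compP[rc cc] := compP (diag a b).
have /andP[_ /forallP Hp] := valP p; have /andP[_ /forallP Hq] := valP q.
apply/is_compP; split=> x.
  have /existsP[u Hu] := Hp x; have [v Huv] := rc u.
  exists (val q v); rewrite mxE.
  by apply: (big_mmul_neq1 (i := u)) => //; apply: (big_mmul_neq1 (i := v)).
have /existsP[v Hv] := Hq x; have [u Huv] := cc v.
exists (val p u); rewrite mxE.
by apply: (big_mmul_neq1 (i := u)) => //; apply: (big_mmul_neq1 (i := v)).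
Qed.

Definition qs_comp (a b : comp) j k (p : qsh (nrows a) (nrows b) j)
    (q : qsh (ncols a) (ncols b) k) : comp := Comp (is_comp_qs p q).

End MatrixCompositions.

Arguments ecomp {d}.

HB.lock Definition lin_ext (K : comNzRingType) (A : choiceType) (V : lmodType K)
  (f : A -> V) (x : {malg K[A]}) : V := \sum_(a <- msupp x) x@_a *: f a.

Section LinearExtension.
Variable K : comNzRingType.

Lemma lin_extE (A : choiceType) (V : lmodType K) (f : A -> V) (x : {malg K[A]}) :
  lin_ext f x = \sum_(a <- msupp x) x@_a *: f a.
Proof. by rewrite unlock. Qed.

Lemma lin_extEw (A : choiceType) (V : lmodType K) (f : A -> V)
    (x : {malg K[A]}) (D : {fset A}) : (msupp x `<=` D)%fset ->
  lin_ext f x = \sum_(a <- D) x@_a *: f a.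
Proof.
move=> sD; rewrite unlock; apply: big_fset_incl => // a _ /mcoeff_outdom ->.
by rewrite scale0r.
Qed.

Lemma lin_ext_is_linear (A : choiceType) (V : lmodType K) (f : A -> V) :
  linear (lin_ext f).
Proof.
move=> c x y; pose D := (msupp x `|` msupp y)%fset.
have sx : (msupp x `<=` D)%fset by apply: fsubsetUl.
have sy : (msupp y `<=` D)%fset by apply: fsubsetUr.
have sxy : (msupp (c *: x + y) `<=` D)%fset.
  apply: fsubset_trans (msuppD_le _ _) _.
  by apply: fsetSU; apply: msuppZ_le.
rewrite (lin_extEw _ sx) (lin_extEw _ sy) (lin_extEw _ sxy) scaler_sumr -big_split.
by apply: eq_bigr => a _; rewrite mcoeffD mcoeffZ scalerDl scalerA.
Qed.

HB.instance Definition _ (A : choiceType) (V : lmodType K) (f : A -> V) :=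
  GRing.isLinear.Build K {malg K[A]} V *:%R (lin_ext f) (lin_ext_is_linear f).

Lemma lin_extU (A : choiceType) (V : lmodType K) (f : A -> V) a :
  lin_ext f << a >> = f a.
Proof. by rewrite (lin_extEw _ msuppU_le) big_seq_fset1 mcoeffUU scale1r. Qed.

Definition bilin_ext (A B : choiceType) (V : lmodType K) (f : A -> B -> V)
    (x : {malg K[A]}) (y : {malg K[B]}) : V :=
  lin_ext (fun a => lin_ext (f a) y) x.

End LinearExtension.

Section HopfAlgebra.
Variables (K : comNzRingType) (d : nat).
Local Notation comp := (comp d).

Definition H := {malg K[comp]}.

(* H (x) H, with a (x) b represented by the basis element (a, b). *)
Definition HH := {malg K[(comp * comp)%type]}.

(* The tensor algebra of H, with a_1 (x) ... (x) a_n represented by the word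
   [:: a_1; ...; a_n]. *)
Definition TH := {malg K[seq comp]}.

Definition tens (x y : H) : HH := bilin_ext (fun a b => << (a, b) >>) x y.

Definition tens_map (f g : H -> H) : HH -> HH :=
  lin_ext (fun p => tens (f << p.1 >>) (g << p.2 >>)).

Definition coproduct : H -> HH := lin_ext (fun c =>
  \sum_(0 <= i < (nblocks c).+1)
    << (diags (take i (blocks c)), diags (drop i (blocks c))) >>).

Definition unitH (c : K) : H := c *: << ecomp >>.

Definition counit (x : H) : K := x@_ecomp.

(* A product on H is given by its values on pairs of compositions. *)
Definition product := comp -> comp -> H.

Definition mul (m : product) (x y : H) : H := bilin_ext m x y.

Definition mul_tens (m : product) : HH -> H := lin_ext (fun p => m p.1 p.2).

Definition diagH : H -> H -> H := mul (fun a b => << diag a b >>).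

Fixpoint bshuffle_rec (s : seq comp) : seq comp -> H :=
  match s with
  | [::] => fun t => << diags t >>
  | a :: u =>
      fix bshuffle_s (t : seq comp) : H :=
        match t with
        | [::] => << diags s >>
        | b :: v => diagH << a >> (bshuffle_rec u t)
                    + diagH << b >> (bshuffle_s v)
        end
  end.

Definition bshuffle : product := fun a b => bshuffle_rec (blocks a) (blocks b).

Lemma bshuffle_e a : bshuffle ecomp a = << a >> /\ bshuffle a ecomp = << a >>.
Proof.
rewrite /bshuffle blocks_e /= blocksK; split=> //.
by case E: (blocks a) => [|u s] /=; rewrite -[in RHS](blocksK a) E.
Qed.

Lemma bshuffle_diag a u b v : connected a -> connected b ->
  bshuffle (diag a u) (diag b v) =
    diagH << a >> (bshuffle u (diag b v)) + diagH << b >> (bshuffle (diag a u) v).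
Proof. by move=> ca cb; rewrite /bshuffle !blocks_diag. Qed.

Definition shuffle : product := fun a b =>
  if a == ecomp then << b >> else if b == ecomp then << a >> else
  \sum_(p : 'S_(nrows a + nrows b) | block_increasing p)
    \sum_(q : 'S_(ncols a + ncols b) | block_increasing q) << sh_comp p q >>.

(* There is no surjection from m + s points onto more than m + s points, so the
   sums over j and k are finite. *)
Definition qshuffle : product := fun a b =>
  if a == ecomp then << b >> else if b == ecomp then << a >> else
  \sum_(1 <= j < (nrows a + nrows b).+1)
    \sum_(1 <= k < (ncols a + ncols b).+1)
      \sum_(p : qsh (nrows a) (nrows b) j)
        \sum_(q : qsh (ncols a) (ncols b) k) << qs_comp p q >>.

Definition conv (m : product) (f g : H -> H) : H -> H :=
  fun x => mul_tens m (tens_map f g (coproduct x)).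

Definition conv_pow (m : product) (f : H -> H) (k : nat) : H -> H :=
  iter k (conv m f) (fun x => unitH (counit x)).

Definition aug_proj (x : H) : H := x - unitH (counit x).

Definition proj_blocks (k : nat) : H -> H :=
  lin_ext (fun a => if nblocks a == k then << a >> else 0).

Definition red_coproduct (x : H) : HH :=
  coproduct x - tens x << ecomp >> - tens << ecomp >> x.

Definition tcons (x : H) (w : TH) : TH := bilin_ext (fun a s => << a :: s >>) x w.

Fixpoint iter_red_coproduct (n : nat) (x : H) : TH :=
  match n with
  | 0 => lin_ext (fun a => << [:: a] >>) x
  | n'.+1 => lin_ext (fun p : (comp * comp)%type =>
               tcons << p.1 >> (iter_red_coproduct n' << p.2 >>))
               (red_coproduct x)
  end.

Definition tens_pow (psi : H -> H) : TH -> TH :=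
  lin_ext (foldr (fun a w => tcons (psi << a >>) w) << [::] >>).

Definition diagT : TH -> H := lin_ext (fun s => << diags s >>).

(* By [iter_red_coproduct_eq0] below, the terms with n > nblocks a vanish. *)
Definition coalg_lift (psi : H -> H) : H -> H := lin_ext (fun a =>
  if a == ecomp then << ecomp >> else
  \sum_(1 <= n < (nblocks a).+1)
    diagT (tens_pow psi (iter_red_coproduct n.-1 << a >>))).

Definition unital_coalgebra_map (f : H -> H) : Prop :=
  [/\ linear f,
      f << ecomp >> = << ecomp >>,
      forall x, coproduct (f x) = tens_map f f (coproduct x)
    & forall x, counit (f x) = counit x].

Definition bialgebra_map (m1 m2 : product) (f : H -> H) : Prop :=
  unital_coalgebra_map f /\
  forall x y, f (mul m1 x y) = mul m2 (f x) (f y).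

Lemma bilin0r (A B C : choiceType) (f : A -> B -> {malg K[C]}) x :
  bilin_ext f x 0 = 0.
Proof.
by rewrite /bilin_ext [LHS]lin_extE big1 // => a _; rewrite linear0 scaler0.
Qed.

Lemma bilin0l (A B C : choiceType) (f : A -> B -> {malg K[C]}) y :
  bilin_ext f 0 y = 0.
Proof. exact: linear0. Qed.

Lemma tensU (a b : comp) : tens << a >> << b >> = << (a, b) >>.
Proof. by rewrite /tens /bilin_ext !lin_extU. Qed.

Lemma nblocks_drop i (a : comp) :
  nblocks (diags (drop i (blocks a))) = (nblocks a - i)%N.
Proof.
by rewrite /nblocks diagsK ?size_drop // => u /mem_drop/blocks_connected.
Qed.

Lemma nblocks_eq0 (a : comp) : nblocks a = 0%N -> a = ecomp.
Proof. by rewrite -{2}(blocksK a) => /size0nil ->. Qed.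

Lemma nblocks_e : nblocks (@ecomp d) = 0%N.
Proof. by rewrite /nblocks blocks_e. Qed.

Lemma conv_pow_aug_proj_eq0 (m : product) k (a : comp) :
  (nblocks a < k)%N -> conv_pow m aug_proj k << a >> = 0.
Proof.
elim: k a => // k IH a; rewrite ltnS => ak.
rewrite /conv_pow iterS -/(conv_pow m aug_proj k) /conv /coproduct lin_extU.
rewrite /tens_map [lin_ext _ (\sum_(0 <= i < _) _)]linear_sum /mul_tens linear_sum.
rewrite big_nat big1 // => i /andP[_ hi].
rewrite /= lin_extU /=; case: i hi => [|i] hi.
  have -> : aug_proj << diags (take 0 (blocks a)) >> = 0.
    by rewrite take0 /= /aug_proj /unitH /counit mcoeffUU scale1r subrr.
  by rewrite /tens bilin0l; apply: linear0.
rewrite IH; first by rewrite /tens bilin0r; apply: linear0.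
rewrite nblocks_drop ltn_subLR //.
by rewrite addSn ltnS (leq_trans ak) // leq_addl.
Qed.

Lemma red_coproductU (a : comp) : a != ecomp ->
  red_coproduct << a >> = \sum_(1 <= i < nblocks a)
    << (diags (take i (blocks a)), diags (drop i (blocks a))) >> :> HH.
Proof.
move=> ae; have apos : (0 < nblocks a)%N.
  by rewrite lt0n; apply: contra ae => /eqP/nblocks_eq0/eqP.
rewrite /red_coproduct /coproduct lin_extU !tensU big_nat_recr //=.
rewrite take_size drop_size blocksK addrK big_ltn // take0 drop0 blocksK.
by rewrite [X in X - _]addrC addrK.
Qed.

Lemma iter_red_coproduct_eq0 n (a : comp) : a != ecomp ->
  (nblocks a <= n)%N -> iter_red_coproduct n << a >> = 0.
Proof.
elim: n a => [|n IH] a ae an.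
  by case/eqP: ae; apply: nblocks_eq0; apply/eqP; rewrite -leqn0.
rewrite /= red_coproductU // linear_sum big_nat big1 // => i /andP[hi1 hi].
rewrite /= lin_extU /= IH ?nblocks_drop.
- by rewrite /tcons bilin0r.
- apply/eqP => /(congr1 (@nblocks d)); rewrite nblocks_drop nblocks_e => /eqP.
  by rewrite subn_eq0 leqNgt hi.
- by rewrite leq_subLR (leq_trans an) // -add1n leq_add2r.
Qed.

End HopfAlgebra.

Section Logarithm.
Variables (K : comAlgType rat) (d : nat).

(* By [conv_pow_aug_proj_eq0] above, the terms with k > nblocks a vanish. *)
Definition eulerian (m : product K d) : H K d -> H K d := lin_ext (fun a =>
  \sum_(1 <= k < (nblocks a).+1)
    (((-1) ^+ k.-1 / k%:R : rat)%:A : K) *: conv_pow m (@aug_proj K d) k << a >>).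

Definition LogH (m : product K d) : H K d -> H K d :=
  coalg_lift (fun x => proj_blocks 1 (eulerian m x)).

End Logarithm.

(* Main.v *)
From Pilot Require Import Defs.
From HB Require Import structures.
From mathcomp Require Import all_boot all_algebra perm ring.
From mathcomp Require Import finmap boolp.
From mathcomp Require Import monalg.
Import Pilot.Defs.

Set Implicit Arguments.
Unset Strict Implicit.
Unset Printing Implicit Defensive.

Import GRing.Theory Num.Theory.

Local Open Scope ring_scope.

(** Why the theorem holds.

    Compositions form the free monoid on the connected ones under [diag], and
    the coproduct of [H] is dual to this product: the coefficient of
    [(c1, c2)] in [coproduct x] is the coefficient of [diag c1 c2] in [x].
    Hence everything can be read on transposes. A linear map [L] is a
    coalgebra map iff sending [c] to the function [a |-> (L a)_c] is a
    morphism from compositions under [diag] to scalar functions under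
    convolution, and a product [m] is compatible with the coproduct iff
    sending [c] to [(a, b) |-> (m a b)_c] is such a morphism for functions of
    two compositions. By freeness such a morphism is known from its values on
    connected compositions ([multiplicative_eq]); this is cofreeness of [H],
    and it gives uniqueness of [Log] and reduces its multiplicativity to
    connected compositions.

    [Log] is multiplicative. Both [(a, b) |-> Log (m a b)] and
    [(a, b) |-> Log a bshuffle Log b] are coalgebra maps, so only their
    coefficients at connected compositions matter. For non-empty [a] and [b]
    these vanish on both sides: a block shuffle of non-empty compositions has
    at least two blocks, and the Eulerian idempotent kills [m a b]
    ([eulerian_product]). For the latter, let [J] be the projection onto the
    augmentation ideal. As [m] is commutative and associative, the
    convolution powers [id^n] are algebra morphisms. Now [id^n] is the sum of
    [binomial n k] times [J^k], a polynomial in [n] whose linear coefficient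
    is the Eulerian idempotent, while for non-empty [a] and [b] the product of
    [id^n a] and [id^n b] is divisible by [n^2].

    [Log] is bijective. It fixes the part of top block number:
    [Log a = a + (fewer blocks)], so [1 - Log] is locally nilpotent and the
    inverse is the Neumann series. Comparing the components of
    [Exp (Log (pi_k a)) = pi_k a] with [n < k] blocks gives the recursion
    ([neumann_recursion]).

    The two products are bialgebra products. For the quasi-shuffle, a
    composition [a] is sent to the sum of all arrays obtained by placing [a],
    in order, on some of a given list of rows and columns ([realize]), just as
    a word is sent to a monomial quasi-symmetric polynomial. This turns the
    quasi-shuffle into the product of a commutative monoid algebra
    ([realize_qshuffle]) and is jointly injective ([mcoeff_realize]), whence
    commutativity and associativity; keeping only the block diagonal arrays
    is an algebra endomorphism, whence compatibility with the coproduct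
    ([diag_part_spreads]). The shuffle is the part of the quasi-shuffle in
    which numbers of rows and of columns add up ([shuffle_coef]), that is,
    its associated graded product, and inherits these properties. *)

(** * Linear maps out of free modules *)

Section LinearMaps.
Variable K : comNzRingType.

Lemma malg_sum (A : choiceType) (x : {malg K[A]}) :
  x = \sum_(a <- msupp x) x@_a *: << a >>.
Proof.
rewrite [LHS]monalgE; apply: eq_bigr => a _.
by apply/malgP => b; rewrite mcoeffZ !mcoeffU; case: eqP; rewrite ?mulr1 ?mulr0.
Qed.

Lemma linear_malg_ext (A : choiceType) (V : lmodType K) (f g : {malg K[A]} -> V) :
  linear f -> linear g -> (forall a, f << a >> = g << a >>) -> f =1 g.
Proof.
move=> lf lg fg x.
pose F := HB.pack_for {linear {malg K[A]} -> V} f (GRing.isLinear.Build _ _ _ _ f lf).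
pose G := HB.pack_for {linear {malg K[A]} -> V} g (GRing.isLinear.Build _ _ _ _ g lg).
rewrite -[f]/(F : _ -> _) -[g]/(G : _ -> _) (malg_sum x) !linear_sum.
by apply: eq_bigr => a _; rewrite !linearZ /= fg.
Qed.

Lemma mcoeff_linear (A : choiceType) (a : A) :
  linear (fun x : {malg K[A]} => x@_a : K^o).
Proof. by move=> c x y; rewrite mcoeffD mcoeffZ. Qed.

Lemma mcoeff_sum (A : choiceType) I (r : seq I) (P : pred I)
    (F : I -> {malg K[A]}) a :
  (\sum_(i <- r | P i) F i)@_a = \sum_(i <- r | P i) (F i)@_a.
Proof. exact: raddf_sum. Qed.

Section Bilinear.
Variables (A B : choiceType) (V : lmodType K) (f : A -> B -> V).

Lemma bilin_extUU a b : bilin_ext f << a >> << b >> = f a b.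
Proof. by rewrite /bilin_ext !lin_extU. Qed.

Lemma bilin_ext_linl y : linear (fun x => bilin_ext f x y).
Proof. by move=> c x x'; rewrite /bilin_ext linearP. Qed.

Lemma bilin_ext_linr x : linear (bilin_ext f x).
Proof.
move=> c y y'; rewrite /bilin_ext !lin_extE scaler_sumr -big_split /=.
apply: eq_bigr => a _.
by rewrite linearP /= scalerDr !scalerA mulrC.
Qed.

End Bilinear.

Lemma bilinear_malg_ext (A B : choiceType) (V : lmodType K)
    (f g : {malg K[A]} -> {malg K[B]} -> V) :
  (forall y, linear (f^~ y)) -> (forall x, linear (f x)) ->
  (forall y, linear (g^~ y)) -> (forall x, linear (g x)) ->
  (forall a b, f << a >> << b >> = g << a >> << b >>) -> f =2 g.
Proof.
move=> fl fr gl gr fg x y.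
apply: (linear_malg_ext (f := f^~ y) (g := g^~ y)) => // a.
exact: linear_malg_ext.
Qed.

End LinearMaps.

(** * Concatenation of compositions and convolution *)

Section CompositionMonoid.
Variable d : nat.
Local Notation comp := (Defs.comp d).
Implicit Types (a b c u x : comp) (p : comp * comp).

Lemma diags_cat (s t : seq comp) : diags (s ++ t) = diag (diags s) (diags t).
Proof. by elim: s => [|u s IH] /=; rewrite ?diage0 // IH diagA. Qed.

Lemma blocks_diags_sub (s : seq comp) a :
  {subset s <= blocks a} -> blocks (diags s) = s.
Proof. by move=> sa; apply: diagsK => u /sa/blocks_connected. Qed.

Lemma blocks_diag2 a b : blocks (diag a b) = blocks a ++ blocks b.
Proof.
rewrite -{1}(blocksK a) -{1}(blocksK b) -diags_cat diagsK // => u.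
by rewrite mem_cat => /orP[] /blocks_connected.
Qed.

Lemma nblocks_diag a b : nblocks (diag a b) = (nblocks a + nblocks b)%N.
Proof. by rewrite /nblocks blocks_diag2 size_cat. Qed.

Lemma nblocks_connected u : connected u -> nblocks u = 1%N.
Proof. by move=> cu; rewrite /nblocks -[u]diag0e blocks_diag // blocks_e. Qed.

Lemma connected_ne u : connected u -> u != ecomp.
Proof. by case=> /eqP. Qed.

Lemma nblocks_eq0E a : (nblocks a == 0%N) = (a == ecomp).
Proof.
by apply/eqP/eqP => [/nblocks_eq0|->] //; rewrite nblocks_e.
Qed.

Lemma nblocks1_connected a : nblocks a = 1%N -> connected a.
Proof.
rewrite /nblocks; case E: (blocks a) => [|u [|v s]] // _.
have cu : connected u by apply: (@blocks_connected _ a); rewrite E inE.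
by rewrite -(blocksK a) E /= diag0e.
Qed.

Lemma comp_ind (P : comp -> Prop) :
  P ecomp -> (forall u x, connected u -> P x -> P (diag u x)) -> forall c, P c.
Proof.
move=> Pe PS c; rewrite -(blocksK c).
have: forall u, u \in blocks c -> connected u by exact: blocks_connected.
elim: (blocks c) => //= u s IH H; apply: PS; first by apply: H; rewrite inE eqxx.
by apply: IH => v vs; apply: H; rewrite inE vs orbT.
Qed.

Lemma diag_eq_e a b : (diag a b == ecomp) = (a == ecomp) && (b == ecomp).
Proof. by rewrite -!nblocks_eq0E nblocks_diag addn_eq0. Qed.

Definition splits a : seq (comp * comp) :=
  [seq (diags (take i (blocks a)), diags (drop i (blocks a)))
     | i <- iota 0 (nblocks a).+1].

Lemma mem_splits a p : (p \in splits a) = (diag p.1 p.2 == a).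
Proof.
apply/mapP/eqP => [[i _ ->] /=|pa].
  by rewrite -diags_cat cat_take_drop blocksK.
exists (nblocks p.1).
  by rewrite mem_iota /= add0n ltnS -pa nblocks_diag leq_addr.
by rewrite -pa blocks_diag2 take_size_cat // drop_size_cat // !blocksK; case: p pa.
Qed.

Lemma splits_uniq a : uniq (splits a).
Proof.
rewrite map_inj_in_uniq ?iota_uniq // => i j.
rewrite !mem_iota /= !add0n !ltnS => hi hj [/(congr1 (fun b => size (blocks b)))].
rewrite !(@blocks_diags_sub _ a); try by move=> u /mem_take.
by rewrite !size_takel.
Qed.

Lemma splits_e : splits ecomp = [:: (ecomp, ecomp)].
Proof. by rewrite /splits nblocks_e blocks_e. Qed.

End CompositionMonoid.

(** Convolution of scalar functions needs a monoid in which every element has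
    finitely many factorizations. It is used both for compositions (transposes
    of linear maps) and for pairs of compositions (transposes of products). *)
Record factMonoid := FactMonoid {
  fm_sort :> eqType;
  fm_op : fm_sort -> fm_sort -> fm_sort;
  fm_e : fm_sort;
  fm_split : fm_sort -> seq (fm_sort * fm_sort);
  fm_opA : associative fm_op;
  fm_1op : left_id fm_e fm_op;
  fm_op1 : right_id fm_e fm_op;
  fm_split_uniq : forall s, uniq (fm_split s);
  mem_fm_split : forall s p, (p \in fm_split s) = (fm_op p.1 p.2 == s)
}.

Section Convolution.
Variables (K : comNzRingType) (S : factMonoid).
Implicit Types (f g h : S -> K) (s : S).

(** Both sides run over the factorizations of [s] into three factors. *)
Lemma fm_split_coassoc (V : nmodType) (F : S -> S -> S -> V) s :
  \sum_(p <- fm_split s) \sum_(q <- fm_split p.2) F p.1 q.1 q.2 =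
  \sum_(p <- fm_split s) \sum_(q <- fm_split p.1) F q.1 q.2 p.2.
Proof.
pose L := [seq (p.1, q.1, q.2) | p <- fm_split s, q <- fm_split p.2].
pose R := [seq (q.1, q.2, p.2) | p <- fm_split s, q <- fm_split p.1].
pose G (t : S * S * S) := F t.1.1 t.1.2 t.2.
transitivity (\sum_(t <- L) G t); first by rewrite big_allpairs_dep.
transitivity (\sum_(t <- R) G t); last by rewrite big_allpairs_dep.
apply: perm_big; apply: uniq_perm.
- apply: allpairs_uniq_dep => [|p _|]; rewrite ?fm_split_uniq //.
  move=> [[p1 p2] [q1 q2]] [[p1' p2'] [q1' q2']] /allpairsPdep[x [y [_ hy]]] [E1 E2].
  move: hy; rewrite -E1 -E2 mem_fm_split /= => /eqP hy.
  move=> /allpairsPdep[x' [y' [_ hy']]] [E1' E2'].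
  move: hy'; rewrite -E1' -E2' mem_fm_split /= => /eqP hy'.
  by move=> [-> e1 e2]; rewrite -hy -hy' e1 e2.
- apply: allpairs_uniq_dep => [|p _|]; rewrite ?fm_split_uniq //.
  move=> [[p1 p2] [q1 q2]] [[p1' p2'] [q1' q2']] /allpairsPdep[x [y [_ hy]]] [E1 E2].
  move: hy; rewrite -E1 -E2 mem_fm_split /= => /eqP hy.
  move=> /allpairsPdep[x' [y' [_ hy']]] [E1' E2'].
  move: hy'; rewrite -E1' -E2' mem_fm_split /= => /eqP hy'.
  by move=> [e1 e2 ->]; rewrite -hy -hy' e1 e2.
move=> [[t1 t2] t3]; apply/allpairsPdep/allpairsPdep => -[[p1 p2] [[q1 q2]]] [].
  rewrite !mem_fm_split /= => /eqP ps /eqP qs [-> -> ->].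
  exists (fm_op p1 q1, q2), (p1, q1); rewrite !mem_fm_split /= eqxx; split=> //.
  by rewrite -fm_opA qs ps.
rewrite !mem_fm_split /= => /eqP ps /eqP qs [-> -> ->].
exists (q1, fm_op q2 p2), (q2, p2); rewrite !mem_fm_split /= eqxx; split=> //.
by rewrite fm_opA qs ps.
Qed.

Definition convol f g : S -> K := fun s => \sum_(p <- fm_split s) f p.1 * g p.2.
Definition delta_e : S -> K := fun s => (s == fm_e S)%:R.

Lemma convolA f g h s : convol f (convol g h) s = convol (convol f g) h s.
Proof.
rewrite /convol; under eq_bigr do rewrite big_distrr /=.
rewrite (fm_split_coassoc (fun a b c => f a * (g b * h c))).
apply: eq_bigr => p _; rewrite big_distrl /=; apply: eq_bigr => q _.
by rewrite mulrA.
Qed.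

Lemma sum_seq_delta (I : eqType) (V : nmodType) (r : seq I) (j : I) (F : I -> V) :
  uniq r -> (forall i, i \in r -> i != j -> F i = 0) ->
  \sum_(i <- r) F i = if j \in r then F j else 0.
Proof.
move=> ur H; case: ifP => [jr|/negbT jr].
  by rewrite (bigD1_seq j) //= big_seq_cond big1 ?addr0 // => i /andP[]; exact: H.
rewrite big_seq big1 // => i ir; apply: H => //.
by apply: contra jr => /eqP <-.
Qed.

Lemma convol1l f s : convol delta_e f s = f s.
Proof.
rewrite /convol (sum_seq_delta (j := (fm_e S, s))) ?fm_split_uniq //.
  by rewrite mem_fm_split /= fm_1op eqxx /delta_e eqxx mul1r.
move=> [a b]; rewrite mem_fm_split /delta_e /= => /eqP <-.
have [->|] := eqVneq a; last by rewrite mul0r.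
by rewrite fm_1op eqxx.
Qed.

Lemma convol1r f s : convol f delta_e s = f s.
Proof.
rewrite /convol (sum_seq_delta (j := (s, fm_e S))) ?fm_split_uniq //.
  by rewrite mem_fm_split /= fm_op1 eqxx /delta_e eqxx mulr1.
move=> [a b]; rewrite mem_fm_split /delta_e /= => /eqP <-.
have [->|] := eqVneq b; last by rewrite mulr0.
by rewrite fm_op1 eqxx.
Qed.

Lemma eq_convol f f' g g' s : f =1 f' -> g =1 g' -> convol f g s = convol f' g' s.
Proof. by move=> ff' gg'; apply: eq_bigr => p _; rewrite ff' gg'. Qed.

Variable d : nat.
Implicit Types F G : Defs.comp d -> S -> K.

(** A morphism from compositions under [diag] to functions under convolution,
    tested only for a connected first factor; [multiplicative_diag] removes
    this restriction. *)
Definition multiplicative_on_connected F :=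
  F ecomp =1 delta_e /\
  forall u x, connected u -> F (diag u x) =1 convol (F u) (F x).

(** Peel off the connected blocks of [a] one at a time, using associativity of
    convolution. *)
Lemma multiplicative_diag F a b : multiplicative_on_connected F ->
  F (diag a b) =1 convol (F a) (F b).
Proof.
case=> Fe FS; elim/comp_ind: a => [|u x cu IH] s.
  rewrite diage0 -[LHS]convol1l; apply: eq_convol => // t; exact/esym/Fe.
rewrite -diagA FS // (eq_convol (f' := F u) (g' := convol (F x) (F b))) //.
by rewrite convolA; apply: eq_convol => // t; rewrite FS.
Qed.

(** Compositions are freely generated by the connected ones. Read on
    transposes, this is the uniqueness part of the cofreeness of [H]. *)
Lemma multiplicative_eq F G :
  multiplicative_on_connected F -> multiplicative_on_connected G ->
  (forall u, connected u -> F u =1 G u) -> F =2 G.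
Proof.
move=> [Fe FS] [Ge GS] FG; elim/comp_ind => [|u x cu IH] s; first by rewrite Fe Ge.
by rewrite FS // GS //; apply: eq_convol => //; apply: FG.
Qed.

End Convolution.

Definition comp_fm (d : nat) : factMonoid :=
  @FactMonoid (Defs.comp d) (@diag d) ecomp (@splits d) (@diagA d) (@diage0 d) (@diag0e d)
    (@splits_uniq d) (@mem_splits d).

Section PairMonoid.
Variable d : nat.
Local Notation cc := (Defs.comp d * Defs.comp d)%type.

Definition diag2 (p q : cc) : cc := (diag p.1 q.1, diag p.2 q.2).
Definition splits2 (p : cc) : seq (cc * cc) :=
  [seq ((r.1, t.1), (r.2, t.2)) | r <- splits p.1, t <- splits p.2].

Lemma diag2A : associative diag2.
Proof. by move=> p q r; rewrite /diag2 /= !diagA. Qed.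
Lemma diag2_1l : left_id (ecomp, ecomp) diag2.
Proof. by case=> a b; rewrite /diag2 /= !diage0. Qed.
Lemma diag2_1r : right_id (ecomp, ecomp) diag2.
Proof. by case=> a b; rewrite /diag2 /= !diag0e. Qed.
Lemma splits2_uniq p : uniq (splits2 p).
Proof.
apply: allpairs_uniq; rewrite ?splits_uniq //.
by move=> [[a b] [c e]] [[a' b'] [c' e']] _ _ [-> -> -> ->].
Qed.
Lemma mem_splits2 p t : (t \in splits2 p) = (diag2 t.1 t.2 == p).
Proof.
case: p t => a b [[t1 t2] [t3 t4]]; rewrite /diag2 /=.
apply/allpairsP/eqP => [[[[x1 x2] [y1 y2]]] /= []|[<- <-]].
  by rewrite !mem_splits /= => /eqP <- /eqP <- [-> -> -> ->].
by exists ((t1, t3), (t2, t4)); rewrite !mem_splits /= !eqxx.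
Qed.

Definition comp2_fm : factMonoid :=
  FactMonoid diag2A diag2_1l diag2_1r splits2_uniq mem_splits2.
End PairMonoid.

(** * Coalgebra maps and cofreeness *)

Section Coalgebra.
Variables (K : comNzRingType) (d : nat).
Local Notation comp := (Defs.comp d).
Local Notation H := (H K d).
Local Notation HH := (HH K d).
Implicit Types (a b c u : comp) (x y z : H).

Lemma coproduct_linear : linear (@coproduct K d).
Proof. exact: lin_ext_is_linear. Qed.

Lemma tens_map_linear f g : linear (@tens_map K d f g).
Proof. exact: lin_ext_is_linear. Qed.

HB.instance Definition _ := GRing.isLinear.Build K H HH *:%R (@coproduct K d)
  coproduct_linear.
HB.instance Definition _ f g := GRing.isLinear.Build K HH HH *:%R
  (@tens_map K d f g) (tens_map_linear f g).
HB.instance Definition _ (m : product K d) := GRing.isLinear.Build K HH H *:%R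
  (mul_tens m) (lin_ext_is_linear _).
HB.instance Definition _ k := GRing.isLinear.Build K H H *:%R
  (@proj_blocks K d k) (lin_ext_is_linear _).
HB.instance Definition _ (m : product K d) x := GRing.isLinear.Build K H H *:%R
  (mul m x) (bilin_ext_linr m x).
HB.instance Definition _ x := GRing.isLinear.Build K H HH *:%R
  (@tens K d x) (bilin_ext_linr _ x).
HB.instance Definition _ x := GRing.isLinear.Build K H H *:%R
  (@diagH K d x) (bilin_ext_linr _ x).
HB.instance Definition _ x := GRing.isLinear.Build K (TH K d) (TH K d) *:%R
  (@tcons K d x) (bilin_ext_linr _ x).
HB.instance Definition _ := GRing.isLinear.Build K (TH K d) H *:%R
  (@diagT K d) (lin_ext_is_linear _).
HB.instance Definition _ psi := GRing.isLinear.Build K (TH K d) (TH K d) *:%R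
  (@tens_pow K d psi) (lin_ext_is_linear _).
HB.instance Definition _ psi := GRing.isLinear.Build K H H *:%R
  (@coalg_lift K d psi) (lin_ext_is_linear _).

Lemma mul_linl (m : product K d) y : linear (fun x => mul m x y).
Proof. exact: bilin_ext_linl. Qed.
Lemma tens_linl y : linear (fun x => @tens K d x y).
Proof. exact: bilin_ext_linl. Qed.
Lemma diagH_linl y : linear (fun x => @diagH K d x y).
Proof. exact: bilin_ext_linl. Qed.

Lemma mulUU (m : product K d) a b : mul m << a >> << b >> = m a b.
Proof. exact: bilin_extUU. Qed.

Lemma mul_suml (m : product K d) I (r : seq I) (P : pred I) (F : I -> H) y :
  mul m (\sum_(i <- r | P i) F i) y = \sum_(i <- r | P i) mul m (F i) y.
Proof. exact: linear_sum. Qed.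

Lemma mul0l (m : product K d) y : mul m 0 y = 0.
Proof. exact: bilin0l. Qed.

Lemma mulZl (m : product K d) k x y : mul m (k *: x) y = k *: mul m x y.
Proof. by have := mul_linl m y k x 0; rewrite mul0l !addr0. Qed.

Lemma coproductU a : coproduct << a >> = \sum_(p <- splits a) << p >> :> HH.
Proof. by rewrite /coproduct lin_extU /splits big_map. Qed.

Lemma mcoeff_sum_splits c p :
  (\sum_(q <- splits c) << q >> : HH)@_p = (diag p.1 p.2 == c)%:R.
Proof.
rewrite mcoeff_sum (sum_seq_delta (j := p)) ?splits_uniq //; last first.
  by move=> q _ qp; rewrite mcoeffU (negPf qp).
by rewrite mem_splits mcoeffUU; case: eqP.
Qed.

(** This duality with [diag] lets identities between coproducts be checked on
    coefficients. *)
Lemma mcoeff_coproduct x p : (coproduct x)@_p = x@_(diag p.1 p.2).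
Proof.
apply: (linear_malg_ext (V := K^o)
  (f := fun x => (coproduct x)@_p) (g := fun x => x@_(diag p.1 p.2))).
- by move=> k y z; rewrite linearP mcoeffD mcoeffZ.
- exact: mcoeff_linear.
by move=> a; rewrite coproductU mcoeff_sum_splits mcoeffU eq_sym.
Qed.

Lemma mcoeff_tens x y p : (tens x y)@_p = x@_p.1 * y@_p.2.
Proof.
apply: (bilinear_malg_ext (V := K^o)
  (f := fun x y => (tens x y)@_p) (g := fun x y => x@_p.1 * y@_p.2)).
- by move=> z k x' y'; rewrite tens_linl mcoeffD mcoeffZ.
- by move=> z k x' y'; rewrite linearP mcoeffD mcoeffZ.
- by move=> z k x' y'; rewrite mcoeffD mcoeffZ mulrDl -mulrA.
- by move=> z k x' y'; rewrite mcoeffD mcoeffZ mulrDr mulrCA.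
by case: p => p1 p2 a b; rewrite tensU !mcoeffU xpair_eqE -mulnb natrM.
Qed.

Lemma mcoeff_diagH x y c :
  (diagH x y)@_c = \sum_(p <- splits c) x@_p.1 * y@_p.2.
Proof.
apply: (bilinear_malg_ext (V := K^o)
  (f := fun x y => (diagH x y)@_c)
  (g := fun x y => \sum_(p <- splits c) x@_p.1 * y@_p.2)).
- by move=> z k x' y'; rewrite diagH_linl mcoeffD mcoeffZ.
- by move=> z k x' y'; rewrite linearP mcoeffD mcoeffZ.
- move=> z k x' y'; rewrite scaler_sumr -big_split; apply: eq_bigr => p _.
  by rewrite mcoeffD mcoeffZ mulrDl -mulrA.
- move=> z k x' y'; rewrite scaler_sumr -big_split; apply: eq_bigr => p _.
  by rewrite mcoeffD mcoeffZ mulrDr mulrCA.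
move=> a b; rewrite /diagH mulUU.
rewrite (sum_seq_delta (j := (a, b))) ?splits_uniq //.
  by rewrite mem_splits /= !mcoeffUU mulr1 mcoeffU; case: eqP.
move=> [p1 p2] _; rewrite xpair_eqE negb_and /= !mcoeffU => /orP[] /negPf.
  by rewrite eq_sym => ->; rewrite mul0r.
by rewrite [b == _]eq_sym => ->; rewrite mulr0.
Qed.

Lemma tens_mapU f g p : tens_map f g << p >> = tens (f << p.1 >>) (g << p.2 >>) :> HH.
Proof. exact: lin_extU. Qed.

Lemma tens_map_tens (f g : H -> H) x y : linear f -> linear g ->
  tens_map f g (tens x y) = tens (f x) (g y).
Proof.
move=> lf lg; apply: (bilinear_malg_ext
  (f := fun x y => tens_map f g (tens x y)) (g := fun x y => tens (f x) (g y))).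
- by move=> z k x' y'; rewrite tens_linl linearP.
- by move=> z k x' y'; rewrite !linearP.
- by move=> z k x' y'; rewrite lf tens_linl.
- by move=> z k x' y'; rewrite lg linearP.
by move=> a b; rewrite tensU tens_mapU.
Qed.

Lemma mul_tens_tens (m : product K d) x y : mul_tens m (tens x y) = mul m x y.
Proof.
apply: (bilinear_malg_ext (f := fun x y => mul_tens m (tens x y))).
- by move=> z k x' y'; rewrite tens_linl linearP.
- by move=> z k x' y'; rewrite !linearP.
- exact: mul_linl.
- by move=> z k x' y'; rewrite linearP.
by move=> a b; rewrite tensU /mul_tens lin_extU mulUU.
Qed.

Lemma convU (m : product K d) f g a :
  conv m f g << a >> =
  \sum_(p <- splits a) mul m (f << p.1 >>) (g << p.2 >>).
Proof.
rewrite /conv coproductU !linear_sum; apply: eq_bigr => p _.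
by rewrite /= tens_mapU mul_tens_tens.
Qed.

Lemma conv_linear (m : product K d) f g : linear (conv m f g).
Proof. by move=> k x y; rewrite /conv !linearP. Qed.

Lemma mcoeff_proj_blocks k x c :
  (proj_blocks k x)@_c = if nblocks c == k then x@_c else 0.
Proof.
apply: (linear_malg_ext (V := K^o) (f := fun x => (proj_blocks k x)@_c)
  (g := fun x => if nblocks c == k then x@_c else 0)).
- by move=> r y z; rewrite linearP mcoeffD mcoeffZ.
- move=> r y z; case: ifP; rewrite ?mcoeffD ?mcoeffZ ?scaler0 ?addr0 //.
move=> a; rewrite /proj_blocks lin_extU mcoeffU.
have [ac|ac] := eqVneq a c; first by rewrite ac; case: ifP; rewrite ?mcoeffUU ?mcoeff0.
by case: ifP => _; rewrite ?mcoeffU ?mcoeff0 ?(negPf ac) if_same.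
Qed.

(** The transpose of [L], evaluated at basis elements. *)
Definition coefs (L : H -> H) : comp -> comp_fm d -> K := fun c a => (L << a >>)@_c.

Lemma linear_coalgebra_coefs (L : H -> H) : linear L ->
  ((forall x, coproduct (L x) = tens_map L L (coproduct x)) <->
   forall c1 c2, coefs L (diag c1 c2) =1 convol (coefs L c1) (coefs L c2)).
Proof.
move=> lL.
have E a p : (tens_map L L (coproduct << a >>))@_p
    = convol (coefs L p.1) (coefs L p.2) a.
  rewrite coproductU linear_sum mcoeff_sum; apply: eq_bigr => q _.
  by rewrite /= tens_mapU mcoeff_tens.
split=> [HL c1 c2 a|HL].
  by rewrite -(E a (c1, c2)) -HL mcoeff_coproduct.
apply: linear_malg_ext => [k x y|k x y|a]; first by rewrite lL linearP.
  by rewrite !linearP.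
apply/malgP => p; rewrite E mcoeff_coproduct; exact: HL.
Qed.

Lemma coalgebra_coefs (L : H -> H) : unital_coalgebra_map L ->
  multiplicative_on_connected (coefs L).
Proof.
case=> lL Le Ld Lc; split=> [a|u x _]; last exact: (linear_coalgebra_coefs lL).1.
by have := Lc << a >>; rewrite /counit /coefs mcoeffU.
Qed.

(** Compatibility with the counit is the case of the empty composition of
    multiplicativity. *)
Lemma unital_coalgebraP (L : H -> H) : linear L ->
  L << ecomp >> = << ecomp >> -> multiplicative_on_connected (coefs L) ->
  unital_coalgebra_map L.
Proof.
move=> lL Le Lm; split=> //.
  by apply/(linear_coalgebra_coefs lL) => c1 c2; apply: multiplicative_diag.
apply: (linear_malg_ext (V := K^o)).
- by move=> k x y; rewrite lL /counit mcoeffD mcoeffZ.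
- exact: mcoeff_linear.
by move=> a; rewrite /counit -/(coefs L ecomp a) Lm.1 mcoeffU.
Qed.

Lemma coalgebra_map_eq (L L' : H -> H) :
  unital_coalgebra_map L -> unital_coalgebra_map L' ->
  (forall a, a <> ecomp -> proj_blocks 1 (L << a >>) = proj_blocks 1 (L' << a >>)) ->
  L =1 L'.
Proof.
move=> cL cL' E; case: (cL) => lL Le _ _; case: (cL') => lL' Le' _ _.
apply: linear_malg_ext => // a; apply/malgP => c.
apply: (multiplicative_eq (coalgebra_coefs cL) (coalgebra_coefs cL')).
move=> u cu b; rewrite /coefs; have [->|/eqP be] := eqVneq b ecomp.
  by rewrite Le Le'.
have /malgP/(_ u) := E b be.
by rewrite !mcoeff_proj_blocks nblocks_connected.
Qed.

Section CoalgLift.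
Variable psi : H -> H.
Hypothesis psi_e : psi << ecomp >> = 0.
Hypothesis psi_prim : forall a c, ~ connected c -> (psi << a >>)@_c = 0.

Definition lift_term n a : H := diagT (tens_pow psi (iter_red_coproduct n << a >>)).

Lemma diagT_tcons x w : diagT (tcons x w) = diagH x (diagT w) :> H.
Proof.
apply: (bilinear_malg_ext (f := fun x w => diagT (tcons x w))
  (g := fun x w => diagH x (diagT w))).
- by move=> z k x' y'; rewrite [tcons _ _]bilin_ext_linl linearP.
- by move=> z k x' y'; rewrite !linearP.
- by move=> z k x' y'; rewrite diagH_linl.
- by move=> z k x' y'; rewrite !linearP.
by move=> a s; rewrite /tcons bilin_extUU /diagT !lin_extU /diagH mulUU.
Qed.

Lemma tens_pow_tcons a w :
  tens_pow psi (tcons << a >> w) = tcons (psi << a >>) (tens_pow psi w).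
Proof.
apply: (linear_malg_ext (f := fun w => tens_pow psi (tcons << a >> w))
  (g := fun w => tcons (psi << a >>) (tens_pow psi w))).
- by move=> k x' y'; rewrite !linearP.
- by move=> k x' y'; rewrite !linearP.
by move=> s; rewrite /tcons bilin_extUU /tens_pow !lin_extU.
Qed.

Lemma diagH1r x : diagH x << ecomp >> = x.
Proof.
apply: (linear_malg_ext (f := fun x => diagH x << ecomp >>) (g := fun x => x)) => //.
  exact: diagH_linl.
by move=> a; rewrite /diagH mulUU diag0e.
Qed.

Lemma lift_term0 a : lift_term 0 a = psi << a >>.
Proof.
rewrite /lift_term /= lin_extU /tens_pow lin_extU /= diagT_tcons /diagT lin_extU /=.
exact: diagH1r.
Qed.

(** The first tensor factor of the iterated reduced coproduct can be split
    off, since the iteration acts on the second one. *)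
Lemma lift_termS n a : a != ecomp -> lift_term n.+1 a =
  \sum_(1 <= i < nblocks a) diagH (psi << diags (take i (blocks a)) >>)
    (lift_term n (diags (drop i (blocks a)))).
Proof.
move=> ae; rewrite /lift_term /= red_coproductU // !linear_sum.
apply: eq_bigr => i _.
by rewrite /= lin_extU /= tens_pow_tcons diagT_tcons.
Qed.

Lemma coalg_lift_e : coalg_lift psi << ecomp >> = << ecomp >>.
Proof. by rewrite /coalg_lift lin_extU eqxx. Qed.

Lemma coalg_lift_terms a N : a != ecomp -> (nblocks a <= N)%N ->
  coalg_lift psi << a >> = \sum_(0 <= n < N) lift_term n a.
Proof.
move=> ae aN; rewrite /coalg_lift lin_extU (negPf ae) (big_addn 0 _ 1) subn1 /=.
rewrite (big_cat_nat (n := nblocks a) (p := N)) //= [X in _ + X]big_nat_cond.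
rewrite [X in _ + X]big1 ?addr0; last first.
  move=> n /andP[/andP[an _] _].
  by rewrite /lift_term iter_red_coproduct_eq0 // !linear0.
by apply: eq_bigr => i _; rewrite addn1.
Qed.

(** The lift satisfies [L = unit + psi * L] for the convolution taken with
    respect to concatenation. The term where [p.2] is empty is the summand
    [n = 1] of the lift; the others collect the remaining summands by the
    first tensor factor. *)
Lemma coalg_lift_rec a : a != ecomp -> coalg_lift psi << a >> =
  \sum_(p <- splits a) diagH (psi << p.1 >>) (coalg_lift psi << p.2 >>).
Proof.
move=> ae; have a0 : (0 < nblocks a)%N by rewrite lt0n nblocks_eq0E.
rewrite /splits big_map; set r := iota 0 _.
have -> : r = index_iota 0 (nblocks a).+1 by rewrite /index_iota subn0.
rewrite big_nat_recl //=.
rewrite take0 psi_e [diagH 0 _]bilin0l add0r.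
rewrite (coalg_lift_terms (N := nblocks a)) // -{1}(prednK a0).
rewrite big_nat_recl // lift_term0 -[in RHS](prednK a0) big_nat_recr //= (prednK a0).
rewrite take_size drop_size blocksK [diags [::]]/(ecomp) coalg_lift_e diagH1r.
rewrite addrC; congr (_ + _); under eq_bigr do rewrite lift_termS //.
rewrite exchange_big /= (big_addn 0 _ 1) subn1 /=.
apply: eq_big_nat => i /andP[_ hi]; rewrite addn1 -linear_sum; congr diagH.
rewrite (coalg_lift_terms (N := (nblocks a).-1)) //.
  by rewrite -nblocks_eq0E nblocks_drop subn_eq0 -ltnNge -ltn_predRL.
by rewrite nblocks_drop -subn1 leq_sub2l.
Qed.

(** If [x] is supported on connected compositions, the only factorization of
    [diag u c] that contributes is the one with first factor [u]. *)
Lemma mcoeff_diagH_connected x y u c : connected u ->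
  (forall b, ~ connected b -> x@_b = 0) ->
  (diagH x y)@_(diag u c) = x@_u * y@_c.
Proof.
move=> cu xp; rewrite mcoeff_diagH (sum_seq_delta (j := (u, c))) ?splits_uniq //.
  by rewrite mem_splits eqxx.
move=> [b b']; rewrite mem_splits /= => /eqP E.
have [cb|nb] := pselect (connected b); last by rewrite xp // mul0r.
by have [-> ->] := connected_diag_inj cb cu E; rewrite eqxx.
Qed.

Lemma coalg_lift_e_coef a : (coalg_lift psi << a >>)@_ecomp = (a == ecomp)%:R.
Proof.
have [->|ae] := eqVneq a ecomp; first by rewrite coalg_lift_e mcoeffUU.
rewrite coalg_lift_rec // mcoeff_sum big1 // => p _.
rewrite mcoeff_diagH splits_e big_seq1 /= psi_prim ?mul0r //.
by case.
Qed.

(** The transpose of [coalg_lift_rec]. *)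
Lemma coefs_coalg_lift u (x : comp) : connected u ->
  coefs (coalg_lift psi) (diag u x) =1
  convol (coefs psi u) (coefs (coalg_lift psi) x).
Proof.
move=> cu a; rewrite /coefs /convol; have [->|ae] := eqVneq a ecomp.
  rewrite coalg_lift_e /= splits_e big_seq1 /= psi_e mcoeff0 mul0r mcoeffU.
  by rewrite [_ == _]eq_sym diag_eq_e (negPf (connected_ne cu)).
rewrite coalg_lift_rec // mcoeff_sum; apply: eq_bigr => p _.
by rewrite mcoeff_diagH_connected // => b; apply: psi_prim.
Qed.

Lemma coefs_coalg_lift_connected u : connected u ->
  coefs (coalg_lift psi) u =1 coefs psi u.
Proof.
move=> cu a; rewrite -{1}[u]diag0e coefs_coalg_lift // -[RHS]convol1r.
by apply: eq_convol => // b; rewrite /coefs coalg_lift_e_coef.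
Qed.

Lemma coalg_lift_multiplicative :
  multiplicative_on_connected (coefs (coalg_lift psi)).
Proof.
split=> [a|u x cu a]; first exact: coalg_lift_e_coef.
rewrite coefs_coalg_lift //; apply: eq_convol => // b.
by rewrite coefs_coalg_lift_connected.
Qed.

Lemma coalg_lift_coalgebra : unital_coalgebra_map (coalg_lift psi).
Proof.
apply: unital_coalgebraP; [exact: linearP|exact: coalg_lift_e|].
exact: coalg_lift_multiplicative.
Qed.

Lemma proj_coalg_lift a : a <> ecomp -> proj_blocks 1 (coalg_lift psi << a >>) = psi << a >>.
Proof.
move=> ae; apply/malgP => c; rewrite mcoeff_proj_blocks; case: eqP => [c1|c1].
  exact: (coefs_coalg_lift_connected (nblocks1_connected c1)).
by rewrite psi_prim // => /nblocks_connected.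
Qed.

Section Triangular.
Hypothesis psi_id : forall u, connected u -> psi << u >> = << u >>.

(** A coefficient of the lift at [c] is a sum of products of one value of
    [psi] per block of [c], over the ways of cutting [a] into that many
    pieces. Empty pieces contribute zero, so [a] needs at least as many blocks
    as [c]; when the numbers agree every piece is one block, fixed by [psi]. *)
Lemma coalg_lift_triangular a c : (nblocks a <= nblocks c)%N ->
  (coalg_lift psi << a >>)@_c = (a == c)%:R.
Proof.
elim/comp_ind: c a => [|u x cu IH] a; first by rewrite coalg_lift_e_coef.
rewrite nblocks_diag (nblocks_connected cu) add1n => hac.
rewrite -/(coefs _ _ a) coefs_coalg_lift // /convol.
rewrite (sum_seq_delta (j := (u, x))) ?splits_uniq //.
  rewrite mem_splits /coefs /= psi_id // mcoeffUU mul1r IH // eqxx eq_sym.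
  by case: eqP.
move=> [b b']; rewrite mem_splits /coefs /= => /eqP ba.
have [->|be] := eqVneq b ecomp; first by rewrite psi_e mcoeff0 mul0r.
have b1 : (0 < nblocks b)%N by rewrite lt0n nblocks_eq0E.
have hb' : (nblocks b' <= nblocks x)%N.
  rewrite -ltnS; apply: leq_trans hac.
  by rewrite -ba nblocks_diag -addn1 addnC leq_add2r.
rewrite IH //; have [b'x|] := eqVneq b' x; last by rewrite mulr0.
have cb : connected b.
  apply: nblocks1_connected; apply/eqP; rewrite eqn_leq b1 andbT.
  by move: hac; rewrite -ba nblocks_diag b'x -add1n leq_add2r.
by rewrite psi_id // mcoeffU xpair_eqE b'x eqxx andbT => /negPf ->; rewrite mul0r.
Qed.
End Triangular.

End CoalgLift.
End Coalgebra.

(** * Bialgebra products and convolution powers *)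

Arguments conv_pow : simpl never.

Section BialgebraProducts.
Variables (K : comNzRingType) (d : nat).
Local Notation comp := (Defs.comp d).
Local Notation H := (H K d).
Local Notation HH := (HH K d).
Implicit Types (a b c u : comp) (x y z : H) (m : product K d).

(** The transpose of the product [m]. *)
Definition coefs2 m : comp -> comp2_fm d -> K := fun c p => (m p.1 p.2)@_c.

(** The last condition says that [m] is a morphism of coalgebras, counit
    included, from the tensor square of [H]. *)
Definition bialgebra_product m : Prop :=
  [/\ forall a, m ecomp a = << a >>, forall a, m a ecomp = << a >>
    & multiplicative_on_connected (coefs2 m)].

Definition comm_assoc_product m : Prop :=
  (forall a b, m a b = m b a) /\
  (forall a b c, mul m (m a b) << c >> = mul m << a >> (m b c)).

Lemma coproduct_product m a b : bialgebra_product m ->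
  coproduct (m a b) =
  \sum_(q <- splits a) \sum_(r <- splits b) tens (m q.1 r.1) (m q.2 r.2).
Proof.
case=> _ _ Hm; apply/malgP => p; rewrite mcoeff_coproduct.
have := multiplicative_diag p.1 p.2 Hm (a, b); rewrite /coefs2 /= => ->.
rewrite /convol /= /splits2 big_allpairs_dep /= mcoeff_sum; apply: eq_bigr => q _.
by rewrite mcoeff_sum; apply: eq_bigr => r _; rewrite mcoeff_tens.
Qed.

Lemma counit_mul m x y : bialgebra_product m ->
  counit (mul m x y) = counit x * counit y.
Proof.
case=> _ _ [Hm _]; apply: (bilinear_malg_ext (V := K^o)
  (f := fun x y => counit (mul m x y)) (g := fun x y => counit x * counit y)).
- by move=> z k x' y'; rewrite /counit mul_linl mcoeffD mcoeffZ.
- by move=> z k x' y'; rewrite /counit linearP mcoeffD mcoeffZ.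
- by move=> z k x' y'; rewrite /counit mcoeffD mcoeffZ mulrDl -mulrA.
- by move=> z k x' y'; rewrite /counit mcoeffD mcoeffZ mulrDr mulrCA.
move=> a b; rewrite mulUU /counit; have := Hm (a, b); rewrite /coefs2 /= => ->.
by rewrite /delta_e /= xpair_eqE !mcoeffU -mulnb natrM.
Qed.

Lemma mul1x m x : bialgebra_product m -> mul m << ecomp >> x = x.
Proof.
case=> m1 _ _; apply: (linear_malg_ext (g := fun x => x)) => // [k y z|a].
  by rewrite linearP.
by rewrite mulUU.
Qed.

Lemma mulx1 m x : bialgebra_product m -> mul m x << ecomp >> = x.
Proof.
case=> _ m1 _; apply: (linear_malg_ext (f := fun x => mul m x << ecomp >>)
  (g := fun x => x)) => // [|a]; first exact: mul_linl.
by rewrite mulUU.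
Qed.

Lemma mulHC m x y : (forall a b, m a b = m b a) -> mul m x y = mul m y x.
Proof.
move=> mC.
apply: (bilinear_malg_ext (f := fun x y => mul m x y) (g := fun x y => mul m y x)).
- exact: mul_linl.
- by move=> z; apply: linearP.
- by move=> z; apply: linearP.
- exact: mul_linl.
by move=> a b; rewrite !mulUU mC.
Qed.

Section CommutativeAlgebra.
Variable m : product K d.
Hypothesis ca_m : comm_assoc_product m.

Lemma mulHA x y z : mul m (mul m x y) z = mul m x (mul m y z).
Proof.
suff H a : forall y z, mul m (mul m << a >> y) z = mul m << a >> (mul m y z).
  apply: (linear_malg_ext (f := fun x => mul m (mul m x y) z)
    (g := fun x => mul m x (mul m y z))) => //.
    by move=> k x' y'; rewrite !mul_linl.
  exact: mul_linl.
apply: bilinear_malg_ext.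
- by move=> t k x' y'; rewrite linearP mul_linl.
- by move=> t k x' y'; rewrite linearP.
- by move=> t k x' y'; rewrite mul_linl linearP.
- by move=> t k x' y'; rewrite !linearP.
by move=> b c; rewrite !mulUU ca_m.2.
Qed.

Lemma mulHACA x y z t :
  mul m (mul m x y) (mul m z t) = mul m (mul m x z) (mul m y t).
Proof.
rewrite !mulHA -[mul m y (mul m z t)]mulHA (mulHC y z ca_m.1).
by rewrite [mul m (mul m z y) t]mulHA.
Qed.
End CommutativeAlgebra.

Section ConvolutionPowers.
Variable m : product K d.
Hypothesis bi_m : bialgebra_product m.

Lemma conv_pow_linear f k : linear (conv_pow m f k).
Proof.
case: k => [|k]; last exact: conv_linear.
by move=> r x y; rewrite /conv_pow /= /unitH /counit mcoeffD mcoeffZ scalerDl scalerA.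
Qed.

HB.instance Definition _ f k := GRing.isLinear.Build K H H *:%R
  (conv_pow m f k) (conv_pow_linear f k).

Lemma conv_powS f k a : conv_pow m f k.+1 << a >> =
  \sum_(p <- splits a) mul m (f << p.1 >>) (conv_pow m f k << p.2 >>).
Proof. exact: convU. Qed.

(** The convolution powers of the identity multiply: in Sweedler notation
    [(a b)_1 ((a b)_2)^n] reorders into [(a_1 a_2^n) (b_1 b_2^n)], because the
    product is commutative. *)
Lemma conv_pow_id_mul n x y : comm_assoc_product m ->
  conv_pow m id n (mul m x y) = mul m (conv_pow m id n x) (conv_pow m id n y).
Proof.
move=> ca_m; elim: n x y => [|n IH] x y.
  rewrite /conv_pow /= /unitH counit_mul // mulZl linearZ /= scalerA.
  by rewrite mul1x.
apply: (bilinear_malg_ext (f := fun x y => conv_pow m id n.+1 (mul m x y))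
  (g := fun x y => mul m (conv_pow m id n.+1 x) (conv_pow m id n.+1 y))).
- by move=> z k x' y'; rewrite mul_linl linearP.
- by move=> z k x' y'; rewrite !linearP.
- by move=> z k x' y'; rewrite linearP mul_linl.
- by move=> z k x' y'; rewrite !linearP.
move=> a b; rewrite mulUU !conv_powS.
rewrite -[LHS]/(conv m id (conv_pow m id n) (m a b)) /conv coproduct_product //.
rewrite [RHS]mul_suml !linear_sum; apply: eq_bigr => p _.
rewrite !linear_sum; apply: eq_bigr => q _ /=.
rewrite tens_map_tens //; last exact: conv_pow_linear.
by rewrite mul_tens_tens -!mulUU IH mulHACA.
Qed.

Lemma nblocks_split a p : p \in splits a -> nblocks a = (nblocks p.1 + nblocks p.2)%N.
Proof. by rewrite mem_splits => /eqP <-; rewrite nblocks_diag. Qed.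

(** The identity is the convolution unit plus [aug_proj], so its powers
    expand by the binomial formula. The powers of [aug_proj] beyond the number
    of blocks vanish, hence the bound [N]. *)
Lemma conv_pow_id_binomial n N a : (nblocks a < N)%N ->
  conv_pow m id n << a >> =
  \sum_(k < N) 'C(n, k)%:R *: conv_pow m (@aug_proj K d) k << a >>.
Proof.
elim: n a => [|n IH] a aN.
  case: N aN => // N _; rewrite big_ord_recl bin0 scale1r big1 ?addr0 //.
  by move=> i _; rewrite bin0n scale0r.
(* One factor [id] is split as unit plus [aug_proj]; Pascal's rule then closes
   the induction. *)
have -> : conv_pow m id n.+1 << a >> = conv_pow m id n << a >>
   + \sum_(p <- splits a) mul m (aug_proj << p.1 >>) (conv_pow m id n << p.2 >>).
  have -> : conv_pow m id n << a >> = \sum_(p <- splits a)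
      mul m (unitH d (counit << p.1 >>)) (conv_pow m id n << p.2 >>).
    rewrite (sum_seq_delta (j := (ecomp, a))) ?splits_uniq //; last first.
      move=> [b b']; rewrite mem_splits /= => /eqP <-.
      rewrite xpair_eqE /unitH /counit mcoeffU; case: eqVneq => [->|_ _].
        by rewrite diage0 eqxx.
      by rewrite scale0r mul0l.
    by rewrite mem_splits /= diage0 eqxx /unitH /counit mcoeffUU scale1r mul1x.
  rewrite conv_powS -big_split; apply: eq_bigr => p _ /=.
  have {1}-> : << p.1 >> = unitH d (counit << p.1 >>) + aug_proj << p.1 >> :> H.
    by rewrite /aug_proj addrC subrK.
  by have := mul_linl m (conv_pow m id n << p.2 >>) 1
      (unitH d (counit << p.1 >>)) (aug_proj << p.1 >>); rewrite !scale1r.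
rewrite (IH _ aN).
have -> : \sum_(p <- splits a) mul m (aug_proj << p.1 >>) (conv_pow m id n << p.2 >>)
   = \sum_(k < N) 'C(n, k)%:R *: conv_pow m (@aug_proj K d) k.+1 << a >>.
  under [RHS]eq_bigr do rewrite conv_powS scaler_sumr.
  rewrite exchange_big /= big_seq [RHS]big_seq; apply: eq_bigr => p pa.
  rewrite IH ?linear_sum; last first.
    by apply: leq_trans aN; rewrite ltnS (nblocks_split pa) leq_addl.
  by apply: eq_bigr => k _; rewrite linearZ.
have [N' EN] : exists N', N = N'.+1 by case: (N) aN => // N' _; exists N'.
move: aN; rewrite EN ltnS => aN.
rewrite big_ord_recl [X in _ + X]big_ord_recr /=.
rewrite (@conv_pow_aug_proj_eq0 _ _ _ N'.+1) ?ltnS // scaler0 addr0 [RHS]big_ord_recl /= !bin0.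
rewrite -addrA -big_split; congr (_ + _); apply: eq_bigr => i _.
by rewrite /= /bump leq0n add1n -scalerDl -natrD binS.
Qed.

End ConvolutionPowers.
End BialgebraProducts.

(** * The Eulerian idempotent vanishes on products *)

Section BinomialPolynomials.
Variable K : comAlgType rat.
Implicit Types p q : {poly K}.

Definition ratK (r : rat) : K := r%:A.

Lemma ratK_nat n : ratK n%:R = n%:R.
Proof. by rewrite /ratK scaler_nat. Qed.

Lemma ratKM r s : ratK (r * s) = ratK r * ratK s.
Proof. by rewrite /ratK -scalerAl mul1r scalerA. Qed.

Lemma natK_inj n (x : K) : (0 < n)%N -> n%:R * x = 0 -> x = 0.
Proof.
move=> n0 nx; have nn : n%:R != 0 :> rat by rewrite pnatr_eq0 -lt0n.
by rewrite -[x]mul1r -[1]/(1%:R) -(ratK_nat 1) -(mulVf nn) ratKM ratK_nat -mulrA nx mulr0.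
Qed.

(** [K] may have zero divisors, but differences of distinct natural numbers
    are invertible in a rational algebra, so linear factors can be removed
    one by one. *)
Lemma poly_eq0_on_nat n0 p : (forall n, (n0 <= n)%N -> p.[n%:R] = 0) -> p = 0.
Proof.
have [N] := ubnP (size p); elim: N n0 p => // N IH n0 p; rewrite ltnS => pN H.
apply: contrapT => /eqP p0.
have /factor_theorem[q pq] : root p n0%:R by apply/rootP/H.
have q0 : q = 0.
  apply: (IH n0.+1) => [|n n0n].
    have q0 : q != 0 by apply: contra_neq p0 => q0; rewrite pq q0 mul0r.
    by apply: leq_trans pN; rewrite pq size_Mmonic ?monicXsubC // size_XsubC addn2.
  apply: (@natK_inj (n - n0)); first by rewrite subn_gt0.
  have := H n (ltnW n0n); rewrite pq hornerM hornerXsubC mulrC => <-.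
  by rewrite natrB // ltnW.
by rewrite pq q0 mul0r eqxx in p0.
Qed.

(** The binomial coefficient [X choose k]. *)
Definition binom_poly k : {poly K} :=
  ratK (k`!%:R^-1) *: \prod_(i < k) ('X - (i%:R)%:P).

Lemma horner_ffact k n :
  (\prod_(i < k) ('X - (i%:R)%:P : {poly K})).[n%:R] = (n ^_ k)%:R.
Proof.
elim: k => [|k IH]; first by rewrite big_ord0 hornerC ffactn0.
rewrite big_ord_recr hornerM IH hornerXsubC ffactnSr natrM /=.
have [kn|nk] := leqP k n; first by rewrite natrB.
by rewrite ffact_small // !mul0r.
Qed.

Lemma horner_binom_poly k n : (binom_poly k).[n%:R] = 'C(n, k)%:R.
Proof.
rewrite /binom_poly hornerZ horner_ffact -bin_ffact mulnC natrM mulrA -(ratK_nat k`!).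
have k0 : k`!%:R != 0 :> rat by rewrite pnatr_eq0 -lt0n fact_gt0.
by rewrite -ratKM (mulVf k0) (ratK_nat 1) mul1r.
Qed.

Lemma binom_poly_coef0 k : (binom_poly k.+1)`_0 = 0.
Proof.
rewrite coefZ big_ord_recl /= subr0 -horner_coef0 hornerM hornerX.
by rewrite mul0r mulr0.
Qed.

(** These linear coefficients are the coefficients of the logarithm series,
    as the derivative of [(1 + x)^X] in [X] at [0] is [log (1 + x)]. *)
Lemma binom_poly_coef1 k : (0 < k)%N ->
  (binom_poly k)`_1 = ratK ((-1) ^+ k.-1 / k%:R).
Proof.
case: k => // k _; rewrite coefZ big_ord_recl /= subr0 coefXM /= -horner_coef0.
have -> : (\prod_(i < k) ('X - ((bump 0 i)%:R)%:P : {poly K})).[0]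
    = ratK ((-1) ^+ k * k`!%:R).
  elim: k => [|k IH]; first by rewrite big_ord0 hornerC expr0 mul1r ratK_nat.
  rewrite big_ord_recr hornerM IH hornerXsubC /= /bump leq0n add1n sub0r.
  rewrite -ratK_nat -[- ratK _]mulN1r -[-1]/(- 1%:R).
  have -> : - 1%:R = ratK (- 1) :> K by rewrite /ratK scaleNr scale1r.
  by rewrite -!ratKM; congr ratK; rewrite factS natrM exprSr; ring.
rewrite -ratKM; congr ratK; rewrite factS natrM.
have k1 : k.+1%:R != 0 :> rat by rewrite pnatr_eq0.
have k2 : k`!%:R != 0 :> rat by rewrite pnatr_eq0 -lt0n fact_gt0.
move: k1 k2; move: (k.+1%:R : rat) (k`!%:R : rat) ((-1) ^+ k : rat) => x y z x0 y0.
by field; rewrite x0 y0.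
Qed.
End BinomialPolynomials.

Section Eulerian.
Variables (K : comAlgType rat) (d : nat) (m : product K d).
Local Notation comp := (Defs.comp d).
Local Notation H := (H K d).
Implicit Types (a b c u : comp) (x y z : H).
Hypothesis bi_m : bialgebra_product m.
Local Notation J := (conv_pow m (@aug_proj K d)).

HB.instance Definition _ := GRing.isLinear.Build K H H *:%R
  (eulerian m) (lin_ext_is_linear _).

(** The filtration by number of blocks bounds all sums that are finite only
    on each element. *)
Definition nblocks_lt (N : nat) x := forall c, c \in msupp x -> (nblocks c < N)%N.

Lemma nblocks_lt_ex x : exists N, nblocks_lt N x.
Proof.
exists (\sum_(c <- msupp x) nblocks c).+1 => c cx.
by rewrite ltnS (big_fsetD1 c) //= leq_addr.
Qed.

Lemma conv_pow_id_binomial_lt n N x : nblocks_lt N x ->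
  conv_pow m id n x = \sum_(k < N) 'C(n, k)%:R *: J k x.
Proof.
move=> xN; rewrite {1 2}(malg_sum x) [LHS](linear_sum (conv_pow m id n)).
under [RHS]eq_bigr do rewrite linear_sum scaler_sumr.
rewrite exchange_big /= big_seq [RHS]big_seq; apply: eq_bigr => a ax.
rewrite linearZ /= (conv_pow_id_binomial bi_m n (xN _ ax)) scaler_sumr.
by apply: eq_bigr => k _; rewrite [conv_pow _ _ _ (_ *: _)]linearZ /= !scalerA mulrC.
Qed.

Lemma eulerianU_lt N a : (nblocks a < N)%N -> eulerian m << a >> =
  \sum_(1 <= k < N) ratK K ((-1) ^+ k.-1 / k%:R) *: J k << a >>.
Proof.
move=> aN; rewrite /eulerian lin_extU.
rewrite [RHS](big_cat_nat (n := (nblocks a).+1)) //= [X in _ + X]big_nat_cond.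
rewrite [X in _ + X]big1 ?addr0 // => k /andP[/andP[ak _] _].
by rewrite conv_pow_aug_proj_eq0 // scaler0.
Qed.

Lemma eulerian_lt N x : nblocks_lt N x -> eulerian m x =
  \sum_(1 <= k < N) ratK K ((-1) ^+ k.-1 / k%:R) *: J k x.
Proof.
move=> xN; rewrite {1 2}(malg_sum x) linear_sum.
under [RHS]eq_bigr do rewrite linear_sum scaler_sumr.
rewrite exchange_big /= big_seq [RHS]big_seq; apply: eq_bigr => a ax.
rewrite linearZ /= (eulerianU_lt (xN _ ax)) scaler_sumr.
by apply: eq_bigr => k _; rewrite [conv_pow _ _ _ (_ *: _)]linearZ /= !scalerA mulrC.
Qed.

Lemma nblocks_lt_leq N N' x : (N <= N')%N -> nblocks_lt N x -> nblocks_lt N' x.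
Proof. by move=> NN xN c /xN/leq_trans->. Qed.

Lemma nblocks_ltU N a : (nblocks a < N)%N -> nblocks_lt N << a >>.
Proof. by move=> aN c; rewrite msuppU oner_eq0 inE => /eqP ->. Qed.

Lemma eulerian_e : eulerian m << ecomp >> = 0.
Proof. by rewrite /eulerian lin_extU nblocks_e big_geq. Qed.

Lemma eulerian_connected u : connected u -> eulerian m << u >> = << u >>.
Proof.
move=> cu; rewrite /eulerian lin_extU (nblocks_connected cu) big_nat1 /=.
rewrite expr0 divr1 !scale1r conv_powS (sum_seq_delta (j := (u, ecomp))) ?splits_uniq //.
  rewrite mem_splits /= diag0e eqxx /conv_pow /= /unitH /counit mcoeffUU scale1r mulx1 //.
  rewrite /aug_proj /unitH /counit mcoeffU eq_sym [_ == _]eq_sym (negPf (connected_ne cu)).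
  by rewrite scale0r subr0.
move=> [b b']; rewrite mem_splits /= => /eqP E ne.
rewrite /conv_pow /= /unitH /counit mcoeffU; case: eqVneq => [b'e|_]; last first.
  by rewrite scale0r linear0.
by rewrite -E b'e diag0e xpair_eqE !eqxx in ne.
Qed.

(** Compare the linear coefficients in [n] of the two expansions of
    [id^n (a b) = id^n a id^n b]: on the left it is the Eulerian idempotent of
    [a b], on the right every term has a double zero at [n = 0] because the
    zeroth convolution power vanishes on [a] and on [b]. *)
Lemma eulerian_product a b : comm_assoc_product m ->
  a <> ecomp -> b <> ecomp -> eulerian m (m a b) = 0.
Proof.
move=> ca_m /eqP ae /eqP be; apply/malgP => c; rewrite mcoeff0.
have [N0 hN0] := nblocks_lt_ex (m a b).
pose N := maxn N0 (maxn (nblocks a).+1 (nblocks b).+1).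
have hab : nblocks_lt N (m a b) by apply: nblocks_lt_leq hN0; rewrite leq_maxl.
have ha : nblocks_lt N << a >> by apply: nblocks_ltU; rewrite !leq_max leqnn !orbT.
have hb : nblocks_lt N << b >> by apply: nblocks_ltU; rewrite !leq_max leqnn !orbT.
pose v k := (J k (m a b))@_c.
pose w i j := (mul m (J i << a >>) (J j << b >>))@_c.
(* [Q] is the difference of the two expansions at the coefficient [c], with the
   power [n] replaced by the indeterminate. *)
pose Q : {poly K} := \sum_(k < N) v k *: binom_poly K k -
  \sum_(i < N) \sum_(j < N) w i j *: (binom_poly K i * binom_poly K j).
have Q0 : Q = 0.
  apply: (@poly_eq0_on_nat _ 0) => n _.
  rewrite hornerD hornerN !horner_sum; apply/eqP; rewrite subr_eq0; apply/eqP.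
  have := conv_pow_id_mul bi_m n << a >> << b >> ca_m.
  rewrite mulUU (conv_pow_id_binomial_lt _ hab) (conv_pow_id_binomial_lt _ ha).
  rewrite (conv_pow_id_binomial_lt _ hb) => /malgP/(_ c).
  rewrite mul_suml !mcoeff_sum => E.
  transitivity (\sum_(i < N) ('C(n, i)%:R *: J i (m a b))@_c).
    by apply: eq_bigr => i _; rewrite hornerZ horner_binom_poly mcoeffZ mulrC.
  rewrite E; apply: eq_bigr => i _; rewrite horner_sum linear_sum mcoeff_sum.
  apply: eq_bigr => j _; rewrite hornerZ hornerM !horner_binom_poly /= mulZl.
  rewrite [mul m _ (_ *: _)]linearZ /=.
  by rewrite !mcoeffZ mulrA mulrC.
have J0 e : e != ecomp -> J 0 << e >> = 0.
  by move=> ee; rewrite /conv_pow /= /unitH /counit mcoeffU (negPf ee) scale0r.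
have : Q`_1 = 0 by rewrite Q0 coef0.
rewrite coefB [X in _ - X]coef_sum [X in _ - X]big1 ?subr0; last first.
  move=> [[|i] hi] _; rewrite coef_sum big1 // => -[[|j] hj] _ /=.
  - by rewrite /w J0 // mul0l mcoeff0 scale0r coef0.
  - by rewrite /w J0 // mul0l mcoeff0 scale0r coef0.
  - by rewrite /w (J0 b) // linear0 mcoeff0 scale0r coef0.
  rewrite coefZ coefM big_ord_recl big_ord1 /= !binom_poly_coef0.
  by rewrite mul0r mulr0 addr0 mulr0.
rewrite (eulerian_lt hab) mcoeff_sum coef_sum => {}Q0; rewrite -[RHS]Q0.
have -> : \sum_(k < N) (v k *: binom_poly K k)`_1 =
  \sum_(0 <= k < N) (v k *: binom_poly K k)`_1 by rewrite big_mkord.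
have [->|N0'] := posnP N; first by rewrite !big_geq.
rewrite [RHS]big_ltn //= coefZ {1}/v.
have -> : (binom_poly K 0)`_1 = 0 by rewrite coefZ big_ord0 coefC mulr0.
rewrite mulr0 add0r; apply: eq_big_nat => k /andP[k0 _].
by rewrite coefZ binom_poly_coef1 // mcoeffZ mulrC.
Qed.
End Eulerian.

(** * The block shuffle *)

Section BlockShuffle.
Variables (K : comNzRingType) (d : nat).
Local Notation comp := (Defs.comp d).
Local Notation H := (H K d).
Local Notation bsh := (@bshuffle K d).
Implicit Types (a b c u w : comp).

Lemma comp_case a : a = ecomp \/ exists u b, connected u /\ a = diag u b.
Proof. by elim/comp_ind: a => [|u x cu _]; [left | right; exists u, x]. Qed.

Lemma diag_connected_ne u b : connected u -> diag u b != ecomp.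
Proof. by move=> cu; rewrite diag_eq_e (negPf (connected_ne cu)). Qed.

Lemma mcoeff_diagHU u w b (z : H) : connected u -> connected w ->
  (diagH << u >> z)@_(diag w b) = (u == w)%:R * z@_b.
Proof.
move=> cu cw; rewrite mcoeff_diagH_connected // ?mcoeffU // => c nc.
by rewrite mcoeffU; case: eqP => // uc; case: nc; rewrite -uc.
Qed.

Lemma mcoeff_diagHU_e u (z : H) : connected u -> (diagH << u >> z)@_ecomp = 0.
Proof.
move=> cu; rewrite mcoeff_diagH splits_e big_seq1 /= mcoeffU (negPf (connected_ne cu)).
by rewrite mul0r.
Qed.

(** A term of a block shuffle of non-empty compositions starts with the first
    block of one of them. *)
Lemma bshuffle_counit a b : (bsh a b)@_ecomp = ((a == ecomp) && (b == ecomp))%:R.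
Proof.
have [->|[u [a' [cu ->]]]] := comp_case a.
  by rewrite (bshuffle_e K b).1 mcoeffU eqxx.
have [->|[v [b' [cv ->]]]] := comp_case b.
  by rewrite (bshuffle_e K _).2 mcoeffU eqxx andbT.
rewrite bshuffle_diag // mcoeffD !mcoeff_diagHU_e // addr0.
by rewrite (negPf (diag_connected_ne _ cu)).
Qed.

Lemma sum_splits_head u w b (G : comp -> K) : connected u -> connected w ->
  \sum_(p <- splits (diag u b)) (p.1 == w)%:R * G p.2 = (u == w)%:R * G b.
Proof.
move=> cu cw; rewrite (sum_seq_delta (j := (u, b))) ?splits_uniq //.
  by rewrite mem_splits eqxx.
move=> [p1 p2]; rewrite mem_splits /= => /eqP E; have [pw|_ _] := eqVneq p1 w; last first.
  by rewrite mul0r.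
have cp1 : connected p1 by rewrite pw.
by have [-> ->] := connected_diag_inj cp1 cu E; rewrite eqxx.
Qed.

(** The transpose of the defining recursion: the first block [w] of a term of
    the shuffle is the first block of [a] or that of [b]. *)
Lemma bshuffle_rec_coef w c a b : connected w ->
  (bsh a b)@_(diag w c) =
    \sum_(p <- splits a) (p.1 == w)%:R * (bsh p.2 b)@_c +
    \sum_(q <- splits b) (q.1 == w)%:R * (bsh a q.2)@_c.
Proof.
move=> cw; have we := negPf (connected_ne cw).
have [->|[u [a' [cu ->]]]] := comp_case a; have [->|[v [b' [cv ->]]]] := comp_case b.
- rewrite !splits_e !big_seq1 /= (bshuffle_e K _).1 mcoeffU [_ == diag _ _]eq_sym.
  by rewrite diag_eq_e we [ecomp == w]eq_sym we !mul0r addr0.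
- rewrite splits_e big_seq1 /= [ecomp == w]eq_sym we mul0r add0r.
  rewrite (sum_splits_head _ (fun x => (bsh ecomp x)@_c)) // !(bshuffle_e K _).1.
  rewrite !mcoeffU; case: eqVneq => [/(connected_diag_inj cv cw)[-> ->]|ne].
    by rewrite !eqxx mulr1.
  case: eqVneq => [vw|_]; last by rewrite mul0r.
  by rewrite mul1r; case: eqVneq => // bc; rewrite vw bc eqxx in ne.
- rewrite splits_e big_seq1 /= [ecomp == w]eq_sym we mul0r addr0.
  rewrite (sum_splits_head _ (fun x => (bsh x ecomp)@_c)) // !(bshuffle_e K _).2.
  rewrite !mcoeffU; case: eqVneq => [/(connected_diag_inj cu cw)[-> ->]|ne].
    by rewrite !eqxx mulr1.
  case: eqVneq => [vw|_]; last by rewrite mul0r.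
  by rewrite mul1r; case: eqVneq => // bc; rewrite vw bc eqxx in ne.
rewrite (sum_splits_head _ (fun x => (bsh x (diag v b'))@_c)) //.
rewrite (sum_splits_head _ (fun x => (bsh (diag u a') x)@_c)) //.
by rewrite bshuffle_diag // mcoeffD !mcoeff_diagHU.
Qed.

Lemma bshuffle_connected_coef w a b : connected w -> (bsh a b)@_w =
  (a == w)%:R * (b == ecomp)%:R + (a == ecomp)%:R * (b == w)%:R.
Proof.
move=> cw; rewrite -{1}[w]diag0e bshuffle_rec_coef //; congr (_ + _).
  rewrite (sum_seq_delta (j := (a, ecomp))) ?splits_uniq //.
    by rewrite mem_splits /= diag0e eqxx bshuffle_counit eqxx.
  move=> [x y]; rewrite mem_splits bshuffle_counit xpair_eqE /= => /eqP <-.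
  have [->|] := eqVneq y ecomp; last by rewrite /= mulr0.
  by rewrite diag0e eqxx.
rewrite (sum_seq_delta (j := (b, ecomp))) ?splits_uniq //.
  by rewrite mem_splits /= diag0e eqxx bshuffle_counit eqxx andbT mulrC.
move=> [x y]; rewrite mem_splits bshuffle_counit xpair_eqE /= => /eqP <-.
have [->|] := eqVneq y ecomp; last by rewrite !andbF mulr0.
by rewrite diag0e eqxx.
Qed.

(** By [bshuffle_connected_coef] at a connected [w] only the pairs [(w, e)] and
    [(e, w)] contribute, so the convolution with a connected first factor is
    the recursion [bshuffle_rec_coef]. *)
Lemma bshuffle_bialgebra : bialgebra_product bsh.
Proof.
split=> [a|a|]; [by case: (bshuffle_e K a)|by case: (bshuffle_e K a)|].
split=> [[a b]|w c cw [a b]].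
  by rewrite /coefs2 bshuffle_counit /delta_e xpair_eqE.
rewrite /coefs2 /convol /= bshuffle_rec_coef // /splits2 big_allpairs_dep /=.
transitivity (\sum_(p <- splits a) \sum_(q <- splits b)
  ((p.1 == w)%:R * (q.1 == ecomp)%:R * (bsh p.2 q.2)@_c +
   (p.1 == ecomp)%:R * (q.1 == w)%:R * (bsh p.2 q.2)@_c)); last first.
  apply: eq_bigr => p _; apply: eq_bigr => q _.
  by rewrite (bshuffle_connected_coef _ _ cw) mulrDl.
have E (z : comp) (G : comp -> K) :
    \sum_(q <- splits z) (q.1 == ecomp)%:R * G q.2 = G z.
  rewrite (sum_seq_delta (j := (ecomp, z))) ?splits_uniq //.
    by rewrite mem_splits /= diage0 !eqxx mul1r.
  move=> [x y]; rewrite mem_splits /= => /eqP <-.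
  have [->|] := eqVneq x ecomp; last by rewrite mul0r.
  by rewrite diage0 eqxx.
under [RHS]eq_bigr do rewrite big_split /=.
rewrite big_split /=; congr (_ + _).
  apply: eq_bigr => p _; under eq_bigr do rewrite -mulrA.
  by rewrite -big_distrr /= (E _ (fun x => (bsh p.2 x)@_c)).
rewrite exchange_big /=; apply: eq_bigr => q _.
under eq_bigr do rewrite -mulrA mulrCA.
by rewrite -big_distrr /= (E _ (fun x => (bsh x q.2)@_c)).
Qed.

End BlockShuffle.

Section TensorSquareProduct.
Variables (K : comNzRingType) (d : nat).
Local Notation comp := (Defs.comp d).
Local Notation H := (H K d).
Local Notation HH := (HH K d).
Implicit Types (a b c u : comp) (x y z : H) (m : product K d).

(** The product of the tensor square of [(H, m)]. *)
Definition mul2 m (x y : HH) : HH :=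
  bilin_ext (fun p q : comp * comp => tens (m p.1 q.1) (m p.2 q.2)) x y.

HB.instance Definition _ m X := GRing.isLinear.Build K HH HH *:%R
  (mul2 m X) (bilin_ext_linr _ X).
Lemma mul2_linl m Y : linear (fun X => mul2 m X Y).
Proof. exact: bilin_ext_linl. Qed.

Lemma mul2_suml m I (r : seq I) (F : I -> HH) Y :
  mul2 m (\sum_(i <- r) F i) Y = \sum_(i <- r) mul2 m (F i) Y.
Proof. exact: (linear_sum (lin_ext _)). Qed.

Lemma mul2_tens m x x' y y' :
  mul2 m (tens x x') (tens y y') = tens (mul m x y) (mul m x' y').
Proof.
have H1 a b : forall y y', mul2 m (tens << a >> << b >>) (tens y y') =
    tens (mul m << a >> y) (mul m << b >> y').
  apply: bilinear_malg_ext.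
  - by move=> t k z z'; rewrite tens_linl linearP.
  - by move=> t k z z'; rewrite !linearP.
  - by move=> t k z z'; rewrite linearP tens_linl.
  - by move=> t k z z'; rewrite !linearP.
  by move=> e f; rewrite !tensU /mul2 bilin_extUU !mulUU.
apply: (bilinear_malg_ext (f := fun x x' => mul2 m (tens x x') (tens y y'))
  (g := fun x x' => tens (mul m x y) (mul m x' y'))) => //.
- by move=> t k z z'; rewrite tens_linl mul2_linl.
- by move=> t k z z'; rewrite linearP mul2_linl.
- by move=> t k z z'; rewrite mul_linl tens_linl.
- by move=> t k z z'; rewrite mul_linl linearP.
Qed.

Lemma coproduct_mul m x y : bialgebra_product m ->
  coproduct (mul m x y) = mul2 m (coproduct x) (coproduct y).
Proof.
move=> bi_m; apply: (bilinear_malg_ext (f := fun x y => coproduct (mul m x y))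
  (g := fun x y => mul2 m (coproduct x) (coproduct y))).
- by move=> t k z z'; rewrite mul_linl linearP.
- by move=> t k z z'; rewrite !linearP.
- by move=> t k z z'; rewrite linearP mul2_linl.
- by move=> t k z z'; rewrite !linearP.
move=> a b; rewrite mulUU coproduct_product // !coproductU.
rewrite mul2_suml; apply: eq_bigr => p _.
rewrite linear_sum; apply: eq_bigr => q _ /=.
by rewrite /mul2 bilin_extUU.
Qed.

Lemma coproduct_image (L : H -> H) a : unital_coalgebra_map L ->
  coproduct (L << a >>) = \sum_(p <- splits a) tens (L << p.1 >>) (L << p.2 >>).
Proof.
case=> _ _ -> _; rewrite coproductU linear_sum; apply: eq_bigr => p _ /=.
by rewrite tens_mapU.
Qed.

(** Both [(a, b) |-> L (m a b)] and, in [product_image_multiplicative],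
    [(a, b) |-> m (L a) (L b)] are coalgebra maps from the tensor square. *)
Lemma image_product_multiplicative m (L : H -> H) :
  bialgebra_product m -> unital_coalgebra_map L ->
  multiplicative_on_connected
    (fun c (p : comp2_fm d) => (L (m p.1 p.2))@_c).
Proof.
move=> bi_m [lL _ Ld Lc]; split=> [[a b]|u c _ [a b]].
  have := Lc (m a b); rewrite /counit => ->; case: bi_m => _ _ [He _].
  exact: (He (a, b)).
rewrite -[diag u c]/(diag (u, c).1 (u, c).2) -mcoeff_coproduct Ld.
rewrite coproduct_product // !linear_sum /convol /= /splits2 big_allpairs_dep /=.
rewrite mcoeff_sum; apply: eq_bigr => p _; rewrite linear_sum mcoeff_sum.
by apply: eq_bigr => q _ /=; rewrite tens_map_tens // mcoeff_tens.
Qed.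

Lemma product_image_multiplicative m (L : H -> H) :
  bialgebra_product m -> unital_coalgebra_map L ->
  multiplicative_on_connected
    (fun c (p : comp2_fm d) => (mul m (L << p.1 >>) (L << p.2 >>))@_c).
Proof.
move=> bi_m cL; case: (cL) => lL _ _ Lc; split=> [[a b]|u c _ [a b]].
  have := counit_mul (L << a >>) (L << b >>) bi_m; rewrite !Lc /counit /= => ->.
  by rewrite !mcoeffU -natrM mulnb /delta_e xpair_eqE.
rewrite -[diag u c]/(diag (u, c).1 (u, c).2) -mcoeff_coproduct.
rewrite coproduct_mul // !coproduct_image // /convol /= /splits2 big_allpairs_dep /=.
rewrite mul2_suml mcoeff_sum; apply: eq_bigr => p _.
rewrite linear_sum mcoeff_sum; apply: eq_bigr => q _ /=.
by rewrite mul2_tens mcoeff_tens.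
Qed.

End TensorSquareProduct.

(** * Unitriangular maps, logarithm and exponential *)

Section Unitriangular.
Variables (K : comAlgType rat) (d : nat).
Local Notation comp := (Defs.comp d).
Local Notation H := (H K d).
Implicit Types (a b c u : comp) (x y z : H).

(** On each element, [L] is the identity plus terms with fewer blocks. *)
Definition unitriangular (L : H -> H) := forall a c,
  (nblocks a <= nblocks c)%N -> (L << a >>)@_c = (a == c)%:R.

Lemma unitriangular_proj (L : H -> H) n k x : linear L -> unitriangular L ->
  (k <= n)%N -> proj_blocks n (L (proj_blocks k x)) = proj_blocks n (proj_blocks k x).
Proof.
move=> lL uL kn; apply: (linear_malg_ext
  (f := fun x => proj_blocks n (L (proj_blocks k x)))
  (g := fun x => proj_blocks n (proj_blocks k x))).
- by move=> r y z; rewrite !(lL, linearP).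
- by move=> r y z; rewrite !linearP.
move=> a; rewrite {2 4}/proj_blocks !lin_extU; case: eqP => [ak|_]; last first.
  have -> : L 0 = 0.
    by have := lL (-1) 0 0; rewrite scaler0 addr0 scaleN1r addNr.
  by [].
apply/malgP => c; rewrite !mcoeff_proj_blocks; case: eqP => // cn.
by rewrite uL ?ak ?cn // mcoeffU.
Qed.

Variable L : H -> H.
Hypothesis linL : linear L.
Hypothesis triL : unitriangular L.

(** For a unitriangular [L] this strictly lowers the number of blocks. *)
Definition lowering x : H := x - L x.

Lemma lowering_linear : linear lowering.
Proof.
by move=> k x y; rewrite /lowering linL scalerBr opprD addrACA.
Qed.

HB.instance Definition _ := GRing.isLinear.Build K H H *:%R lowering lowering_linear.

Lemma iter_lowering_linear n : linear (iter n lowering).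
Proof. by elim: n => // n IH k x y /=; rewrite IH linearP. Qed.

HB.instance Definition _ n := GRing.isLinear.Build K H H *:%R (iter n lowering)
  (iter_lowering_linear n).

Lemma lowering_lt N x : nblocks_lt N.+1 x -> nblocks_lt N (lowering x).
Proof.
move=> xN c; rewrite -mcoeff_neq0; apply: contraR; rewrite -leqNgt => Nc.
rewrite (malg_sum x) linear_sum mcoeff_sum big_seq big1 // => a ax.
rewrite linearZ mcoeffZ /lowering mcoeffB triL ?mcoeffU ?subrr ?mulr0 //.
by apply: leq_trans Nc; rewrite -ltnS xN.
Qed.

Lemma nblocks_lt0 x : nblocks_lt 0 x -> x = 0.
Proof.
by move=> x0; apply/malgP => c; rewrite mcoeff0; apply: mcoeff_outdom; apply/negP => /x0.
Qed.

Lemma iter_lowering_lt n N x : nblocks_lt (n + N) x -> nblocks_lt N (iter n lowering x).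
Proof.
elim: n N => // n IH N; rewrite addSnnS => /IH H /=; exact: lowering_lt.
Qed.

Lemma iter_lowering0 n N x : nblocks_lt N x -> (N <= n)%N -> iter n lowering x = 0.
Proof.
move=> xN Nn; apply: nblocks_lt0; apply: iter_lowering_lt; rewrite addn0.
exact: nblocks_lt_leq xN.
Qed.

(** The geometric series in [lowering], which inverts [L = 1 - lowering]; the
    powers beyond the number of blocks vanish. *)
Definition neumann : H -> H := lin_ext (fun a =>
  \sum_(i < (nblocks a).+1) iter i lowering << a >>).

HB.instance Definition _ := GRing.isLinear.Build K H H *:%R neumann
  (lin_ext_is_linear _).

Lemma neumann_lt N x : nblocks_lt N x ->
  neumann x = \sum_(i < N) iter i lowering x.
Proof.
move=> xN; rewrite {1 2}(malg_sum x) linear_sum.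
under [RHS]eq_bigr do rewrite linear_sum.
rewrite exchange_big /= big_seq [RHS]big_seq; apply: eq_bigr => a ax.
rewrite linearZ /= /neumann lin_extU scaler_sumr.
rewrite (big_ord_widen N (fun i => x@_a *: iter i lowering << a >>)) ?xN //.
rewrite big_mkcond; apply: eq_bigr => i _; rewrite [RHS]linearZ /=; case: ltnP => // ai.
by rewrite (@iter_lowering0 _ (nblocks a).+1) ?scaler0 //; apply: nblocks_ltU.
Qed.

Lemma lowering_sub x : L x = x - lowering x.
Proof. by rewrite /lowering opprB addrC subrK. Qed.

Lemma neumann_right_inverse : cancel neumann L.
Proof.
apply: (linear_malg_ext (f := L \o neumann) (g := fun x => x)) => // [k x y|a] /=.
  by rewrite linearP linL.
have aN : nblocks_lt (nblocks a).+1 (<< a >> : H) by apply: nblocks_ltU.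
rewrite (neumann_lt aN) lowering_sub linear_sum -sumrB -(big_mkord xpredT (fun i =>
  iter i lowering << a >> - lowering (iter i lowering << a >>))).
rewrite (eq_bigr (fun i => - (iter i.+1 lowering << a >> - iter i lowering << a >>))).
  by rewrite sumrN telescope_sumr // (iter_lowering0 aN) // sub0r opprK.
by move=> i _; rewrite [RHS]opprB.
Qed.

Lemma lowering_neumann x : neumann (lowering x) = neumann x - x.
Proof.
have [N xN] := nblocks_lt_ex x.
have xN1 := nblocks_lt_leq (leqnSn N) xN.
have lxN := lowering_lt xN1.
rewrite (neumann_lt xN1) (neumann_lt lxN) big_ord_recl /= [_ - x]addrAC subrr add0r.
by apply: eq_bigr => i _; rewrite -iterSr.
Qed.

Lemma neumann_left_inverse : cancel L neumann.
Proof.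
by move=> x; rewrite lowering_sub linearB /= lowering_neumann opprB addrC subrK.
Qed.

Lemma neumann_unitriangular : unitriangular neumann.
Proof.
move=> a c ac; rewrite /neumann lin_extU big_ord_recl mcoeffD mcoeffU mcoeff_sum.
rewrite big1 ?addr0 // => i _; apply: mcoeff_outdom.
have aN : nblocks_lt (nblocks a).+1 (<< a >> : H) by apply: nblocks_ltU.
have iN : nblocks_lt (nblocks a) (iter (bump 0 i) lowering << a >>).
  rewrite /bump leq0n add1n iterSr; have := lowering_lt aN.
  elim: (i : nat) (lowering _) => // n IH y yN.
  by rewrite iterSr; apply: IH; apply: lowering_lt; apply: nblocks_lt_leq yN.
by apply/negP => /iN; rewrite ltnNge ac.
Qed.

Lemma sum_proj_blocks k x : nblocks_lt k x -> x = \sum_(j < k) proj_blocks j x.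
Proof.
move=> xk; apply/malgP => c; rewrite mcoeff_sum.
have [ck|kc] := ltnP (nblocks c) k.
  rewrite (bigD1 (Ordinal ck)) //= mcoeff_proj_blocks eqxx big1 ?addr0 // => j jc.
  by rewrite mcoeff_proj_blocks; case: eqP => // E; case/eqP: jc; apply: val_inj.
rewrite mcoeff_outdom ?big1 // => [j _|]; last by apply/negP => /xk; rewrite ltnNge kc.
by rewrite mcoeff_proj_blocks; case: eqP => // E; move: kc; rewrite E leqNgt ltn_ord.
Qed.

Lemma nblocks_lt_proj k x : nblocks_lt k.+1 (proj_blocks k x).
Proof.
move=> c; rewrite -mcoeff_neq0 mcoeff_proj_blocks.
by case: (nblocks c =P k) => [->|]; rewrite ?eqxx.
Qed.

Lemma unitriangular_lt N x : nblocks_lt N x -> nblocks_lt N (L x).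
Proof.
move=> xN c; rewrite lowering_sub -mcoeff_neq0 mcoeffB => ne.
have lx := lowering_lt (nblocks_lt_leq (leqnSn N) xN).
rewrite ltnNge; apply: contra ne => Nc; rewrite !mcoeff_outdom ?subrr //.
  by apply/negP => /lx; rewrite ltnNge Nc.
by apply/negP => /xN; rewrite ltnNge Nc.
Qed.

Lemma proj_blocksK n k x :
  proj_blocks n (proj_blocks k x) = if n == k then proj_blocks k x else 0.
Proof.
have [->|nk] := eqVneq n k; apply/malgP => c.
  by rewrite !mcoeff_proj_blocks; case: eqP.
rewrite mcoeff0 !mcoeff_proj_blocks; case: (nblocks c =P n) => // ->.
by rewrite (negPf nk).
Qed.

(** The component of [neumann (L y) = y] with [n < k] blocks, for [y] with [k]
    blocks: in the sum over the components of [L y] those with [j < n] blocks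
    contribute nothing by triangularity, and the one with [k] blocks is [y]. *)
Lemma neumann_recursion n k x : (n < k)%N ->
  proj_blocks n (neumann (proj_blocks k x)) =
  - \sum_(n <= j < k) proj_blocks n (neumann (proj_blocks j (L (proj_blocks k x)))).
Proof.
move=> nk; apply/eqP; rewrite -addr_eq0; apply/eqP.
set y := proj_blocks k x; set z := L y.
have zk : nblocks_lt k.+1 z by apply: unitriangular_lt; apply: nblocks_lt_proj.
have : proj_blocks n (neumann z) = 0.
  by rewrite neumann_left_inverse /y proj_blocksK (ltn_eqF nk).
rewrite {1}(sum_proj_blocks zk) linear_sum linear_sum.
rewrite big_ord_recr -(big_mkord xpredT (fun j => proj_blocks n (neumann (proj_blocks j z)))).
rewrite (big_cat_nat (n := n)) ?(ltnW nk) //= big_nat big1 ?add0r; last first.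
  move=> j /andP[_ jn]; rewrite (unitriangular_proj _ _ neumann_unitriangular (ltnW jn)).
    by rewrite proj_blocksK (gtn_eqF jn).
  exact: lin_ext_is_linear.
by rewrite [proj_blocks k z](unitriangular_proj x linL triL (leqnn k)) proj_blocksK eqxx addrC.
Qed.

End Unitriangular.

Section Transfer.
Variables (K : comAlgType rat) (d : nat).
Local Notation H := (H K d).

(** The inverse commutes with the coproducts because [tens_map g g] is a left
    inverse of [tens_map f f]. *)
Lemma inverse_bialgebra_map (m1 m2 : product K d) (f g : H -> H) :
  linear g -> cancel f g -> cancel g f ->
  bialgebra_map m1 m2 f -> bialgebra_map m2 m1 g.
Proof.
move=> lg fK gK [[lf fe fd fc] fm]; split; last first.
  by move=> x y; rewrite -{1}(gK x) -{1}(gK y) -fm fK.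
split=> //.
- by rewrite -fe fK.
- move=> x; have gf : forall z, tens_map g g (tens_map f f z) = z.
    apply: (linear_malg_ext (g := fun z => z)) => // [k y z|p]; first by rewrite !linearP.
    by rewrite tens_mapU tens_map_tens // !fK tensU; case: p.
  by rewrite -[LHS]gf -fd gK.
by move=> x; rewrite -fc gK.
Qed.

End Transfer.

Section LogExp.
Variables (K : comAlgType rat) (d : nat) (m : product K d).
Local Notation comp := (Defs.comp d).
Local Notation H := (H K d).
Implicit Types (a b c u : comp) (x y z : H).
Hypothesis bi_m : bialgebra_product m.
Hypothesis ca_m : comm_assoc_product m.

Local Notation psi := (fun x => proj_blocks 1 (eulerian m x)).

Lemma log_gen_e : psi << ecomp >> = 0.
Proof. by rewrite /= eulerian_e linear0. Qed.

Lemma log_gen_prim a c : ~ connected c -> (psi << a >>)@_c = 0.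
Proof.
by move=> nc; rewrite mcoeff_proj_blocks; case: eqP => // /nblocks1_connected /nc.
Qed.

Lemma log_gen_id u : connected u -> psi << u >> = << u >>.
Proof.
move=> cu; rewrite /= eulerian_connected // /proj_blocks lin_extU.
by rewrite nblocks_connected.
Qed.

Lemma LogH_coalgebra : unital_coalgebra_map (LogH m).
Proof. exact: (coalg_lift_coalgebra log_gen_e log_gen_prim). Qed.

Lemma LogH_proj x : counit x = 0 -> proj_blocks 1 (LogH m x) = proj_blocks 1 (eulerian m x).
Proof.
move=> x0; rewrite (malg_sum x) /LogH !linear_sum; apply: eq_bigr => a _.
rewrite !linearZ /=; have [->|/eqP ae] := eqVneq a ecomp.
  by rewrite [x@_ecomp]x0 !scale0r.
by rewrite (proj_coalg_lift log_gen_e log_gen_prim ae).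
Qed.

Lemma LogH_unitriangular : unitriangular (LogH m).
Proof.
move=> a c ac; exact: (coalg_lift_triangular log_gen_e log_gen_prim log_gen_id ac).
Qed.

(** Both sides are coalgebra maps from the tensor square, so by freeness it is
    enough to compare coefficients at a connected [u]. If one factor is empty
    this is unitality; otherwise the left side is [psi (m a b)], which
    vanishes, and a block shuffle contributes to [u] only if one of its
    factors is empty. *)
Lemma LogH_mul x y : LogH m (mul m x y) = mul (@bshuffle K d) (LogH m x) (LogH m y).
Proof.
have [lL Le _ _] := LogH_coalgebra.
apply: (bilinear_malg_ext (f := fun x y => LogH m (mul m x y))
  (g := fun x y => mul (@bshuffle K d) (LogH m x) (LogH m y))).
- by move=> t k z z'; rewrite mul_linl lL.
- by move=> t k z z'; rewrite linearP lL.
- by move=> t k z z'; rewrite lL mul_linl.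
- by move=> t k z z'; rewrite lL linearP.
move=> a b; rewrite mulUU; apply/malgP => c.
have H1 := image_product_multiplicative bi_m LogH_coalgebra.
have H2 := product_image_multiplicative (bshuffle_bialgebra K d) LogH_coalgebra.
apply: (multiplicative_eq H1 H2 _ c (a, b)) => u cu [{c}a {}b] /=.
have bi_b := bshuffle_bialgebra K d; have [m1 m2 _] := bi_m.
have [->|/eqP ae] := eqVneq a ecomp; first by rewrite m1 Le mul1x.
have [->|/eqP be] := eqVneq b ecomp; first by rewrite m2 Le mulx1.
have PE x' : counit x' = 0 -> (LogH m x')@_u = (proj_blocks 1 (eulerian m x'))@_u.
  by move=> /LogH_proj <-; rewrite mcoeff_proj_blocks nblocks_connected.
rewrite PE; last first.
  by rewrite -mulUU counit_mul // /counit mcoeffU; move/eqP/negPf: ae => ->; rewrite mul0r.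
rewrite eulerian_product // linear0 mcoeff0 (malg_sum (LogH m << a >>)) mul_suml.
rewrite mcoeff_sum big1 // => a' _; rewrite mulZl mcoeffZ (malg_sum (LogH m << b >>)).
rewrite linear_sum mcoeff_sum big_distrr big1 // => b' _.
rewrite linearZ mcoeffZ /= mulUU bshuffle_connected_coef //.
have L0 e : e <> ecomp -> (LogH m << e >>)@_ecomp = 0.
  by move=> /eqP ee; rewrite (coalg_lift_e_coef log_gen_e log_gen_prim) (negPf ee).
have [->|_] := eqVneq b' ecomp; first by rewrite L0 // mul0r mulr0.
have [->|_] := eqVneq a' ecomp; first by rewrite L0 // mul0r.
by rewrite mulr0 mul0r addr0 !mulr0.
Qed.

Theorem Log_isomorphism :
  [/\ bialgebra_map m (@bshuffle K d) (LogH m),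
      forall x, counit x = 0 -> proj_blocks 1 (LogH m x) = proj_blocks 1 (eulerian m x)
    & forall L : H -> H, unital_coalgebra_map L ->
        (forall x, counit x = 0 -> proj_blocks 1 (L x) = proj_blocks 1 (eulerian m x)) ->
        L =1 LogH m] /\
  exists Exp : H -> H,
    [/\ cancel (LogH m) Exp, cancel Exp (LogH m), bialgebra_map (@bshuffle K d) m Exp,
        forall k x, proj_blocks k (Exp (proj_blocks k x)) = proj_blocks k x
      & forall n k x, (0 < n)%N -> (n < k)%N ->
          proj_blocks n (Exp (proj_blocks k x)) =
          - \sum_(n <= j < k) proj_blocks n (Exp (proj_blocks j (LogH m (proj_blocks k x))))].
Proof.
have cL := LogH_coalgebra; have [lL _ _ _] := cL.
have bL : bialgebra_map m (@bshuffle K d) (LogH m) by split=> //; apply: LogH_mul.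
have tri := LogH_unitriangular.
have lE : linear (neumann (LogH m)) by apply: lin_ext_is_linear.
have LK := neumann_left_inverse lL tri; have EK := neumann_right_inverse lL tri.
split.
  split=> // [|L cL' HL]; first exact: LogH_proj.
  apply: coalgebra_map_eq => // a /eqP ae.
  have a0 : counit (<< a >> : H) = 0 by rewrite /counit mcoeffU (negPf ae).
  by rewrite HL // LogH_proj.
exists (neumann (LogH m)); split=> //.
- exact: inverse_bialgebra_map bL.
- move=> k x; rewrite unitriangular_proj //; first by rewrite proj_blocksK eqxx.
  exact: neumann_unitriangular.
by move=> n k x _ nk; apply: neumann_recursion.
Qed.
End LogExp.

(** * Subsequences and covering pairs *)

Section Subsequences.
Variable T : eqType.
Implicit Types (x : T) (l s t u : seq T).

Fixpoint subs l : seq (seq T) :=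
  if l is x :: l' then subs l' ++ [seq x :: s | s <- subs l'] else [:: [::]].

Lemma mem_subs s l : (s \in subs l) = subseq s l.
Proof.
elim: l s => [|x l IH] s /=; first by rewrite inE.
rewrite mem_cat IH; case: s => [|y s].
  by rewrite sub0seq.
have [->|yx] := eqVneq y x.
  rewrite mem_map ?IH; last by move=> ? ? [].
  apply/orP/idP => [[|//]|]; last by right.
  exact/subseq_trans/subseq_cons.
case: mapP => [[z _ [E]]|]; last by rewrite orbF.
by rewrite E eqxx in yx.
Qed.

Lemma subs_uniq l : uniq l -> uniq (subs l).
Proof.
elim: l => //= x l IH /andP[xl /IH ul]; rewrite cat_uniq ul map_inj_uniq ?ul ?andbT.
  apply/hasPn => _ /mapP[s _ ->]; rewrite mem_subs; apply: contra xl => /mem_subseq.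
  by apply; rewrite inE eqxx.
by move=> ? ? [].
Qed.

Lemma sum_subs_cat (V : nmodType) l1 l2 (F : seq T -> V) :
  \sum_(s <- subs (l1 ++ l2)) F s =
  \sum_(s <- subs l1) \sum_(t <- subs l2) F (s ++ t).
Proof.
elim: l1 F => [|x l1 IH] F /=; first by rewrite big_seq1.
by rewrite !big_cat /= !big_map !IH.
Qed.

(** The pairs of subsequences that jointly exhaust [l] (see [mem_covers]); the
    recursion places the head in the first, in the second or in both. *)
Fixpoint covers l : seq (seq T * seq T) :=
  if l is x :: l' then
    [seq (x :: p.1, p.2) | p <- covers l'] ++
    [seq (p.1, x :: p.2) | p <- covers l'] ++
    [seq (x :: p.1, x :: p.2) | p <- covers l']
  else [:: ([::], [::])].

(** Pairs of subsequences are grouped by their union. *)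
Lemma sum_subs2 (V : nmodType) l (G : seq T -> seq T -> V) :
  \sum_(s <- subs l) \sum_(t <- subs l) G s t =
  \sum_(u <- subs l) \sum_(p <- covers u) G p.1 p.2.
Proof.
elim: l G => [|x l IH] G /=; first by rewrite !big_seq1.
rewrite !big_cat /= !big_map; under eq_bigr do rewrite big_cat /= big_map.
under [X in _ + X = _]eq_bigr do rewrite big_cat /= big_map.
rewrite !big_split /= IH.
under [X in _ = _ + X]eq_bigr do rewrite !big_cat /= !big_map /=.
rewrite !big_split /= (IH (fun s t => G s (x :: t))) (IH (fun s t => G (x :: s) t)).
rewrite (IH (fun s t => G (x :: s) (x :: t))) -!addrA; congr (_ + _).
by rewrite addrCA.
Qed.

Lemma mem_covers l p : uniq l -> (p \in covers l) =
  [&& subseq p.1 l, subseq p.2 l & all (fun x => (x \in p.1) || (x \in p.2)) l].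
Proof.
move=> ul; apply/idP/and3P => [|[]]; case: p => s t /=.
  elim: l {ul} s t => [|x l IH] s t /=; first by rewrite inE => /eqP[-> ->].
  have sa (a b a' b' : seq T) : {subset a <= a'} -> {subset b <= b'} ->
      all (fun y => (y \in a) || (y \in b)) l ->
      all (fun y => (y \in a') || (y \in b')) l.
    move=> aa bb; apply: sub_all => y /orP[/aa ->|/bb ->] //.
    by rewrite orbT.
  rewrite !mem_cat => /or3P[] /mapP[[a b] /= /IH[ha hb hab] [-> ->]].
  - rewrite eqxx inE eqxx; split=> //=; first exact: subseq_trans (subseq_cons l x).
    by apply: sa hab => // y ya; rewrite inE ya orbT.
  - rewrite eqxx inE eqxx orbT; split=> //=; first exact: subseq_trans (subseq_cons l x).
    by apply: sa hab => // y ya; rewrite inE ya orbT.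
  rewrite !eqxx !inE eqxx; split=> //=.
  by apply: sa hab => y ya; rewrite inE ya orbT.
elim: l ul s t => [|x l IH] /= ul s t; first by case: s t => [|? ?] [].
have W (w : seq T) : subseq w (x :: l) ->
    (exists2 w', w = x :: w' & subseq w' l) \/ subseq w l.
  case: w => [|y w] /=; first by right; apply: sub0seq.
  by case: eqVneq => [->|_] h; [left; exists w|right].
case/andP: ul => xl ul.
have rem a b a' b' : {subset a <= x :: a'} -> {subset b <= x :: b'} ->
    all (fun y => (y \in a) || (y \in b)) l ->
    all (fun y => (y \in a') || (y \in b')) l.
  move=> aa bb /allP H; apply/allP => y yl.
  have /negPf yx : y != x by apply: contraNneq xl => <-.
  by case/orP: (H y yl) => [/aa|/bb]; rewrite inE yx /= => ->; rewrite ?orbT.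
have tl a : {subset a <= x :: a} by move=> y ya; rewrite inE ya orbT.
move=> /W[[s' -> hs]|hs] /W[[t' -> ht]|ht] /andP[hx hl]; rewrite !mem_cat.
- apply/or3P/Or33/mapP; exists (s', t') => //; apply: IH => //.
  exact: rem hl.
- apply/or3P/Or31/mapP; exists (s', t) => //; apply: IH => //.
  by apply: rem hl.
- apply/or3P/Or32/mapP; exists (s, t') => //; apply: IH => //.
  by apply: rem hl.
by case/orP: hx => [/(mem_subseq hs)|/(mem_subseq ht)] xl'; rewrite xl' in xl.
Qed.

Lemma covers_uniq l : uniq l -> uniq (covers l).
Proof.
elim: l => //= x l IH /andP[xl ul].
have nx a b : (a, b) \in covers l -> (x \in a = false) /\ (x \in b = false).
  rewrite mem_covers // => /and3P[/mem_subseq ha /mem_subseq hb _].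
  by split; [apply: contraNF xl => /ha | apply: contraNF xl => /hb].
rewrite !cat_uniq !map_inj_uniq ?IH //=; last first.
- by move=> [? ?] [? ?] /= [-> ->].
- by move=> [? ?] [? ?] /= [-> ->].
- by move=> [? ?] [? ?] /= [-> ->].
rewrite andbT; apply/andP; split; last first.
  apply/hasPn => _ /mapP[[a b] ab ->]; apply/mapP => -[[a' b'] ab' [E _]].
  by have := (nx _ _ ab').1; rewrite /= -E inE eqxx.
apply/hasPn => p; rewrite mem_cat => /orP[] /mapP[[a b] ab ->];
  apply/mapP => -[[a' b'] ab' /= [E1 E2]].
  by have := (nx _ _ ab).1; rewrite E1 inE eqxx.
by have := (nx _ _ ab').2; rewrite -E2 inE eqxx.
Qed.

End Subsequences.

Lemma covers_map (T T' : eqType) (h : T -> T') l :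
  covers (map h l) = [seq (map h p.1, map h p.2) | p <- covers l].
Proof. by elim: l => //= x l ->; rewrite !map_cat -!map_comp. Qed.

(** * Quasi-shuffles as covering pairs *)

Section QuasiShuffleSums.
Local Open Scope nat_scope.
Variables m s : nat.

(** A quasi-shuffle is recorded by the increasing sequences of its values on
    the two blocks of its domain. *)
Definition qsh_left j (q : qsh m s j) : seq nat :=
  [seq val (val q (lshift s i)) | i <- enum 'I_m].
Definition qsh_right j (q : qsh m s j) : seq nat :=
  [seq val (val q (rshift m i)) | i <- enum 'I_s].

Lemma size_qsh_left j (q : qsh m s j) : size (qsh_left q) = m.
Proof. by rewrite size_map size_enum_ord. Qed.
Lemma size_qsh_right j (q : qsh m s j) : size (qsh_right q) = s.
Proof. by rewrite size_map size_enum_ord. Qed.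

(** Sorted sequences with the same entries coincide, so the sequence of values
    is [iota 0 j] filtered by membership. *)
Lemma increasing_subseq_iota n j (f : 'I_n -> 'I_j) :
  (forall i k : 'I_n, i < k -> f i < f k) ->
  subseq [seq val (f i) | i <- enum 'I_n] (iota 0 j).
Proof.
move=> f_inc; set l := [seq _ | _ <- _].
have sl : sorted ltn l.
  rewrite sorted_map; apply: (@sub_sorted _ (relpre val ltn)) => [i k /=|].
    exact: f_inc.
  by rewrite -sorted_map val_enum_ord iota_ltn_sorted.
have -> : l = [seq x <- iota 0 j | x \in l].
  apply: (irr_sorted_eq ltn_trans ltnn) => //.
    by apply: sorted_filter; [exact: ltn_trans|exact: iota_ltn_sorted].
  move=> x; rewrite mem_filter mem_iota /= add0n; apply/idP/andP => [xl|[]//].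
  by split=> //; case/mapP: xl => i _ ->; exact: ltn_ord.
exact: filter_subseq.
Qed.

Lemma subseq_iota_inc j (l : seq nat) i k : subseq l (iota 0 j) ->
  i < k -> k < size l -> nth 0 l i < nth 0 l k.
Proof.
move=> lj ik kl; have sl : sorted ltn l.
  by apply: subseq_sorted lj _; [exact: ltn_trans|exact: iota_ltn_sorted].
apply: (sorted_ltn_nth ltn_trans 0 sl) => //; by rewrite inE // (ltn_trans ik).
Qed.

Lemma subseq_iota_lt j (l : seq nat) x : subseq l (iota 0 j) -> x \in l -> x < j.
Proof. by move=> /mem_subseq H /H; rewrite mem_iota. Qed.

Lemma qsh_pair_mem j (q : qsh m s j) :
  (qsh_left q, qsh_right q) \in covers (iota 0 j).
Proof.
have /andP[/andP[/forallP q1 /forallP q2] /forallP q3] := valP q.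
rewrite mem_covers ?iota_uniq //=; apply/and3P; split.
- by apply: increasing_subseq_iota => i k ik; move/forallP: (q1 i) => /(_ k); rewrite ik.
- by apply: increasing_subseq_iota => i k ik; move/forallP: (q2 i) => /(_ k); rewrite ik.
apply/allP => x; rewrite mem_iota add0n /= => xj.
have /existsP[u /eqP qu] := q3 (Ordinal xj).
case: (split_ordP u) qu => i -> qu; apply/orP; [left|right]; apply/mapP; exists i.
- by rewrite mem_enum.
- by rewrite qu.
- by rewrite mem_enum.
by rewrite qu.
Qed.

Lemma qsh_pair_inj j : injective (fun q : qsh m s j => (qsh_left q, qsh_right q)).
Proof.
move=> q q' [/eq_in_map E1 /eq_in_map E2]; apply: val_inj; apply/ffunP => u.
case: (split_ordP u) => i ->; apply: val_inj; first by apply: E1; rewrite mem_enum.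
by apply: E2; rewrite mem_enum.
Qed.

Lemma qsh_pair_ex j p : p \in covers (iota 0 j) -> size p.1 = m -> size p.2 = s ->
  exists q : qsh m s j, p = (qsh_left q, qsh_right q).
Proof.
rewrite mem_covers ?iota_uniq // => /and3P[h1 h2 h3] s1 s2.
have b1 (i : 'I_m) : nth 0 p.1 i < j.
  by apply: subseq_iota_lt h1 _; rewrite mem_nth ?s1.
have b2 (i : 'I_s) : nth 0 p.2 i < j.
  by apply: subseq_iota_lt h2 _; rewrite mem_nth ?s2.
pose f (u : 'I_(m + s)) : 'I_j :=
  match split u with inl i => Ordinal (b1 i) | inr i => Ordinal (b2 i) end.
have fl i : f (lshift s i) = Ordinal (b1 i) by rewrite /f (unsplitK (inl i)).
have fr i : f (rshift m i) = Ordinal (b2 i) by rewrite /f (unsplitK (inr i)).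
have fq : is_qsh (finfun f).
  apply/andP; split; [apply/andP; split|]; apply/forallP => x.
  - apply/forallP => y; apply/implyP => xy; rewrite !ffunE !fl /=.
    by apply: subseq_iota_inc h1 xy _; rewrite s1.
  - apply/forallP => y; apply/implyP => xy; rewrite !ffunE !fr /=.
    by apply: subseq_iota_inc h2 xy _; rewrite s2.
  have /orP[xp|xp] : (val x \in p.1) || (val x \in p.2).
  - by move/allP: h3; apply; rewrite mem_iota /=.
  - have xi : index (val x) p.1 < m by rewrite -s1 index_mem.
    apply/existsP; exists (lshift s (Ordinal xi)); rewrite ffunE fl.
    by apply/eqP/val_inj; rewrite /= nth_index.
  have xi : index (val x) p.2 < s by rewrite -s2 index_mem.
  apply/existsP; exists (rshift m (Ordinal xi)); rewrite ffunE fr.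
  by apply/eqP/val_inj; rewrite /= nth_index.
exists (exist _ (finfun f) fq); case: p s1 s2 h1 h2 h3 b1 b2 f fl fr fq => p1 p2 /=.
move=> s1 s2 h1 h2 h3 b1 b2 f fl fr fq; rewrite /qsh_left /qsh_right /=.
congr (_, _).
  rewrite -[LHS](mkseq_nth 0) /mkseq s1 -val_enum_ord -map_comp.
  by apply: eq_map => i /=; rewrite ffunE fl.
rewrite -[LHS](mkseq_nth 0) /mkseq s2 -val_enum_ord -map_comp.
by apply: eq_map => i /=; rewrite ffunE fr.
Qed.

(** Surjectivity of a quasi-shuffle means that its two value sequences cover
    the codomain. *)
Lemma sum_qsh (V : nmodType) j (F : seq nat -> seq nat -> V) :
  (\sum_(q : qsh m s j) F (qsh_left q) (qsh_right q) =
  \sum_(p <- covers (iota 0 j) | (size p.1 == m) && (size p.2 == s)) F p.1 p.2)%R.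
Proof.
rewrite -[RHS]big_filter.
transitivity (\sum_(z <- [seq (qsh_left q, qsh_right q) | q <- enum {: qsh m s j}])
  F z.1 z.2)%R; first by rewrite big_map big_enum.
apply: perm_big; apply: uniq_perm.
- by rewrite map_inj_uniq ?enum_uniq //; apply: qsh_pair_inj.
- by rewrite filter_uniq // covers_uniq // iota_uniq.
move=> p; rewrite mem_filter; apply/mapP/andP => [[q _ ->]|[/andP[/eqP p1 /eqP p2] pc]].
  by rewrite /= size_qsh_left size_qsh_right !eqxx qsh_pair_mem.
by have [q ->] := qsh_pair_ex pc p1 p2; exists q; rewrite ?mem_enum.
Qed.

Lemma map_nth_iota0 (u : seq nat) : map (nth 0 u) (iota 0 (size u)) = u.
Proof. exact: mkseq_nth. Qed.

Lemma size_covers (T : eqType) (l : seq T) p : uniq l -> p \in covers l ->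
  (size p.1 <= size l) && (size l <= size p.1 + size p.2).
Proof.
move=> ul; rewrite mem_covers // => /and3P[h1 h2 /allP h3].
rewrite size_subseq //= -size_cat uniq_leq_size // => x /h3.
by rewrite mem_cat.
Qed.

(** Image factorization: two increasing maps into [l] amount to a quasi-shuffle
    onto [j] points followed by an increasing map, which enumerates the union
    [u] of the two images. The bounds on [j] are automatic, since [u] has at
    least [m] and at most [m + s] elements. *)
Lemma sum_qsh_subs (V : nmodType) (l : seq nat) (G : seq nat -> seq nat -> V) :
  uniq l -> 0 < m ->
  (\sum_(1 <= j < (m + s).+1) \sum_(q : qsh m s j)
     \sum_(u <- subs l | size u == j)
       G (map (nth 0%N u) (qsh_left q)) (map (nth 0%N u) (qsh_right q)) =
  \sum_(s1 <- subs l | size s1 == m) \sum_(s2 <- subs l | size s2 == s) G s1 s2)%R.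
Proof.
move=> ul m0; rewrite [RHS]big_mkcond.
pose G' s1 s2 := (if (size s1 == m) && (size s2 == s) then G s1 s2 else 0)%R.
transitivity (\sum_(s1 <- subs l) \sum_(s2 <- subs l) G' s1 s2)%R; last first.
  apply: eq_bigr => s1 _; rewrite /G'; case: (size s1 == m) => /=.
    by rewrite [RHS]big_mkcond.
  by rewrite big1.
rewrite sum_subs2.
have E j : (\sum_(q : qsh m s j) \sum_(u <- subs l | size u == j)
    G (map (nth 0%N u) (qsh_left q)) (map (nth 0%N u) (qsh_right q)) =
   \sum_(u <- subs l | size u == j) \sum_(p <- covers u) G' p.1 p.2)%R.
  rewrite exchange_big /=; apply: eq_bigr => u /eqP uj.
  rewrite (sum_qsh j (fun a b => G (map (nth 0 u) a) (map (nth 0 u) b))) -uj.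
  rewrite -[in covers u](map_nth_iota0 u) covers_map big_map big_mkcond /=.
  by apply: eq_bigr => p _; rewrite /G' !size_map.
under eq_bigr do rewrite E big_mkcond /=.
rewrite exchange_big /= big_seq [RHS]big_seq; apply: eq_bigr => u; rewrite mem_subs => ul'.
have uu := subseq_uniq ul' ul.
have [h|h] := boolP (1 <= size u < (m + s).+1).
  rewrite (bigD1_seq (size u)) ?iota_uniq ?mem_index_iota //= eqxx [X in (_ + X)%R]big1 ?addr0 //.
  by move=> j; rewrite eq_sym => /negPf ->.
rewrite [LHS]big_nat [LHS]big1 => [|j jm]; last first.
  by case: eqP => // uj; rewrite uj jm in h.
rewrite big_seq [RHS]big1 // => p /(size_covers uu)/andP[h1 h2]; rewrite /G'.
case: ifP => // /andP[/eqP p1 /eqP p2]; case/negP: h.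
by rewrite p1 in h1; rewrite p1 p2 in h2; rewrite ltnS h2 (leq_trans m0).
Qed.

End QuasiShuffleSums.

(** * Arrays *)

Section Arrays.
Variable d : nat.
Local Notation Md := {cmonom 'I_d}.

(** Arrays are infinite in both directions, which avoids all bookkeeping of
    dimensions. They form a commutative monoid under the entrywise product,
    without non-trivial invertible elements. *)
Definition array := nat -> nat -> Md.
HB.instance Definition _ := gen_eqMixin array.
HB.instance Definition _ := gen_choiceMixin array.

Definition array_one : array := fun _ _ => mone.
Definition array_mul (X Y : array) : array := fun x y => mmul (X x y) (Y x y).

Lemma arrayP (X Y : array) : (forall x y, X x y = Y x y) -> X = Y.
Proof. by move=> XY; apply: funext => x; apply: funext => y. Qed.

Lemma array_mulA : associative array_mul.
Proof. by move=> X Y Z; apply: arrayP => x y; rewrite /array_mul mulmA. Qed.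
Lemma array_1mul : left_id array_one array_mul.
Proof. by move=> X; apply: arrayP => x y; rewrite /array_mul mul1m. Qed.
Lemma array_mul1 : right_id array_one array_mul.
Proof. by move=> X; apply: arrayP => x y; rewrite /array_mul mulm1. Qed.
Lemma array_mulC : commutative array_mul.
Proof. by move=> X Y; apply: arrayP => x y; rewrite /array_mul mulmC. Qed.
Lemma array_unit X Y : array_mul X Y = array_one -> X = array_one /\ Y = array_one.
Proof.
move=> XY; have H x y : X x y = mone /\ Y x y = mone.
  by apply: unitm; rewrite -[LHS]/(array_mul X Y x y) XY.
by split; apply: arrayP => x y; case: (H x y).
Qed.

HB.instance Definition _ := Choice_isMonomialDef.Build array
  array_mulA array_1mul array_mul1 array_unit.
HB.instance Definition _ := MonomialDef_isConomialDef.Build array array_mulC.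

Local Notation comp := (Defs.comp d).
Implicit Types (a b c : comp) (s t u v l : seq nat) (X Y : array).

(** The matrix [a] spread over the rows listed in [s] and the columns listed
    in [t]. At a row outside [s] the index is [size s]; for
    [size s = nrows a] this lies outside the matrix, so the entry is neutral
    there. *)
Definition spread s t a : array := fun x y => ext_entry a (index x s) (index y t).

Lemma mmul_arrayE X Y x y : mmul X Y x y = mmul (X x y) (Y x y).
Proof. by []. Qed.

Lemma ext_entry_row a x y : (nrows a <= x)%N -> ext_entry a x y = mone.
Proof. by move=> ax; rewrite ext_entry_out // ltnNge ax. Qed.
Lemma ext_entry_col a x y : (ncols a <= y)%N -> ext_entry a x y = mone.
Proof. by move=> ay; rewrite ext_entry_out // andbC ltnNge ay. Qed.

Lemma spread_row s t a x y : size s = nrows a -> x \notin s -> spread s t a x y = mone.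
Proof. by move=> sa xs; rewrite /spread ext_entry_row // memNindex // sa. Qed.
Lemma spread_col s t a x y : size t = ncols a -> y \notin t -> spread s t a x y = mone.
Proof. by move=> sa xs; rewrite /spread ext_entry_col // memNindex // sa. Qed.

Lemma index_iota0 n x : (x < n)%N -> index x (iota 0 n) = x.
Proof.
move=> xn; have := @index_uniq _ 0%N x (iota 0 n).
by rewrite size_iota nth_iota // add0n; apply; rewrite ?iota_uniq.
Qed.

Lemma spread_iota c : spread (iota 0 (nrows c)) (iota 0 (ncols c)) c = ext_entry c.
Proof.
apply: arrayP => x y; rewrite /spread.
have [xc|xc] := ltnP x (nrows c); last first.
  rewrite [RHS]ext_entry_row // ext_entry_row // memNindex ?size_iota //.
  by rewrite mem_iota add0n -leqNgt.
have [yc|yc] := ltnP y (ncols c); last first.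
  rewrite [RHS]ext_entry_col // ext_entry_col // memNindex ?size_iota //.
  by rewrite mem_iota add0n -leqNgt.
by rewrite !index_iota0.
Qed.

(** A composition has no trivial row or column, so if a spread array is the
    composition [c] then every row and column of [c] must be used. *)
Lemma spread_eq_ext s t a c :
  subseq s (iota 0 (nrows c)) -> subseq t (iota 0 (ncols c)) ->
  size s = nrows a -> size t = ncols a -> spread s t a = ext_entry c ->
  [/\ s = iota 0 (nrows c), t = iota 0 (ncols c) & a = c].
Proof.
move=> sc tc sa ta E.
have Es : s = iota 0 (nrows c).
  apply/eqP; rewrite -(size_subseq_leqif sc) eqn_leq size_subseq // uniq_leq_size ?iota_uniq //.
  move=> x; rewrite mem_iota /= => /row_ex[y _]; rewrite -E; apply: contraR => xs.
  by rewrite spread_row.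
have Et : t = iota 0 (ncols c).
  apply/eqP; rewrite -(size_subseq_leqif tc) eqn_leq size_subseq // uniq_leq_size ?iota_uniq //.
  move=> x; rewrite mem_iota /= => /col_ex[y _]; rewrite -E; apply: contraR => xs.
  by rewrite spread_col.
have ra : nrows a = nrows c by rewrite -sa Es size_iota.
have ca : ncols a = ncols c by rewrite -ta Et size_iota.
split=> //; apply: comp_ext => // x y.
by rewrite -[RHS]/((ext_entry c : array) x y) -E Es Et -ra -ca spread_iota.
Qed.

Lemma spread_diag s1 s2 t1 t2 a b : uniq (s1 ++ s2) -> uniq (t1 ++ t2) ->
  size s1 = nrows a -> size t1 = ncols a -> size s2 = nrows b -> size t2 = ncols b ->
  spread (s1 ++ s2) (t1 ++ t2) (diag a b) = mmul (spread s1 t1 a) (spread s2 t2 b).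
Proof.
move=> us ut s1a t1a s2b t2b; apply: arrayP => x y; rewrite mmul_arrayE.
have dis (p q : seq nat) z : uniq (p ++ q) -> z \in p -> z \notin q.
  rewrite cat_uniq => /and3P[_ /hasPn H _] zp; apply/negP => /H; by rewrite zp.
rewrite {1}/spread ext_entry_diag !index_cat.
have [xs|xs] := boolP (x \in s1); have [yt|yt] := boolP (y \in t1).
- rewrite -s1a -t1a !index_mem xs yt /= [X in mmul _ X]spread_row ?mulm1 //.
  exact: dis xs.
- rewrite -s1a -t1a index_mem xs ltnNge leq_addr /= leqNgt index_mem xs /=.
  by rewrite spread_col // spread_row ?mulm1 //; apply: dis xs.
- rewrite -s1a -t1a ltnNge leq_addr /= [(size t1 <= _)%N]leqNgt index_mem yt.
  by rewrite spread_row // spread_col ?mulm1 //; apply: dis yt.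
rewrite -s1a -t1a ltnNge !leq_addr /= !addKn.
by rewrite [X in mmul X _]spread_row ?mul1m.
Qed.

(** An injective [f] has at most one point over [x]. If there is none, the
    index is [n], where [G] is neutral by assumption. *)
Lemma big_mmul_fiber n j (f : 'I_n -> 'I_j) x (G : nat -> Md) :
  injective f -> (forall i, (n <= i)%N -> G i = mone) ->
  \big[mmul/mone]_(i | f i == x) G i = G (index (val x) [seq val (f i) | i <- enum 'I_n]).
Proof.
move=> fi Gout; have vfi : injective (fun i => val (f i)) by move=> i k /val_inj/fi.
have [/mapP[i _ xi]|xf] := boolP (val x \in [seq val (f i) | i <- enum 'I_n]).
  rewrite xi (index_map vfi) (bigD1 i) ?big1 /= ?mulm1.
  - by congr G; rewrite index_enum_ord.
  - by move=> k /andP[/eqP kx]; case/eqP; apply: vfi; rewrite kx.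
  by apply/eqP/val_inj.
rewrite big1 => [|i /eqP xi]; last by case/mapP: xf; exists i; rewrite ?mem_enum // xi.
by rewrite Gout // memNindex // size_map size_enum_ord.
Qed.

Lemma increasing_inj n j (f : 'I_n -> 'I_j) :
  (forall i k : 'I_n, (i < k)%N -> (f i < f k)%N) -> injective f.
Proof.
move=> f_inc i k E; apply: val_inj; case: (ltngtP i k) => // /f_inc.
  by rewrite E ltnn.
by rewrite E ltnn.
Qed.

Lemma qsh_inj_left m n j (q : qsh m n j) : injective (fun i => val q (lshift n i)).
Proof.
have /andP[/andP[/forallP H _] _] := valP q; apply: increasing_inj => i k ik.
by move/forallP: (H i) => /(_ k); rewrite ik.
Qed.

Lemma qsh_inj_right m n j (q : qsh m n j) : injective (fun i => val q (rshift m i)).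
Proof.
have /andP[/andP[_ /forallP H] _] := valP q; apply: increasing_inj => i k ik.
by move/forallP: (H i) => /(_ k); rewrite ik.
Qed.

(** Only the two diagonal blocks of [diag a b] have non-trivial entries, and
    the product over the fibres splits accordingly into one array for each. *)
Lemma ext_entry_qs a b j k (p : qsh (nrows a) (nrows b) j)
    (q : qsh (ncols a) (ncols b) k) :
  ext_entry (qs_comp p q) =
  mmul (spread (qsh_left p) (qsh_left q) a) (spread (qsh_right p) (qsh_right q) b).
Proof.
apply: arrayP => x y; rewrite mmul_arrayE.
have oj n n' (r : qsh n n' j) z : (j <= z)%N ->
    z \notin qsh_left r /\ z \notin qsh_right r.
  by move=> jz; split; apply/mapP => -[i _ zi]; move: jz; rewrite zi leqNgt ltn_ord.
have ok n n' (r : qsh n n' k) z : (k <= z)%N ->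
    z \notin qsh_left r /\ z \notin qsh_right r.
  by move=> jz; split; apply/mapP => -[i _ zi]; move: jz; rewrite zi leqNgt ltn_ord.
have [xj|xj] := ltnP x j; last first.
  rewrite ext_entry_row // !spread_row ?size_qsh_left ?size_qsh_right ?mulm1 //.
    by case: (oj _ _ p x xj).
  by case: (oj _ _ p x xj).
have [yk|yk] := ltnP y k; last first.
  rewrite ext_entry_col // !spread_col ?size_qsh_left ?size_qsh_right ?mulm1 //.
    by case: (ok _ _ q y yk).
  by case: (ok _ _ q y yk).
rewrite -[x]/(val (Ordinal xj)) -[y]/(val (Ordinal yk)) (ext_entryE (a := qs_comp p q)) mxE.
rewrite big_split_ord; congr mmul.
  transitivity (\big[mmul/mone]_(i | val p (lshift _ i) == Ordinal xj)
      ext_entry a i (index y (qsh_left q))); last first.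
    apply: (big_mmul_fiber (G := fun i => ext_entry a i _) _ (@qsh_inj_left _ _ _ p)).
    by move=> i ai; apply: ext_entry_row.
  apply: eq_bigr => i _; rewrite big_split_ord /= [X in mmul _ X]big1 ?mulm1; last first.
    by move=> v _ /=; rewrite block_mxEur mxE.
  rewrite -[y]/(val (Ordinal yk)) -(big_mmul_fiber _ (@qsh_inj_left _ _ _ q)); last first.
    by move=> v av; apply: ext_entry_col.
  by apply: eq_bigr => v _ /=; rewrite block_mxEul ext_entryE.
transitivity (\big[mmul/mone]_(i | val p (rshift _ i) == Ordinal xj)
    ext_entry b i (index y (qsh_right q))); last first.
  apply: (big_mmul_fiber (G := fun i => ext_entry b i _) _ (@qsh_inj_right _ _ _ p)).
  by move=> i ai; apply: ext_entry_row.
apply: eq_bigr => i _; rewrite big_split_ord /= [X in mmul X _]big1 ?mul1m; last first.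
  by move=> v _ /=; rewrite block_mxEdl mxE.
rewrite -[y]/(val (Ordinal yk)) -(big_mmul_fiber _ (@qsh_inj_right _ _ _ q)); last first.
  by move=> v av; apply: ext_entry_col.
by apply: eq_bigr => v _ /=; rewrite block_mxEdr ext_entryE.
Qed.

Lemma index_nth_map u p x : uniq u -> {in p, forall i, (i < size u)%N} ->
  index x (map (nth 0%N u) p) = index (index x u) p.
Proof.
move=> uu; elim: p => //= i p IH H; rewrite IH; last first.
  by move=> k kp; apply: H; rewrite inE kp orbT.
have iu : (i < size u)%N by apply: H; rewrite inE eqxx.
suff -> : (nth 0%N u i == x) = (i == index x u) by [].
apply/eqP/eqP => [<-|ix]; first by rewrite index_uniq.
by rewrite ix nth_index // -index_mem -ix.
Qed.

(** Spreading is functorial: spreading a quasi-shuffle term over [u] and [v]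
    spreads its two factors over subsequences of [u] and [v]. *)
Lemma spread_qs a b j k (p : qsh (nrows a) (nrows b) j)
    (q : qsh (ncols a) (ncols b) k) u v :
  uniq u -> uniq v -> size u = j -> size v = k ->
  spread u v (qs_comp p q) =
  mmul (spread (map (nth 0%N u) (qsh_left p)) (map (nth 0%N v) (qsh_left q)) a)
       (spread (map (nth 0%N u) (qsh_right p)) (map (nth 0%N v) (qsh_right q)) b).
Proof.
move=> uu uv uj vk; apply: arrayP => x y.
rewrite -[LHS]/((ext_entry (qs_comp p q) : array) _ _) ext_entry_qs !mmul_arrayE /spread.
by rewrite !index_nth_map // => i /mapP[z _ ->]; rewrite ?uj ?vk ltn_ord.
Qed.

End Arrays.

(** * Compositions as elements of the array algebra *)

Section ArrayAlgebra.
Variables (K : comNzRingType) (d : nat).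
Local Notation comp := (Defs.comp d).
Local Notation H := (H K d).
Local Notation array := (array d).
Local Notation W := {malg K[array]}.
Implicit Types (a b c : comp) (s t u v l : seq nat) (X Y : array) (x y z : H).

Lemma malgU_mul X Y : << X >> * << Y >> = << mmul X Y >> :> W.
Proof. by rewrite [LHS]fgmulUU mulr1. Qed.

(** The analogue of a monomial quasi-symmetric polynomial, with [l] and [l']
    listing the available rows and columns. *)
Definition spreads l l' a : W :=
  \sum_(s <- subs l | size s == nrows a) \sum_(t <- subs l' | size t == ncols a)
    << spread s t a >>.

Definition realize l l' : H -> W := lin_ext (spreads l l').

HB.instance Definition _ l l' := GRing.isLinear.Build K H W *:%R (realize l l')
  (lin_ext_is_linear _).

Lemma realizeU l l' a : realize l l' << a >> = spreads l l' a.
Proof. exact: lin_extU. Qed.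

Lemma spreads_e l l' : spreads l l' ecomp = 1.
Proof.
have E (V : nmodType) (F : seq nat -> V) (r : seq nat) :
    \sum_(s <- subs r | size s == 0%N) F s = F [::].
  elim: r => [|i r IH] /=; first by rewrite big_mkcond big_seq1.
  by rewrite big_cat IH big_map /= [X in _ + X]big1 ?addr0.
rewrite /spreads !E; congr << _ >>; apply: arrayP => x y.
by rewrite /spread ext_entry_row.
Qed.

(** A product of two spread compositions is determined by the rows and columns
    used by each factor; image factorization, applied to rows and to columns,
    exhibits it as a spread term of the quasi-shuffle. *)
Lemma realize_qshuffle l l' a b : uniq l -> uniq l' ->
  realize l l' (qshuffle K a b) = spreads l l' a * spreads l l' b.
Proof.
move=> ul ul'; rewrite /qshuffle.
have [->|/eqP ae] := eqVneq a ecomp; first by rewrite realizeU spreads_e mul1r.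
have [->|/eqP be] := eqVneq b ecomp; first by rewrite realizeU spreads_e mulr1.
have ra : (0 < nrows a)%N by rewrite lt0n; apply/eqP => /nrows_eq0.
have ca : (0 < ncols a)%N.
  by have [y yc _] := row_ex ra; apply: leq_ltn_trans (leq0n y) yc.
pose G s1 s2 t1 t2 : W := << mmul (spread s1 t1 a) (spread s2 t2 b) >>.
transitivity (\sum_(s1 <- subs l | size s1 == nrows a)
  \sum_(s2 <- subs l | size s2 == nrows b)
  \sum_(t1 <- subs l' | size t1 == ncols a)
  \sum_(t2 <- subs l' | size t2 == ncols b) G s1 s2 t1 t2); last first.
  rewrite /spreads big_distrl /=; apply: eq_bigr => s1 _.
  rewrite big_distrr /=; apply: eq_bigr => s2 _.
  rewrite big_distrl /=; apply: eq_bigr => t1 _.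
  by rewrite big_distrr /=; apply: eq_bigr => t2 _; rewrite malgU_mul.
rewrite -(@sum_qsh_subs _ _ _ _ (fun s1 s2 => \sum_(t1 <- subs l' | size t1 == ncols a)
  \sum_(t2 <- subs l' | size t2 == ncols b) G s1 s2 t1 t2)) //.
rewrite linear_sum; apply: eq_bigr => j _.
transitivity (\sum_(p : qsh (nrows a) (nrows b) j)
  \sum_(1 <= k < (ncols a + ncols b).+1) \sum_(q : qsh (ncols a) (ncols b) k)
    \sum_(u <- subs l | size u == j) \sum_(v <- subs l' | size v == k)
      (<< spread u v (qs_comp p q) >> : W)).
  rewrite linear_sum /=; under eq_bigr do rewrite linear_sum /=.
  rewrite exchange_big /=; apply: eq_bigr => p _; apply: eq_bigr => k _.
  by rewrite linear_sum; apply: eq_bigr => q _; rewrite /= realizeU.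
apply: eq_bigr => p _; under eq_bigr do rewrite exchange_big /=.
rewrite exchange_big /= big_seq_cond [RHS]big_seq_cond; apply: eq_bigr => u.
rewrite mem_subs => /andP[ul0 /eqP uj]; have uu := subseq_uniq ul0 ul.
rewrite -(@sum_qsh_subs _ _ _ _ (fun t1 t2 => G (map (nth 0%N u) (qsh_left p))
  (map (nth 0%N u) (qsh_right p)) t1 t2)) //.
apply: eq_bigr => k _; apply: eq_bigr => q _.
rewrite big_seq_cond [RHS]big_seq_cond; apply: eq_bigr => v.
rewrite mem_subs => /andP[vl0 /eqP vk]; have uv := subseq_uniq vl0 ul'.
by rewrite (spread_qs p q uu uv uj vk).
Qed.

Lemma sum_seq_delta_cond (I : eqType) (V : nmodType) (r : seq I) (P : pred I)
    (j : I) (F : I -> V) : uniq r -> j \in r ->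
  (forall i, i \in r -> P i -> i != j -> F i = 0) ->
  \sum_(i <- r | P i) F i = if P j then F j else 0.
Proof.
move=> ur jr H; rewrite big_mkcond (sum_seq_delta (j := j)) ?jr // => i ir ij.
by case: ifP => // Pi; apply: H.
Qed.

Lemma mem_subs_self l : l \in subs l. Proof. by rewrite mem_subs. Qed.

(** With exactly as many rows and columns as [c], the array of [c] arises only
    from [c] itself, spread in the only possible way. *)
Lemma mcoeff_realize c x :
  (realize (iota 0 (nrows c)) (iota 0 (ncols c)) x)@_(ext_entry c : array) = x@_c.
Proof.
apply: (linear_malg_ext (V := K^o)
  (f := fun x => (realize (iota 0 (nrows c)) (iota 0 (ncols c)) x)@_(ext_entry c : array))
  (g := fun x => x@_c)).
- by move=> k y z; rewrite linearP mcoeffD mcoeffZ.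
- exact: mcoeff_linear.
move=> a; rewrite realizeU /spreads mcoeff_sum mcoeffU.
rewrite (sum_seq_delta_cond (j := iota 0 (nrows c))) ?subs_uniq ?iota_uniq ?mem_subs_self //.
  rewrite size_iota; case: eqP => [ca|]; last by case: eqP => // ->.
  rewrite mcoeff_sum (sum_seq_delta_cond (j := iota 0 (ncols c)))
    ?subs_uniq ?iota_uniq ?mem_subs_self //.
    rewrite size_iota; case: eqP => [cc|]; last by case: eqP => // ->.
    have [->|ac] := eqVneq a c; first by rewrite spread_iota mcoeffUU.
    rewrite mcoeffU; case: eqP => // /spread_eq_ext[] //; rewrite ?size_iota // => _ _ E.
    by rewrite E eqxx in ac.
  move=> t; rewrite mem_subs mcoeffU => tc /eqP ta tn; case: eqP => // /spread_eq_ext[] //.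
    by rewrite size_iota.
  by move=> _ E; rewrite E eqxx in tn.
move=> s; rewrite mem_subs => sc /eqP sa sn; rewrite mcoeff_sum big_seq_cond big1 //.
move=> t /andP[]; rewrite mem_subs mcoeffU => tc /eqP ta.
case: eqP => // /spread_eq_ext[] // E.
by rewrite E eqxx in sn.
Qed.

Lemma realize_inj x y :
  (forall l l', uniq l -> uniq l' -> realize l l' x = realize l l' y) -> x = y.
Proof.
by move=> E; apply/malgP => c; rewrite -!mcoeff_realize E // iota_uniq.
Qed.

Lemma realize_mul l l' x y : uniq l -> uniq l' ->
  realize l l' (mul (@qshuffle K d) x y) = realize l l' x * realize l l' y.
Proof.
move=> ul ul'; apply: (bilinear_malg_ext
  (f := fun x y => realize l l' (mul (@qshuffle K d) x y))
  (g := fun x y => realize l l' x * realize l l' y)).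
- by move=> t k z z'; rewrite mul_linl linearP.
- by move=> t k z z'; rewrite !linearP.
- by move=> t k z z'; rewrite linearP mulrDl scalerAl.
- by move=> t k z z'; rewrite linearP mulrDr scalerAr.
by move=> a b; rewrite mulUU realize_qshuffle // !realizeU.
Qed.

Lemma qshuffle_comm_assoc : comm_assoc_product (@qshuffle K d).
Proof.
split=> [a b|a b c]; apply: realize_inj => l l' ul ul'.
  by rewrite !realize_qshuffle // mulrC.
by rewrite !realize_mul // !realize_qshuffle // !realizeU mulrA.
Qed.

Section BlockDiagonal.
Variables l1 l2 l1' l2' : seq nat.
Hypothesis ul : uniq (l1 ++ l2).
Hypothesis ul' : uniq (l1' ++ l2').

(** Triviality off the two blocks with rows and columns [l1], [l1'] and [l2],
    [l2']. *)
Definition block_diagonal X : bool := `[< forall x y : nat,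
  (x \in l1 -> y \in l2' -> X x y = mone) /\ (x \in l2 -> y \in l1' -> X x y = mone) >].

(** A product in [Md] is neutral only if both factors are. *)
Lemma block_diagonalM X Y :
  block_diagonal (mmul X Y) = block_diagonal X && block_diagonal Y.
Proof.
apply/asboolP/andP => [H|[/asboolP HX /asboolP HY] x y].
  split; apply/asboolP => x y; have [H1 H2] := H x y.
    by split=> xl yl; [have /unitm[] := H1 xl yl|have /unitm[] := H2 xl yl].
  by split=> xl yl; [have /unitm[] := H1 xl yl|have /unitm[] := H2 xl yl].
have [H1 H2] := HX x y; have [H3 H4] := HY x y.
by split=> xl yl; rewrite mmul_arrayE; [rewrite H1 // H3 // mulm1|rewrite H2 // H4 // mulm1].
Qed.

Definition diag_part : W -> W :=
  lin_ext (fun X => if block_diagonal X then << X >> else 0).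

HB.instance Definition _ := GRing.isLinear.Build K W W *:%R diag_part
  (lin_ext_is_linear _).

Lemma diag_partM (z1 z2 : W) : diag_part (z1 * z2) = diag_part z1 * diag_part z2.
Proof.
apply: (bilinear_malg_ext (f := fun z1 z2 : W => diag_part (z1 * z2))
  (g := fun z1 z2 : W => diag_part z1 * diag_part z2)).
- by move=> t k z z'; rewrite mulrDl -scalerAl linearP.
- by move=> t k z z'; rewrite mulrDr -scalerAr linearP.
- by move=> t k z z'; rewrite linearP mulrDl scalerAl.
- by move=> t k z z'; rewrite linearP mulrDr scalerAr.
move=> X Y; rewrite malgU_mul /diag_part !lin_extU block_diagonalM.
by case: block_diagonal; case: block_diagonal; rewrite /= ?mulr0 ?mul0r // malgU_mul.
Qed.

Lemma mcoeff_diag_part (z : W) X : block_diagonal X -> (diag_part z)@_X = z@_X.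
Proof.
move=> bX; apply: (linear_malg_ext (V := K^o) (f := fun z : W => (diag_part z)@_X)
  (g := fun z : W => z@_X)).
- by move=> k z1 z2; rewrite linearP mcoeffD mcoeffZ.
- exact: mcoeff_linear.
move=> Y; rewrite /diag_part lin_extU; case: ifP => // nY.
by rewrite mcoeff0 mcoeffU; case: eqP => // E; rewrite E bX in nY.
Qed.

Lemma diag_size_inj a b a' b' : diag a b = diag a' b' ->
  nrows a = nrows a' -> ncols a = ncols a' -> a = a' /\ b = b'.
Proof.
move=> E ra ca.
have rb : nrows b = nrows b' by move/(congr1 (@nrows d)): E => /=; rewrite ra => /addnI.
have cb : ncols b = ncols b' by move/(congr1 (@ncols d)): E => /=; rewrite ca => /addnI.
have Ee (x y : nat) : ext_entry (diag a b) x y = ext_entry (diag a' b') x y by rewrite E.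
split; apply: comp_ext => // x y.
  have [h|h] := boolP ((x < nrows a) && (y < ncols a))%N.
    by have := Ee x y; rewrite !ext_entry_diag -ra -ca h.
  by rewrite !ext_entry_out // -?ra -?ca.
have := Ee (nrows a + x)%N (ncols a + y)%N.
by rewrite !ext_entry_diag -ra -ca !ltnNge !leq_addr /= !addKn.
Qed.

Lemma cat_disjoint (T : eqType) (p q : seq T) (z : T) : uniq (p ++ q) -> z \in q -> z \notin p.
Proof. by rewrite cat_uniq => /and3P[_ /hasPn H _] /H. Qed.

(** A composition spread block diagonally is of the form [diag p.1 p.2] with the
    cut at the sizes of [s1] and [t1]; there is at most one such cut. *)
Lemma diag_part_spread s1 s2 t1 t2 a :
  subseq s1 l1 -> subseq s2 l2 -> subseq t1 l1' -> subseq t2 l2' ->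
  (if (size (s1 ++ s2) == nrows a) && (size (t1 ++ t2) == ncols a)
   then diag_part << spread (s1 ++ s2) (t1 ++ t2) a >> else 0) =
  \sum_(p <- splits a | [&& size s1 == nrows p.1, size t1 == ncols p.1,
      size s2 == nrows p.2 & size t2 == ncols p.2])
    << mmul (spread s1 t1 p.1) (spread s2 t2 p.2) >> :> W.
Proof.
move=> hs1 hs2 ht1 ht2.
have us : uniq (s1 ++ s2) by apply: subseq_uniq ul; apply: cat_subseq.
have ut : uniq (t1 ++ t2) by apply: subseq_uniq ul'; apply: cat_subseq.
set P := (fun p : comp * comp => [&& size s1 == nrows p.1, size t1 == ncols p.1,
      size s2 == nrows p.2 & size t2 == ncols p.2]).
have [/hasP[p pa Pp]|nP] := boolP (has P (splits a)).
  rewrite (sum_seq_delta_cond (j := p)) ?splits_uniq //; last first.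
    move=> q qa /and4P[/eqP q1 /eqP q2 _ _] /eqP[]; move: Pp => /and4P[/eqP p1 /eqP p2 _ _].
    move: pa qa; rewrite !mem_splits => /eqP pa /eqP; rewrite -pa => /diag_size_inj[].
    - by rewrite -q1 -p1.
    - by rewrite -q2 -p2.
    by case: (p) (q) => [? ?] [? ?] /= -> ->.
  rewrite [RHS]ifT //; move: Pp pa => /and4P[/eqP p1 /eqP p2 /eqP p3 /eqP p4].
  rewrite mem_splits => /eqP <-; rewrite !size_cat p1 p2 p3 p4 /= !eqxx /=.
  rewrite spread_diag // /diag_part lin_extU ifT //; apply/asboolP => x y.
  split=> xl yl; rewrite mmul_arrayE.
    rewrite spread_col //; last first.
      by apply/negP => /(mem_subseq ht1) /=; apply/negP; apply: cat_disjoint yl.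
    rewrite spread_row ?mulm1 //; apply/negP => /(mem_subseq hs2) xl2.
    by move: (cat_disjoint ul xl2); rewrite xl.
  rewrite spread_row //; last first.
    by apply/negP => /(mem_subseq hs1) /=; apply/negP; apply: cat_disjoint xl.
  rewrite spread_col ?mulm1 //; apply/negP => /(mem_subseq ht2) yl2.
  by move: (cat_disjoint ul' yl2); rewrite yl.
rewrite [RHS]big_seq_cond [RHS]big_pred0; last first.
  by move=> p; apply/negbTE; apply: contra nP => /andP[pa Pp]; apply/hasP; exists p.
case: ifP => // /andP[/eqP sa /eqP ta]; rewrite /diag_part lin_extU.
case: ifP => // /asboolP bd; case/negP: nP.
have sm : (size s1 <= nrows a)%N by rewrite -sa size_cat leq_addr.
have tm : (size t1 <= ncols a)%N by rewrite -ta size_cat leq_addr.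
have ent (x y : nat) : (x < nrows a)%N -> (y < ncols a)%N ->
    ext_entry a x y = spread (s1 ++ s2) (t1 ++ t2) a
      (nth 0%N (s1 ++ s2) x) (nth 0%N (t1 ++ t2) y).
  by move=> xa ya; rewrite /spread !index_uniq ?sa ?ta.
have [||a1 [a2 [E r1 c1]]] := diag_split sm tm.
- move=> x y xs ty; have [ya|] := ltnP y (ncols a); last exact: ext_entry_col.
  rewrite ent ?(leq_trans xs) // !nth_cat xs ltnNge ty /=; apply: (bd _ _).1.
    by apply: (mem_subseq hs1); rewrite mem_nth.
  apply: (mem_subseq ht2); rewrite mem_nth // ltn_subLR //.
  by rewrite -size_cat ta.
- move=> x y sx yt; have [xa|] := ltnP x (nrows a); last exact: ext_entry_row.
  rewrite ent ?(leq_trans yt) // !nth_cat yt ltnNge sx /=; apply: (bd _ _).2.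
    apply: (mem_subseq hs2); rewrite mem_nth // ltn_subLR //.
    by rewrite -size_cat sa.
  by apply: (mem_subseq ht1); rewrite mem_nth.
apply/hasP; exists (a1, a2); first by rewrite mem_splits /= E.
move: sa ta; rewrite /P /= E /= r1 c1 !eqxx /= !size_cat.
by move=> /addnI -> /addnI ->; rewrite !eqxx.
Qed.

(** Keeping block diagonal arrays realizes the coproduct. *)
Lemma diag_part_spreads a : diag_part (spreads (l1 ++ l2) (l1' ++ l2') a) =
  \sum_(p <- splits a) spreads l1 l1' p.1 * spreads l2 l2' p.2.
Proof.
transitivity (\sum_(s1 <- subs l1) \sum_(s2 <- subs l2)
   \sum_(t1 <- subs l1') \sum_(t2 <- subs l2')
   (if (size (s1 ++ s2) == nrows a) && (size (t1 ++ t2) == ncols a)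
   then diag_part << spread (s1 ++ s2) (t1 ++ t2) a >> else 0)).
  rewrite /spreads linear_sum big_mkcond sum_subs_cat /=.
  apply: eq_bigr => s1 _; apply: eq_bigr => s2 _; case: eqP => _ /=; last first.
    by rewrite big1 // => t1 _; rewrite big1.
  by rewrite linear_sum big_mkcond sum_subs_cat.
pose C s1 s2 t1 t2 (p : comp * comp) := [&& size s1 == nrows p.1, size t1 == ncols p.1,
      size s2 == nrows p.2 & size t2 == ncols p.2].
pose F s1 s2 t1 t2 (p : comp * comp) : W :=
  if C s1 s2 t1 t2 p then << mmul (spread s1 t1 p.1) (spread s2 t2 p.2) >> else 0.
transitivity (\sum_(s1 <- subs l1) \sum_(s2 <- subs l2)
   \sum_(t1 <- subs l1') \sum_(t2 <- subs l2') \sum_(p <- splits a) F s1 s2 t1 t2 p).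
  rewrite big_seq [RHS]big_seq; apply: eq_bigr => s1; rewrite mem_subs => h1.
  rewrite big_seq [RHS]big_seq; apply: eq_bigr => s2; rewrite mem_subs => h2.
  rewrite big_seq [RHS]big_seq; apply: eq_bigr => t1; rewrite mem_subs => h3.
  rewrite big_seq [RHS]big_seq; apply: eq_bigr => t2; rewrite mem_subs => h4.
  by rewrite diag_part_spread // big_mkcond.
transitivity (\sum_(p <- splits a) \sum_(s1 <- subs l1) \sum_(s2 <- subs l2)
   \sum_(t1 <- subs l1') \sum_(t2 <- subs l2') F s1 s2 t1 t2 p).
  rewrite [RHS]exchange_big; apply: eq_bigr => s1 _.
  rewrite [RHS]exchange_big; apply: eq_bigr => s2 _.
  rewrite [RHS]exchange_big; apply: eq_bigr => t1 _.
  by rewrite [RHS]exchange_big.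
apply: eq_bigr => p _; rewrite /spreads big_distrl /= [RHS]big_mkcond.
apply: eq_bigr => s1 _; rewrite /F /C.
case: (size s1 == _) => /=; last by rewrite !big1 // => ? _; rewrite !big1 // => ? _; rewrite big1.
rewrite big_distrr /= [RHS]big_mkcond; apply: eq_bigr => s2 _.
case: (size s2 == _) => /=; last first.
  by rewrite !big1 // => ? _; rewrite !big1 // => ? _; rewrite andbF.
rewrite big_distrl /= [RHS]big_mkcond; apply: eq_bigr => t1 _.
case: (size t1 == _) => /=; last by rewrite big1.
rewrite big_distrr /= [RHS]big_mkcond; apply: eq_bigr => t2 _.
by case: (size t2 == _) => //=; rewrite malgU_mul.
Qed.

End BlockDiagonal.
End ArrayAlgebra.

(** * The quasi-shuffle bialgebra *)

Section QuasiShuffleBialgebra.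
Variables (K : comNzRingType) (d : nat).
Local Notation comp := (Defs.comp d).
Local Notation H := (H K d).
Local Notation array := (array d).
Local Notation W := {malg K[array]}.
Local Notation qsh := (@qshuffle K d).
Implicit Types (a b c : comp) (s t u v l : seq nat) (X Y : array) (x y z : H).

Section PairCoefficient.
Variables c1 c2 : comp.
Local Notation l1 := (iota 0 (nrows c1)).
Local Notation l2 := (iota (nrows c1) (nrows c2)).
Local Notation l1' := (iota 0 (ncols c1)).
Local Notation l2' := (iota (ncols c1) (ncols c2)).

Lemma cat_iota n k : iota 0 n ++ iota n k = iota 0 (n + k).
Proof. by rewrite iotaD. Qed.

Lemma subseq_cat_full (T : eqType) (p1 p2 q1 q2 : seq T) :
  subseq p1 q1 -> subseq p2 q2 -> p1 ++ p2 = q1 ++ q2 -> p1 = q1 /\ p2 = q2.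
Proof.
move=> h1 h2 E; have s2 := size_subseq h2.
have e1 : p1 = q1.
  apply/eqP; rewrite -(size_subseq_leqif h1) eqn_leq (size_subseq h1) /=.
  have := congr1 size E; rewrite !size_cat => Es.
  by rewrite -(leq_add2r (size q2)) -Es leq_add2l.
by split=> //; move: E; rewrite e1 => /eqP; rewrite eqseq_cat // eqxx => /eqP.
Qed.

(** The two spread factors form one spread block diagonal composition
    ([spread_diag]), to which [spread_eq_ext] applies. *)
Lemma spread_mul_eq_ext s1 s2 t1 t2 a b :
  subseq s1 l1 -> subseq s2 l2 -> subseq t1 l1' -> subseq t2 l2' ->
  size s1 = nrows a -> size t1 = ncols a -> size s2 = nrows b -> size t2 = ncols b ->
  mmul (spread s1 t1 a) (spread s2 t2 b) = ext_entry (diag c1 c2) ->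
  [/\ s1 = l1, s2 = l2, t1 = l1', t2 = l2' & (a = c1 /\ b = c2)].
Proof.
move=> hs1 hs2 ht1 ht2 s1a t1a s2b t2b.
have hs : subseq (s1 ++ s2) (iota 0 (nrows (diag c1 c2))).
  by rewrite /= -cat_iota cat_subseq.
have ht : subseq (t1 ++ t2) (iota 0 (ncols (diag c1 c2))).
  by rewrite /= -cat_iota cat_subseq.
rewrite -spread_diag //; first last.
- by apply: subseq_uniq ht _; apply: iota_uniq.
- by apply: subseq_uniq hs _; apply: iota_uniq.
move=> /(spread_eq_ext hs ht)[].
- by rewrite size_cat s1a s2b.
- by rewrite size_cat t1a t2b.
rewrite /= -!cat_iota => /(subseq_cat_full hs1 hs2)[e1 e2].
move=> /(subseq_cat_full ht1 ht2)[e3 e4] /diag_size_inj[].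
- by rewrite -s1a e1 size_iota.
- by rewrite -t1a e3 size_iota.
by move=> ? ?; split.
Qed.

(** The tensor square of [realize] is injective as well: coefficients at
    [(c1, c2)] can be read off on complementary diagonal blocks. *)
Lemma mcoeff_realize2 x y :
  (realize l1 l1' x * realize l2 l2' y)@_(ext_entry (diag c1 c2) : array)
  = x@_c1 * y@_c2.
Proof.
apply: (bilinear_malg_ext (V := K^o)
  (f := fun x y => (realize l1 l1' x * realize l2 l2' y)@_(ext_entry (diag c1 c2) : array))
  (g := fun x y => x@_c1 * y@_c2)).
- by move=> t k z z'; rewrite linearP mulrDl -scalerAl mcoeffD mcoeffZ.
- by move=> t k z z'; rewrite linearP mulrDr -scalerAr mcoeffD mcoeffZ.
- by move=> t k z z'; rewrite mcoeffD mcoeffZ mulrDl -mulrA.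
- by move=> t k z z'; rewrite mcoeffD mcoeffZ mulrDr mulrCA.
move=> a b; rewrite !realizeU.
have -> : spreads K l1 l1' a * spreads K l2 l2' b =
  \sum_(s1 <- subs l1 | size s1 == nrows a) \sum_(s2 <- subs l2 | size s2 == nrows b)
  \sum_(t1 <- subs l1' | size t1 == ncols a) \sum_(t2 <- subs l2' | size t2 == ncols b)
    (<< mmul (spread s1 t1 a) (spread s2 t2 b) >> : W).
  rewrite /spreads big_distrl /=; apply: eq_bigr => s1 _.
  rewrite big_distrr /=; apply: eq_bigr => s2 _.
  rewrite big_distrl /=; apply: eq_bigr => t1 _.
  by rewrite big_distrr /=; apply: eq_bigr => t2 _; rewrite malgU_mul.
have core s1 s2 t1 t2 : s1 \in subs l1 -> size s1 == nrows a ->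
    s2 \in subs l2 -> size s2 == nrows b ->
    t1 \in subs l1' -> size t1 == ncols a ->
    t2 \in subs l2' -> size t2 == ncols b ->
    ~ [/\ s1 = l1, s2 = l2, t1 = l1', t2 = l2' & (a = c1 /\ b = c2)] ->
    (<< mmul (spread s1 t1 a) (spread s2 t2 b) >> : W)@_(ext_entry (diag c1 c2) : array) = 0.
  rewrite !mem_subs => h1 /eqP h2 h3 /eqP h4 h5 /eqP h6 h7 /eqP h8 ne.
  by rewrite mcoeffU; case: eqP => // /(spread_mul_eq_ext h1 h3 h5 h7 h2 h6 h4 h8) /ne.
rewrite mcoeff_sum !mcoeffU.
have [[ac bc]|ne] := pselect (a = c1 /\ b = c2); last first.
  rewrite -natrM mulnb.
  have -> : (a == c1) && (b == c2) = false.
    by apply/negbTE; apply/negP => /andP[/eqP ? /eqP ?]; apply: ne.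
  rewrite big_seq_cond big1 // => s1 /andP[h1 h2].
  rewrite mcoeff_sum big_seq_cond big1 // => s2 /andP[h3 h4].
  rewrite mcoeff_sum big_seq_cond big1 // => t1 /andP[h5 h6].
  rewrite mcoeff_sum big_seq_cond big1 // => t2 /andP[h7 h8].
  by apply: core => // -[_ _ _ _ /ne].
subst a b; rewrite !eqxx mulr1.
have lu n k : uniq (subs (iota n k)) by rewrite subs_uniq ?iota_uniq.
have z0 (s1 s2 t1 t2 : seq nat) : s1 \in subs l1 -> size s1 == nrows c1 ->
    s2 \in subs l2 -> size s2 == nrows c2 ->
    t1 \in subs l1' -> size t1 == ncols c1 ->
    t2 \in subs l2' -> size t2 == ncols c2 ->
    [|| s1 != l1, s2 != l2, t1 != l1' | t2 != l2'] ->
    (<< mmul (spread s1 t1 c1) (spread s2 t2 c2) >> : W)@_(ext_entry (diag c1 c2) : array) = 0.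
  move=> h1 h2 h3 h4 h5 h6 h7 h8 ne; apply: core => // -[e1 e2 e3 e4 _].
  by move: ne; rewrite e1 e2 e3 e4 !eqxx.
rewrite (sum_seq_delta_cond (j := l1)) ?lu ?mem_subs_self ?size_iota ?eqxx //; last first.
  move=> s1 h1 h2 ne.
  rewrite mcoeff_sum big_seq_cond big1 // => s2 /andP[h3 h4].
  rewrite mcoeff_sum big_seq_cond big1 // => t1 /andP[h5 h6].
  rewrite mcoeff_sum big_seq_cond big1 // => t2 /andP[h7 h8].
  by apply: z0 => //; rewrite ne.
have L1 : size l1 == nrows c1 by rewrite size_iota.
rewrite mcoeff_sum (sum_seq_delta_cond (j := l2))
  ?lu ?mem_subs_self ?size_iota ?eqxx //; last first.
  move=> s2 h3 h4 ne.
  rewrite mcoeff_sum big_seq_cond big1 // => t1 /andP[h5 h6].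
  rewrite mcoeff_sum big_seq_cond big1 // => t2 /andP[h7 h8].
  by apply: z0 => //; rewrite ?mem_subs_self // ne orbT.
have L2 : size l2 == nrows c2 by rewrite size_iota.
rewrite mcoeff_sum (sum_seq_delta_cond (j := l1'))
  ?lu ?mem_subs_self ?size_iota ?eqxx //; last first.
  move=> t1 h5 h6 ne.
  rewrite mcoeff_sum big_seq_cond big1 // => t2 /andP[h7 h8].
  by apply: z0 => //; rewrite ?mem_subs_self // ne !orbT.
have L3 : size l1' == ncols c1 by rewrite size_iota.
rewrite mcoeff_sum (sum_seq_delta_cond (j := l2'))
  ?lu ?mem_subs_self ?size_iota ?eqxx //; last first.
  by move=> t2 h7 h8 ne; apply: z0 => //; rewrite ?mem_subs_self // ne !orbT.
have L4 : size l2' == ncols c2 by rewrite size_iota.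
rewrite -spread_diag ?(eqP L1) ?(eqP L2) ?(eqP L3) ?(eqP L4) ?cat_iota ?iota_uniq //.
rewrite -[(nrows c1 + _)%N]/(nrows (diag c1 c2)).
by rewrite -[(ncols c1 + _)%N]/(ncols (diag c1 c2)) spread_iota mcoeffUU.
Qed.

Lemma block_diagonal_diag : block_diagonal l1 l2 l1' l2' (ext_entry (diag c1 c2)).
Proof.
apply/asboolP => x y; rewrite !mem_iota !add0n /= ext_entry_diag; split.
  move=> xc /andP[yc _]; rewrite xc [(y < _)%N]ltnNge yc /=.
  by rewrite leqNgt xc.
move=> /andP[xc _] yc; rewrite yc ltnNge xc /=.
by rewrite leqNgt yc.
Qed.

End PairCoefficient.

Lemma qshuffle_counit a b : (qsh a b)@_ecomp = ((a == ecomp) && (b == ecomp))%:R.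
Proof.
have E c : spreads K [::] [::] c = (c == ecomp)%:R.
  have [->|/eqP ce] := eqVneq c ecomp; first exact: spreads_e.
  rewrite /spreads /= big_mkcond big_seq1 ifF //; apply/negbTE.
  by apply/negP => /eqP/esym/nrows_eq0.
rewrite -mcoeff_realize /= realize_qshuffle // !E -natrM mulnb.
have e1 : ext_entry ecomp = mone :> array.
  by apply: arrayP => x y; rewrite ext_entry_row.
case: andb; last by rewrite mcoeff0.
by rewrite e1 mcoeffC eqxx.
Qed.

(** Read the coefficient in the array algebra, where it is not affected by
    [diag_part]; that map is multiplicative and realizes the coproduct. *)
Lemma qshuffle_diag a b c1 c2 : (qsh a b)@_(diag c1 c2) =
  \sum_(p <- splits a) \sum_(q <- splits b)
    (qsh p.1 q.1)@_c1 * (qsh p.2 q.2)@_c2.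
Proof.
have ul n k : uniq (iota 0 n ++ iota n k) by rewrite cat_iota iota_uniq.
rewrite -mcoeff_realize /= -!cat_iota.
rewrite -(mcoeff_diag_part _ (block_diagonal_diag c1 c2)).
rewrite realize_qshuffle // diag_partM !diag_part_spreads // big_distrlr mcoeff_sum.
apply: eq_bigr => p _; rewrite mcoeff_sum; apply: eq_bigr => q _ /=.
rewrite mulrACA -!realize_qshuffle ?iota_uniq //.
exact: mcoeff_realize2.
Qed.

Lemma qshuffle_bialgebra : bialgebra_product qsh.
Proof.
split=> [a|a|].
- by rewrite /qshuffle eqxx.
- by rewrite /qshuffle; case: eqVneq => [->|_] //; rewrite eqxx.
split=> [[a b]|u c _ [a b]].
  by rewrite /coefs2 qshuffle_counit /delta_e xpair_eqE.
by rewrite /coefs2 qshuffle_diag /convol /= /splits2 big_allpairs_dep.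
Qed.

End QuasiShuffleBialgebra.

(** * The shuffle as the leading part of the quasi-shuffle *)

Section ShuffleBialgebra.
Variables (K : comNzRingType) (d : nat).
Local Notation comp := (Defs.comp d).
Local Notation H := (H K d).
Local Notation qshu := (@qshuffle K d).
Local Notation shu := (@shuffle K d).
Implicit Types (a b c e : comp) (x y z : H).

Section QshPerm.
Variables m s : nat.

(** A surjection between finite sets of the same size is a bijection. *)
Lemma qsh_inj (q : qsh m s (m + s)) : injective (val q).
Proof.
have /andP[_ /forallP sur] := valP q.
apply/injectiveP; rewrite /injectiveb /dinjectiveb.
apply: (leq_size_uniq (enum_uniq 'I_(m + s))) => [u _|].
  have /existsP[v /eqP <-] := sur u; exact: codom_f.
by rewrite size_map.
Qed.

Definition perm_of_qsh (q : qsh m s (m + s)) : 'S_(m + s) := perm (@qsh_inj q).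

Lemma sum_perm_qsh (V : nmodType) (F : 'S_(m + s) -> V) :
  \sum_(p : 'S_(m + s) | block_increasing p) F p =
  \sum_(q : qsh m s (m + s)) F (perm_of_qsh q).
Proof.
transitivity (\sum_(p <- [seq perm_of_qsh q | q <- enum {: qsh m s (m + s)}]) F p); last first.
  by rewrite big_map big_enum.
rewrite -big_enum; apply: perm_big; apply: uniq_perm.
- exact: enum_uniq.
- rewrite map_inj_uniq ?enum_uniq // => q q' /permP E; apply: val_inj.
  by apply/ffunP => u; have := E u; rewrite !permE.
move=> p; rewrite mem_enum; apply/idP/mapP => [pb|[q _ ->]].
  have qp : is_qsh [ffun u => p u].
    apply/andP; split.
      move: pb => /andP[/forallP h1 /forallP h2]; apply/andP; split.
        by apply/forallP => i; apply/forallP => k; rewrite !ffunE; apply: (forallP (h1 i)).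
      by apply/forallP => i; apply/forallP => k; rewrite !ffunE; apply: (forallP (h2 i)).
    by apply/forallP => u; apply/existsP; exists ((p^-1)%g u); rewrite ffunE permKV.
  pose q : qsh m s (m + s) := exist (fun f => is_qsh f) _ qp.
  exists q; first by rewrite mem_enum.
  by apply/permP => u; rewrite permE /= ffunE.
have /andP[/andP[/forallP h1 /forallP h2] _] := valP q; apply/andP; split.
  by apply/forallP => i; apply/forallP => k; rewrite !permE; apply: (forallP (h1 i)).
by apply/forallP => i; apply/forallP => k; rewrite !permE; apply: (forallP (h2 i)).
Qed.

End QshPerm.

Lemma qs_comp_perm a b (p : qsh (nrows a) (nrows b) (nrows a + nrows b))
    (q : qsh (ncols a) (ncols b) (ncols a + ncols b)) :
  qs_comp p q = sh_comp (perm_of_qsh p) (perm_of_qsh q).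
Proof.
apply: comp_ext => // x y.
have [/andP[hx hy]|h] := boolP ((x < nrows a + nrows b) && (y < ncols a + ncols b))%N; last first.
  by rewrite !ext_entry_out.
rewrite -[x]/(val (Ordinal hx)) -[y]/(val (Ordinal hy)).
rewrite (ext_entryE (a := qs_comp p q)) (ext_entryE (a := sh_comp _ _)) [LHS]mxE [RHS]mxE.
rewrite (big_pred1 ((perm_of_qsh p)^-1%g (Ordinal hx))); last first.
  move=> u; rewrite /= -(inj_eq (@perm_inj _ (perm_of_qsh p))) permKV.
  by rewrite permE.
rewrite (big_pred1 ((perm_of_qsh q)^-1%g (Ordinal hy))) //.
move=> u; rewrite /= -(inj_eq (@perm_inj _ (perm_of_qsh q))) permKV.
by rewrite permE.
Qed.

Lemma qshuffle_coef a b c : a != ecomp -> b != ecomp -> (qshu a b)@_c =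
  \sum_(1 <= j < (nrows a + nrows b).+1) \sum_(1 <= k < (ncols a + ncols b).+1)
  \sum_(p : qsh (nrows a) (nrows b) j) \sum_(q : qsh (ncols a) (ncols b) k)
    (qs_comp p q == c)%:R.
Proof.
move=> /negPf ae /negPf be; rewrite /qshuffle ae be mcoeff_sum.
apply: eq_bigr => j _; rewrite mcoeff_sum; apply: eq_bigr => k _.
rewrite mcoeff_sum; apply: eq_bigr => p _; rewrite mcoeff_sum; apply: eq_bigr => q _.
by rewrite mcoeffU.
Qed.

(** A quasi-shuffle can only merge rows and columns. *)
Lemma qshuffle_support a b c : (qshu a b)@_c != 0 ->
  (nrows c <= nrows a + nrows b)%N /\ (ncols c <= ncols a + ncols b)%N.
Proof.
have [->|ae] := eqVneq a ecomp.
  by rewrite /qshuffle eqxx mcoeffU /= !add0n; case: (b =P c) => [->|]; rewrite ?eqxx.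
have [->|be] := eqVneq b ecomp.
  rewrite /qshuffle eqxx (negPf ae) mcoeffU /= !addn0.
  by case: (a =P c) => [->|]; rewrite ?eqxx.
rewrite qshuffle_coef // => ne; split; rewrite leqNgt; apply: contra ne => lt; apply/eqP.
  rewrite big_nat big1 // => j /andP[_ jm]; rewrite big1 // => k _.
  rewrite big1 // => p _; rewrite big1 // => q _; case: eqP => // E.
  by move: jm lt; rewrite -E ltnS /= leqNgt => /negPf ->.
rewrite big1 // => j _; rewrite big_nat big1 // => k /andP[_ km].
rewrite big1 // => p _; rewrite big1 // => q _; case: eqP => // E.
by move: km lt; rewrite -E ltnS /= leqNgt => /negPf ->.
Qed.

(** The terms of the quasi-shuffle without merged rows or columns come from
    bijective quasi-shuffles, which are the shuffle permutations. *)
Lemma shuffle_coef a b c : (shu a b)@_c =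
  if (nrows c == nrows a + nrows b)%N && (ncols c == ncols a + ncols b)%N
  then (qshu a b)@_c else 0.
Proof.
have [->|ae] := eqVneq a ecomp.
  rewrite /shuffle /qshuffle eqxx mcoeffU /= !add0n; case: (b =P c) => [->|]; rewrite ?eqxx //.
  by rewrite if_same.
have [->|be] := eqVneq b ecomp.
  rewrite /shuffle /qshuffle eqxx (negPf ae) mcoeffU /= !addn0.
  by case: (a =P c) => [->|]; rewrite ?eqxx // if_same.
rewrite {1}/shuffle (negPf ae) (negPf be) mcoeff_sum.
have rpos e : e != ecomp -> (0 < nrows e)%N.
  by move=> /eqP xe; rewrite lt0n; apply/eqP => /nrows_eq0.
have cpos e : e != ecomp -> (0 < ncols e)%N.
  by move=> /rpos/row_ex[y yc _]; apply: leq_ltn_trans (leq0n y) yc.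
case: ifP => [/andP[/eqP cr /eqP cc]|ne]; last first.
  rewrite big1 // => p _; rewrite mcoeff_sum big1 // => q _; rewrite mcoeffU.
  by case: eqP => // E; move: ne; rewrite -E /= !eqxx.
rewrite qshuffle_coef // (bigD1_seq (nrows a + nrows b)%N) ?iota_uniq //=; last first.
  by rewrite mem_index_iota ltnSn andbT ltn_addr ?rpos.
rewrite [X in _ = _ + X]big1 ?addr0; last first.
  move=> j ne; rewrite big1 // => k _; rewrite big1 // => p _; rewrite big1 // => q _.
  by case: eqP => // E; move: ne; rewrite -cr -E eqxx.
rewrite (bigD1_seq (ncols a + ncols b)%N) ?iota_uniq //=; last first.
  by rewrite mem_index_iota ltnSn andbT ltn_addr ?cpos.
rewrite [X in _ = _ + X]big1 ?addr0; last first.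
  move=> k ne; rewrite big1 // => p _; rewrite big1 // => q _.
  by case: eqP => // E; move: ne; rewrite -cc -E eqxx.
rewrite sum_perm_qsh; apply: eq_bigr => p _.
rewrite mcoeff_sum sum_perm_qsh; apply: eq_bigr => q _.
by rewrite mcoeffU qs_comp_perm.
Qed.

Definition graded (r k : nat) : H -> H :=
  lin_ext (fun c => if (nrows c == r) && (ncols c == k) then << c >> else 0).

HB.instance Definition _ r k := GRing.isLinear.Build K H H *:%R
  (graded r k) (lin_ext_is_linear _).

Lemma mcoeff_graded r k x c :
  (graded r k x)@_c = if (nrows c == r) && (ncols c == k) then x@_c else 0.
Proof.
apply: (linear_malg_ext (V := K^o) (f := fun x => (graded r k x)@_c)
  (g := fun x => if (nrows c == r) && (ncols c == k) then x@_c else 0)).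
- by move=> t y z; rewrite linearP mcoeffD mcoeffZ.
- by move=> t y z; case: ifP; rewrite ?mcoeffD ?mcoeffZ ?scaler0 ?addr0.
move=> a; rewrite /graded lin_extU mcoeffU.
have [->|ac] := eqVneq a c; first by case: ifP; rewrite ?mcoeffUU ?mcoeff0.
by case: ifP; rewrite ?mcoeff0 ?mcoeffU ?(negPf ac) if_same.
Qed.

Lemma shuffle_graded a b :
  shu a b = graded (nrows a + nrows b) (ncols a + ncols b) (qshu a b).
Proof. by apply/malgP => c; rewrite shuffle_coef mcoeff_graded. Qed.

Lemma shuffle_comm a b : shu a b = shu b a.
Proof.
rewrite !shuffle_graded (qshuffle_comm_assoc K d).1 addnC.
by rewrite [X in graded _ X]addnC.
Qed.

(** Lower components of [x] cannot reach the leading degree of the product, so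
    leading parts may be taken before or after multiplying. *)
Lemma mul_shuffle_graded r k x e :
  (forall c, x@_c != 0 -> (nrows c <= r)%N /\ (ncols c <= k)%N) ->
  mul shu (graded r k x) << e >> = graded (r + nrows e) (k + ncols e) (mul qshu x << e >>).
Proof.
move=> xs; rewrite (malg_sum x) linear_sum !mul_suml linear_sum big_seq [RHS]big_seq.
apply: eq_bigr => c; rewrite -mcoeff_neq0 => /xs[cr ck].
rewrite linearZ /= !mulZl linearZ /= mulUU; congr (_ *: _).
rewrite {1}/graded lin_extU; case: ifP => [/andP[/eqP <- /eqP <-]|ne].
  by rewrite mulUU shuffle_graded.
rewrite mul0l; apply/malgP => c'; rewrite mcoeff_graded mcoeff0.
case: ifP => // /andP[/eqP er /eqP ec]; apply/eqP; apply: contraFT ne.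
rewrite eq_sym => /qshuffle_support[]; rewrite er ec !leq_add2r => h1 h2.
by rewrite !eqn_leq cr ck h1 h2.
Qed.

Lemma shuffle_comm_assoc : comm_assoc_product shu.
Proof.
split; first exact: shuffle_comm.
have [qC qA] := qshuffle_comm_assoc K d.
move=> a b e; rewrite [RHS]mulHC; last exact: shuffle_comm.
rewrite !shuffle_graded !mul_shuffle_graded; try by move=> c /qshuffle_support.
rewrite qA [in RHS]mulHC //; congr (graded _ _ _).
  by rewrite -addnA addnC.
by rewrite -addnA addnC.
Qed.

(** [diag] adds numbers of rows and of columns, so a product of two
    coefficients of quasi-shuffles has leading total degree iff both factors
    have leading degree. *)
Lemma shuffle_bialgebra : bialgebra_product shu.
Proof.
split=> [a|a|].
- by rewrite /shuffle eqxx.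
- by rewrite /shuffle; case: eqVneq => [->|_] //; rewrite eqxx.
split=> [[a b]|u c _ [a b]].
  rewrite /coefs2 shuffle_coef qshuffle_counit /delta_e xpair_eqE /=.
  case: (a =P ecomp) => [->|_] /=; last by rewrite if_same.
  by case: (b =P ecomp) => [->|_] /=; rewrite ?if_same.
rewrite /coefs2 shuffle_coef qshuffle_diag /convol /= /splits2 big_allpairs_dep /=.
set t := (_ && _).
transitivity (\sum_(p <- splits a) \sum_(q <- splits b)
  (if t then (qshu p.1 q.1)@_u * (qshu p.2 q.2)@_c else 0)).
  case: t; first by [].
  by rewrite big1 // => p _; rewrite big1.
rewrite big_seq [RHS]big_seq; apply: eq_bigr => p; rewrite mem_splits => /eqP pa.
rewrite big_seq [RHS]big_seq; apply: eq_bigr => q; rewrite mem_splits => /eqP qb.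
rewrite !shuffle_coef.
have [->|n1] := eqVneq (qshu p.1 q.1)@_u 0; first by rewrite !(mul0r, if_same).
have [->|n2] := eqVneq (qshu p.2 q.2)@_c 0; first by rewrite !(mulr0, if_same).
have [r1 k1] := qshuffle_support n1; have [r2 k2] := qshuffle_support n2.
have key (u1 u2 v1 v2 : nat) : (u1 <= v1)%N -> (u2 <= v2)%N ->
    (u1 + u2 == v1 + v2)%N = (u1 == v1) && (u2 == v2).
  move=> h1 h2; apply/eqP/andP => [E|[/eqP -> /eqP -> //]].
  rewrite !eqn_leq h1 h2 /=; split.
    by rewrite -(leq_add2r u2) E leq_add2l.
  by rewrite -(leq_add2l u1) E leq_add2r.
have -> : t = [&& nrows u == (nrows p.1 + nrows q.1)%N, nrows c == (nrows p.2 + nrows q.2)%N,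
   ncols u == (ncols p.1 + ncols q.1)%N & ncols c == (ncols p.2 + ncols q.2)%N].
  rewrite /t -pa -qb /= addnACA [X in _ && (_ == X)]addnACA !key //.
  by rewrite -!andbA.
by case: (_ == _); case: (_ == _); case: (_ == _); case: (_ == _); rewrite /= ?mulr0 ?mul0r.
Qed.

End ShuffleBialgebra.

(** * Logarithm and exponential for the two-parameter shuffles *)

Theorem theorem5p4 (K : comAlgType rat) (d : nat) (d_gt0 : (0 < d)%N)
    (m : product K d) (hm : m = @shuffle K d \/ m = @qshuffle K d) :
  let bsh : product K d := @bshuffle K d in
  let pi : nat -> H K d -> H K d := @proj_blocks K d in
  let Log : H K d -> H K d := LogH m in
  [/\ bialgebra_map m bsh Log,
      forall x : H K d, counit x = 0 -> pi 1%N (Log x) = pi 1%N (eulerian m x)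
    & forall L : H K d -> H K d, unital_coalgebra_map L ->
        (forall x : H K d, counit x = 0 -> pi 1%N (L x) = pi 1%N (eulerian m x)) ->
        L =1 Log] /\
  exists Exp : H K d -> H K d,
    [/\ cancel Log Exp, cancel Exp Log, bialgebra_map bsh m Exp,
        forall (k : nat) (a : H K d), pi k (Exp (pi k a)) = pi k a
      & forall (n k : nat) (a : H K d), (0 < n)%N -> (n < k)%N ->
          pi n (Exp (pi k a)) =
          - \sum_(n <= j < k) pi n (Exp (pi j (Log (pi k a))))].
Proof.
case: hm => ->; apply: Log_isomorphism.
- exact: shuffle_bialgebra.
- exact: shuffle_comm_assoc.
- exact: qshuffle_bialgebra.
- exact: qshuffle_comm_assoc.
Qed.
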